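(* Assume that $\mathcal L^d(\Omega)=\mathcal L^d(\Lambda)$, that $(f,\mathcal S)$ satisfies (A1) and $F$ satisfies (A3) (recalled in the context). Assume that $\mathcal S$ is a finite dimensional non-empty closed and convex subset of $W_0^{1,q}(\Omega,\mathbb R^{d\times d})$ and that $F+\operatorname{div}\varphi$ is non-degenerate for every $\varphi\in\mathcal S$. Then the problems $$(P_0)\quad\inf_{u\in\mathscr U^1_{\mathcal S}}I_0(u),\qquad I_0(u)=V^f_{\mathcal S}(u)-\int_\Omega F\cdot u\,dx,$$ and $$(D_0)\quad\sup_{(k,l,\varphi)\in A_0}\big(-J(k,l,\varphi)\big),\qquad J(k,l,\varphi)=\int_\Omega k(F+\operatorname{div}\varphi)\,dx+\int_\Lambda l(y)\,dy+\int_\Omega f^*(\varphi)\,dx,$$ are dual (the infimum in $(P_0)$ equals the supremum in $(D_0)$). Problem $(D_0)$ admits a maximizer $(k_0,l_0,\varphi_0)$ with $k_0=l_0^*$ and $l_0=(k_0)^*$. Problem $(P_0)$ admits a unique minimizer $u_0$. Moreover, $u_0$ satisfies $$u_0=\nabla k_0(F+\operatorname{div}\varphi_0)\quad\text{a.e. in }\Omega,\qquad\varphi_0\in\Phi_{\mathcal S}(u_0).$$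
   Context: Domains: $\Omega,\Lambda\subset\mathbb R^d$ are bounded open convex sets; $r^*>1$ is such that $B(0,1/r^* )\subset\Lambda\subset B(0,r^*/2)$; $p\in(1,\infty)$ and $1/p+1/q=1$. For matrix fields $\varphi$, $\operatorname{div}\varphi$ is the row-wise divergence. ''Finite dimensional'' for a subset $\mathcal S$ means that its linear span is finite dimensional. Non-degeneracy: a measurable map $G:\Omega\to\mathbb R^d$ is non-degenerate if $\mathcal L^d(G^{-1}(N))=0$ for every $N\subset\mathbb R^d$ with $\mathcal L^d(N)=0$. $^*$ denotes the Legendre transform (on $\mathbb R^{d\times d}$ for $f$, on $\mathbb R^d$ for $k,l$), e.g. $f^*(\xi^* )=\sup_{\xi}\{\xi\cdot\xi^*-f(\xi)\}$. For a convex $h$, $grad[h](x)$ denotes the element of minimal norm of $\partial h(x)$ when it is non-empty. (A1): $\mathcal S\subset W_0^{1,q}(\Omega,\mathbb R^{d\times d})$, $f:\mathbb R^{d\times d}\to\mathbb R$ is convex and: (i) there are $a,b,c>0$ with $c|\xi|^p/p+b\ge f(\xi)\ge a|\xi|-b$ for all $\xi$, and $|\xi^*|^q\le c|\xi|^p+b$ for all $\xi$ and all $\xi^*\in\partial f(\xi)$; (ii) the set $\mathscr S_f=\{\varphi\in\mathcal S:\int_\Omega f^*(\varphi)\,dx\text{ is finite}\}$ is non-empty; (iii) either (a) for each $x^*\in\mathrm{Dom} f^*$, $\partial f^*(x^* )\neq\emptyset$ and $grad[f^*](x^* )=0$; or (b) $f$ is strictly convex and there are $\bar a,\bar b>0$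 with $f^*(\xi^* )\le\bar a+\bar b|\xi^*|^q$ and $|\nabla f^*(\xi^* )|\le\bar a+\bar b|\xi^*|^{q-1}$ for all $\xi^*$. (A3): $F:\Omega\to\mathbb R^d$ is measurable and belongs to $L^1(\Omega)$. $\mathscr U_{\mathcal S}$ is the set of measurable $u:\Omega\to\bar\Lambda$ for which there is $\bar c>0$ (depending on $u,\Omega,\Lambda$) with $|\int_\Omega u\cdot\operatorname{div}\varphi\,dx|\le\bar c\|\varphi\|_{L^q}$ for all $\varphi\in\mathcal S$. $\mathscr U^1_{\mathcal S}=\{u\in\mathscr U_{\mathcal S}:\int_\Omega l(u(x))\,dx=\int_\Lambda l(y)\,dy\ \ \forall l\in C_c(\mathbb R^d)\}$. $V^f_{\mathcal S}(u)=\sup_{\varphi\in\mathcal S}\int_\Omega(-u\cdot\operatorname{div}\varphi-f^*(\varphi))\,dx$, and $\Phi_{\mathcal S}(u)$ is the set of maximizers of this problem. $A_0$ is the set of triples $(k,l,\varphi)$ with $\varphi\in\mathcal S$, $k:\mathbb R^d\to\mathbb R$ Borel measurable, $l:\mathbb R^d\to\mathbb R\cup\{\infty\}$ Borel measurable with $l\equiv\infty$ on $\mathbb R^d\setminus\bar\Lambda$, $l$ (finite and) continuous on $\Lambda$, $\inf_\Lambda l=0$, and $k(v)+l(u)\ge u\cdot v$ for all $u\in\bar\Lambda$, $v\in\mathbb R^d$. *)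

(* Defs.v *)
From HB Require Import structures.
From mathcomp Require Import all_boot all_order all_algebra.
From mathcomp Require Import all_classical all_reals all_analysis.
From mathcomp Require Import measurable_realfun.
Set Implicit Arguments.
Unset Strict Implicit.
Unset Printing Implicit Defensive.
Import Order.TTheory GRing.Theory Num.Theory.
Import numFieldNormedType.Exports.
Local Open Scope classical_set_scope.
Local Open Scope ring_scope.

Fact borel_mx_display : measure_display.
Proof. exact: default_measure_display. Qed.

Section borel_matrix.
Context (R : realType) (m n : nat).
Notation borel := (<<s @open 'M[R]_(m, n) >>).

Let borel0 : borel set0.
Proof. exact: sigma_algebra0. Qed.

Let borelC A : borel A -> borel (~` A).
Proof. exact: sigma_algebraC. Qed.

Let borelU (F : (set 'M[R]_(m, n))^nat) :
  (forall i, borel (F i)) -> borel (\bigcup_i F i).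
Proof. exact: sigma_algebra_bigcup. Qed.

HB.instance Definition _ := @isMeasurable.Build borel_mx_display
  'M[R]_(m, n) borel borel0 borelC borelU.

Lemma open_measurable_mx (A : set 'M[R]_(m, n)) : open A -> measurable A.
Proof. exact: sub_sigma_algebra. Qed.

Lemma measurable_coord (i : 'I_m) (j : 'I_n) :
  measurable_fun setT (fun M : 'M[R]_(m, n) => M i j).
Proof.
apply: (measurability _ (RGenOInfty.measurableE R)) => _ [_ [a ->]] <-.
rewrite setTI; apply: open_measurable_mx.
have /continuousP := @coord_continuous R m n i j; apply.
exact: interval_open.
Qed.

Lemma measurable_fun_mxP d (T : measurableType d) (f : T -> 'M[R]_(m, n)) :
  measurable_fun setT f <->
  forall i j, measurable_fun setT (fun x => f x i j).
Proof.
split=> [mf i j|mf]; first exact: (measurableT_comp (measurable_coord i j) mf).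
apply: (@measurability _ _ T 'M[R]_(m, n) setT f (@open 'M[R]_(m, n))) => //.
move=> _ [U oU <-]; rewrite setTI.
pose B (c : 'M[rat]_(m, n) * nat) : set 'M[R]_(m, n) :=
  [set M | forall i j, `|ratr (c.1 i j) - M i j| < c.2.+1%:R^-1].
have -> : f @^-1` U = \bigcup_c (if `[< B c `<=` U >] then f @^-1` B c else set0).
  apply/seteqP; split=> [x /= Ufx|x [c _]]; last first.
    by case: ifPn => // /asboolP sub Bx; exact: sub.
  have /nbhs_ballP[e /= e0 ballU] : nbhs (f x) U by exact: open_nbhs_nbhs.
  have e20 : 0 < e / 2 by rewrite divr_gt0.
  have [k _ /(_ _ (leqnn _)) ke] := near_infty_natSinv_lt (PosNum e20).
  rewrite /= in ke.
  have k0 : 0 < k.+1%:R^-1 :> R by rewrite invr_gt0.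
  have q i j : {q : rat | `|ratr q - f x i j| < k.+1%:R^-1}.
    apply: cid.
    have fxk : f x i j - k.+1%:R^-1 < f x i j + k.+1%:R^-1.
      by rewrite ltrBlDr -addrA ltrDl addr_gt0.
    have [q] := rat_in_itvoo fxk.
    by rewrite in_itv/= => /andP[q1 q2]; exists q; rewrite ltr_distl q1.
  exists (\matrix_(i, j) sval (q i j), k) => //=.
  rewrite asboolT; last first.
    move=> M BM; apply: ballU; split=> [//|i j].
    have := BM i j; rewrite /= mxE => BMij.
    apply: (le_lt_trans (ler_distD (ratr (sval (q i j))) _ _)).
    rewrite [ltRHS]splitr ltrD//; last exact: lt_trans ke.
    by rewrite distrC (lt_trans (svalP (q i j)) ke).
  by move=> i j; rewrite mxE; exact: (svalP (q i j)).
apply: countable_bigcupT_measurable => // c.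
case: ifPn => // _.
have -> : f @^-1` B c = \bigcap_(i in [set: 'I_m]) \bigcap_(j in [set: 'I_n])
    ((fun x => f x i j) @^-1` ball (ratr (c.1 i j) : R) c.2.+1%:R^-1).
  by apply/seteqP; split=> [x Bx i _ j _|x Bx i j]; [exact: Bx|exact: Bx].
apply: fin_bigcap_measurable => // i _; apply: fin_bigcap_measurable => // j _.
by rewrite -[X in measurable X]setTI; apply: mf => //; exact: measurable_ball.
Qed.

End borel_matrix.

Section lebesgue_step.
Context (R : realType) (n : nat) (mu : {sigma_finite_measure set 'rV[R]_n -> \bar R}).
Local Open Scope ereal_scope.

Definition rV_cons (p : measurableTypeR R * 'rV[R]_n) : 'rV[R]_(1 + n) :=
  row_mx (\row__ p.1) p.2.

Lemma measurable_rV_cons : measurable_fun setT rV_cons.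
Proof.
apply/measurable_fun_mxP => i j; rewrite /rV_cons.
case: (splitP j) => k jk.
  rewrite (_ : (fun x => _) = fst)//.
  apply/funext => x; rewrite (_ : j = lshift n k) ?row_mxEl ?mxE//.
  exact/val_inj.
rewrite (_ : (fun x => _) = (fun M : 'rV[R]_n => M i k) \o snd).
  exact: measurableT_comp (measurable_coord _ _) _.
apply/funext => x; rewrite (_ : j = rshift 1 k) ?row_mxEr//.
exact/val_inj.
Qed.

Definition lebesgue_step : set 'rV[R]_(1 + n) -> \bar R :=
  pushforward (@lebesgue_measure R \x mu) rV_cons.

Let lebesgue_step0 : lebesgue_step set0 = 0.
Proof. by rewrite /lebesgue_step /pushforward preimage_set0 measure0. Qed.

Let lebesgue_step_ge0 A : 0 <= lebesgue_step A.
Proof. exact: (measure_ge0 (@lebesgue_measure R \x mu)). Qed.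

Let lebesgue_step_sigma_additive : semi_sigma_additive lebesgue_step.
Proof.
move=> F mF tF mUF; rewrite /lebesgue_step /pushforward preimage_bigcup.
have mpre A : measurable A -> measurable (rV_cons @^-1` A).
  by move=> mA; rewrite -[X in measurable X]setTI; exact: measurable_rV_cons.
apply: measure_semi_sigma_additive.
- by move=> k; exact: mpre.
- apply/trivIsetP => /= i j _ _ ij; rewrite -preimage_setI.
  by move/trivIsetP : tF => /(_ _ _ _ _ ij) ->//; rewrite preimage_set0.
- by rewrite -preimage_bigcup; exact: mpre.
Qed.

HB.instance Definition _ := isMeasure.Build _ _ _ lebesgue_step
  lebesgue_step0 lebesgue_step_ge0 lebesgue_step_sigma_additive.

Lemma lebesgue_step_setX (A : set R) (B : set 'rV[R]_n) :
  measurable A -> measurable B ->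
  lebesgue_step [set x : 'rV[R]_(1 + n) | A (x ord0 ord0) /\ B (rsubmx x)] =
  @lebesgue_measure R A * mu B.
Proof.
move=> mA mB; rewrite -product_measure1E//; congr (_ \x _).
have cons0 x y : rV_cons (x, y) ord0 ord0 = x.
  have -> : ord0 = lshift n ord0 :> 'I_(1 + n) by exact/val_inj.
  by rewrite row_mxEl mxE.
have consr x y : rsubmx (rV_cons (x, y)) = y by rewrite row_mxKr.
by apply/seteqP; split=> -[x y] /=; rewrite cons0 consr.
Qed.

Let lebesgue_step_sigma_finite : sigma_finite setT lebesgue_step.
Proof.
have /sigma_finiteP[F [TF ndF Foo]] := sigma_finiteT mu.
have /sigma_finiteP[G [TG ndG Goo]] := sigma_finiteT (@lebesgue_measure R).
exists (fun k => [set x : 'rV[R]_(1 + n) | G k (x ord0 ord0) /\ F k (rsubmx x)]).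
  apply/esym/seteqP; split=> // x _.
  have : setT (x ord0 ord0) by []. rewrite TG => -[i _ Gi].
  have : setT (rsubmx x) by []. rewrite TF => -[j _ Fj].
  exists (maxn i j) => //; split.
    by move: Gi; exact/subsetPset/ndG/leq_maxl.
  by move: Fj; exact/subsetPset/ndF/leq_maxr.
move=> k; have [mF Fk] := Foo k; have [mG Gk] := Goo k; split; last first.
  by rewrite lebesgue_step_setX// lte_mul_pinfty// ge0_fin_numE.
rewrite (_ : [set _ | _] = (fun x : 'rV[R]_(1 + n) => x ord0 ord0) @^-1` G k `&`
    @rsubmx R 1 1 n @^-1` F k)//.
apply: measurableI.
  by rewrite -[X in measurable X]setTI; apply: measurable_coord.
rewrite -[X in measurable X]setTI; apply: (_ : measurable_fun setT _) => //.
apply/measurable_fun_mxP => i j.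
rewrite (_ : (fun x => _) = fun x : 'rV[R]_(1 + n) => x i (rshift 1 j)).
  exact: measurable_coord.
by apply/funext => x; rewrite mxE.
Qed.

HB.instance Definition _ := @Measure_isSigmaFinite.Build _ _ _
  lebesgue_step lebesgue_step_sigma_finite.

End lebesgue_step.

(** Iterated product of the one-dimensional Lebesgue measure, on Borel sets; it
    is determined by its values on boxes, [lebesgue_rV_box]. *)
Fixpoint lebesgue_rV (R : realType) (n : nat) :
    {sigma_finite_measure set 'rV[R]_n -> \bar R} :=
  match n with
  | 0%N => \d_(0 : 'rV[R]_0)
  | n'.+1 => (lebesgue_step (lebesgue_rV R n')
      : {sigma_finite_measure set 'rV[R]_(1 + n') -> \bar R})
  end.

Lemma lebesgue_rV_box (R : realType) (n : nat) (a b : 'rV[R]_n) :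
  (forall i, a ord0 i <= b ord0 i) ->
  lebesgue_rV R n [set x | forall i, x ord0 i \in `[a ord0 i, b ord0 i]] =
  (\prod_i (b ord0 i - a ord0 i))%:E.
Proof.
elim: n a b => [|n IHn] a b ab.
  by rewrite big_ord0 /= diracE mem_set//= => -[].
rewrite big_ord_recl EFinM.
pose a' : 'rV[R]_n := \row_i a ord0 (lift ord0 i).
pose b' : 'rV[R]_n := \row_i b ord0 (lift ord0 i).
have -> : (\prod_(i < n) (b ord0 (lift ord0 i) - a ord0 (lift ord0 i)))%:E =
    lebesgue_rV R n [set x | forall i, x ord0 i \in `[a' ord0 i, b' ord0 i]].
  rewrite IHn; last by move=> i; rewrite !mxE.
  by congr EFin; apply: eq_bigr => i _; rewrite !mxE.
have -> : (b ord0 ord0 - a ord0 ord0)%:E =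
    @lebesgue_measure R `[a ord0 ord0, b ord0 ord0]%classic.
  rewrite lebesgue_measure_itv/= lte_fin -EFinB; case: ltP => // ba.
  by rewrite (le_anti (introT andP (conj ba (ab ord0)))) subrr.
rewrite -lebesgue_step_setX//; last first.
  rewrite [X in measurable X](_ : _ = \bigcap_(i in [set: 'I_n])
      ((fun x : 'rV[R]_n => x ord0 i) @^-1` `[a' ord0 i, b' ord0 i])).
    apply: fin_bigcap_measurable => // i _.
    by rewrite -[X in measurable X]setTI; exact: measurable_coord.
  by apply/seteqP; split=> [x xab i _|x xab i]; exact: xab.
rewrite [lebesgue_rV R n.+1]/=; congr (lebesgue_step _ _).
apply/seteqP; split=> [x /= xab|x /= [x0 xab] i].
  split; first exact: xab.
  move=> i; rewrite !mxE (_ : rshift 1 i = lift ord0 i)//; exact/val_inj.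
case: (unliftP ord0 i) => [j ->|->//].
have := xab j; rewrite !mxE (_ : rshift 1 j = lift ord0 j)//; exact/val_inj.
Qed.

(** Euclidean structure.  The norm [`|x|] of the library on matrices is the
    sup norm: it induces the same topology, but the Euclidean (Frobenius) norm
    [enorm] is the one that appears in the estimates. *)
Section euclidean.
Context (R : realType) (m n : nat).
Implicit Types (A B : 'M[R]_(m, n)).

Definition dot A B : R := \sum_i \sum_j A i j * B i j.

Definition enorm A : R := Num.sqrt (dot A A).

Definition eball A (r : R) : set 'M[R]_(m, n) := [set B | enorm (B - A) < r].

Definition is_gradient (f : 'M[R]_(m, n) -> R) A (g : 'M[R]_(m, n)) : Prop :=
  differentiable (f : _ -> R^o) A /\
  forall v, 'd (f : _ -> R^o) A v = dot g v.

End euclidean.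

Section convex_analysis.
Context (R : realType) (m n : nat).
Implicit Types (h : 'M[R]_(m, n) -> \bar R) (f : 'M[R]_(m, n) -> R).
Implicit Types (x y g : 'M[R]_(m, n)).
Local Open Scope ereal_scope.

Definition legendre h : 'M[R]_(m, n) -> \bar R :=
  fun y => ereal_sup [set (dot x y)%:E - h x | x in setT].

Definition effective_domain h : set 'M[R]_(m, n) := [set x | h x < +oo].

Definition subdifferential h x : set 'M[R]_(m, n) :=
  [set g | h x \is a fin_num /\ forall y, h x + (dot g (y - x))%:E <= h y].

Definition min_norm_subgradient h x g : Prop :=
  subdifferential h x g /\
  forall g', subdifferential h x g' -> (enorm g <= enorm g')%R.

Definition strictly_convex f : Prop :=
  forall x y (t : R), x != y -> (0 < t < 1)%R ->
    (f (t *: x + (1 - t) *: y) < t * f x + (1 - t) * f y)%R.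

End convex_analysis.

(** Functions on a domain [Omega] are represented by Borel functions on the
    whole space, of which only the values on [Omega] matter, up to equality
    almost everywhere. *)
Section sobolev.
Context (R : realType) (d : nat).
Notation E := 'rV[R]_d.
Notation leb := (lebesgue_rV R d).
Implicit Types (Omega : set E) (q : R) (j : 'I_d).

Definition locally_integrable_on Omega (f : E -> R) : Prop :=
  forall K : set E, compact K -> K `<=` Omega ->
    leb.-integrable K (EFin \o f).

Definition partial j (f : E -> R) : E -> R :=
  fun x => 'D_(delta_mx ord0 j) (f : E -> R^o) x.

Definition smooth (f : E -> R) : Prop :=
  forall (s : seq 'I_d) (x : E), differentiable (foldr partial f s : E -> R^o) x.

Definition test_function Omega (psi : E -> R) : Prop :=
  [/\ smooth psi, compact (closure [set x | psi x != 0]) &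
      closure [set x | psi x != 0] `<=` Omega].

Definition is_weak_partial Omega j (f g : E -> R) : Prop :=
  [/\ locally_integrable_on Omega f, locally_integrable_on Omega g &
      forall psi, test_function Omega psi ->
        (\int[leb]_(x in Omega) (f x * partial j psi x)%:E =
         - \int[leb]_(x in Omega) (g x * psi x)%:E)%E].

(** Weak derivatives are unique almost everywhere; [weak_partial] chooses a
    representative, and is meaningful only when a weak derivative exists. *)
Definition weak_partial Omega j (f : E -> R) : E -> R :=
  xget (cst 0) [set g | is_weak_partial Omega j f g].

Definition Lq_norm m n Omega q (phi : E -> 'M[R]_(m, n)) : \bar R :=
  Lnorm leb q%:E ((fun x => (enorm (phi x))%:E) \_ Omega).

Definition in_Lq m n Omega q (phi : E -> 'M[R]_(m, n)) : Prop :=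
  measurable_fun Omega phi /\ (Lq_norm Omega q phi < +oo)%E.

Definition weak_partial_mx m n Omega j (phi : E -> 'M[R]_(m, n)) :
    E -> 'M[R]_(m, n) :=
  fun x => \matrix_(a, b) weak_partial Omega j (fun y => phi y a b) x.

Definition W1q m n Omega q : set (E -> 'M[R]_(m, n)) :=
  [set phi | in_Lq Omega q phi /\
    forall j, (forall a b, exists g,
                 is_weak_partial Omega j (fun x => phi x a b) g) /\
              in_Lq Omega q (weak_partial_mx Omega j phi)].

(** Equivalent to the [q]-th root of the sum of the [q]-th powers. *)
Definition W1q_norm m n Omega q (phi : E -> 'M[R]_(m, n)) : \bar R :=
  (Lq_norm Omega q phi +
   \sum_(j < d) Lq_norm Omega q (weak_partial_mx Omega j phi))%E.

(** Closure of the test functions in [W1q]. *)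
Definition W01q m n Omega q : set (E -> 'M[R]_(m, n)) :=
  [set phi | W1q Omega q phi /\
    forall eps : R, 0 < eps -> exists psi : E -> 'M[R]_(m, n),
      (forall a b, test_function Omega (fun x => psi x a b)) /\
      (W1q_norm Omega q (psi \- phi)%R < eps%:E)%E].

Definition wdiv Omega (phi : E -> 'M[R]_d) : E -> 'rV[R]_d :=
  fun x => \row_i \sum_j weak_partial Omega j (fun y => phi y i j) x.

(** Closedness in [W1q] makes [S] saturated for equality almost everywhere. *)
Definition closed_in_W01q m n Omega q (S : set (E -> 'M[R]_(m, n))) : Prop :=
  forall phi, W01q Omega q phi ->
    (forall eps : R, 0 < eps ->
      exists2 psi, S psi & (W1q_norm Omega q (psi \- phi)%R < eps%:E)%E) ->
    S phi.

Definition linear_span m n (S : set (E -> 'M[R]_(m, n))) :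
    set (E -> 'M[R]_(m, n)) :=
  [set chi | exists (k : nat) (c : 'I_k -> R) (e : 'I_k -> E -> 'M[R]_(m, n)),
    (forall i, S (e i)) /\ chi = (fun x => \sum_(i < k) c i *: e i x)].

(** The span is taken in a space of functions modulo equality almost
    everywhere on [Omega]. *)
Definition finite_dimensional m n Omega (S : set (E -> 'M[R]_(m, n))) : Prop :=
  exists (k : nat) (e : 'I_k -> E -> 'M[R]_(m, n)),
    (forall i, linear_span S (e i)) /\
    forall chi, linear_span S chi -> exists c : 'I_k -> R,
      {ae leb, forall x, Omega x -> chi x = \sum_(i < k) c i *: e i x}.

Definition nondegenerate_map Omega (G : E -> E) : Prop :=
  measurable_fun Omega G /\
  forall N : set E, leb.-negligible N -> leb.-negligible (Omega `&` G @^-1` N).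

End sobolev.

Section problem.
Context (R : realType) (d : nat).
Notation E := 'rV[R]_d.
Notation Mx := 'M[R]_d.
Notation leb := (lebesgue_rV R d).
Implicit Types (Omega Lambda : set E) (p q : R) (f : Mx -> R).
Implicit Types (S : set (E -> Mx)) (F u : E -> E) (phi : E -> Mx).
Local Open Scope ereal_scope.

Definition conjugate f : Mx -> \bar R := legendre (EFin \o f).

Definition finite_energy Omega f S : set (E -> Mx) :=
  [set phi | S phi /\ \int[leb]_(x in Omega) conjugate f (phi x) \is a fin_num].

Definition growth_conditions p q f : Prop :=
  exists a b c : R, [/\ (0 < a)%R, (0 < b)%R, (0 < c)%R,
    (forall xi, (a * enorm xi - b <= f xi)%R /\
                (f xi <= c * enorm xi `^ p / p + b)%R) &
    (forall xi xs, subdifferential (EFin \o f) xi xs ->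
       (enorm xs `^ q <= c * enorm xi `^ p + b)%R)].

Definition conjugate_flat f : Prop :=
  forall xs, effective_domain (conjugate f) xs ->
    subdifferential (conjugate f) xs !=set0 /\
    min_norm_subgradient (conjugate f) xs 0%R.

Definition conjugate_smooth q f : Prop :=
  strictly_convex f /\
  exists a b : R, [/\ (0 < a)%R, (0 < b)%R,
    (forall xs, conjugate f xs <= (a + b * enorm xs `^ q)%:E) &
    (forall xs, exists2 g, is_gradient (fine \o conjugate f) xs g &
       (enorm g <= a + b * enorm xs `^ (q - 1))%R)].

Definition A1 Omega p q f S : Prop :=
  [/\ S `<=` W01q Omega q,
      convex_function (setT : set (convex_lmodType Mx)) f,
      growth_conditions p q f,
      finite_energy Omega f S !=set0 &
      conjugate_flat f \/ conjugate_smooth q f].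

Definition A3 Omega F : Prop :=
  measurable_fun Omega F /\
  leb.-integrable Omega (fun x => (enorm (F x))%:E).

Definition U_S Omega Lambda q S : set (E -> E) :=
  [set u | [/\ measurable_fun Omega u,
     (forall x, Omega x -> closure Lambda (u x)) &
     exists c : R, (0 < c)%R /\ forall phi, S phi ->
       `| \int[leb]_(x in Omega) (dot (u x) (wdiv Omega phi x))%:E |
         <= c%:E * Lq_norm Omega q phi]].

Definition U1_S Omega Lambda q S : set (E -> E) :=
  [set u | U_S Omega Lambda q S u /\
     forall l : E -> R, continuous l -> compact (closure [set x | l x != 0%R]) ->
       \int[leb]_(x in Omega) (l (u x))%:E = \int[leb]_(y in Lambda) (l y)%:E].

Definition V_integral Omega f u phi : \bar R :=
  \int[leb]_(x in Omega)
    ((- dot (u x) (wdiv Omega phi x))%:E - conjugate f (phi x)).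

Definition V Omega f S u : \bar R :=
  ereal_sup [set V_integral Omega f u phi | phi in S].

Definition Phi Omega f S u : set (E -> Mx) :=
  [set phi | S phi /\ V_integral Omega f u phi = V Omega f S u].

Definition I0 Omega f S F u : \bar R :=
  V Omega f S u - \int[leb]_(x in Omega) (dot (F x) (u x))%:E.

Definition A0 Lambda S (k : E -> R) (l : E -> \bar R) phi : Prop :=
  [/\ S phi, measurable_fun [set: E] k &
  [/\ measurable_fun [set: E] l,
      (forall y, l y != -oo),
      (forall y, ~ closure Lambda y -> l y = +oo),
      (forall y, Lambda y -> l y \is a fin_num) /\
        {within Lambda, continuous l} &
      ereal_inf (l @` Lambda) = 0 /\
        forall y v : E, closure Lambda y -> (dot y v)%:E <= (k v)%:E + l y]].

Definition J Omega Lambda f F (k : E -> R) (l : E -> \bar R) phi : \bar R :=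
  \int[leb]_(x in Omega) (k (F x + wdiv Omega phi x)%R)%:E +
  \int[leb]_(y in Lambda) l y +
  \int[leb]_(x in Omega) conjugate f (phi x).

Definition inf_P0 Omega Lambda q f S F : \bar R :=
  ereal_inf [set I0 Omega f S F u | u in U1_S Omega Lambda q S].

Definition sup_D0 Omega Lambda f S F : \bar R :=
  ereal_sup [set v | exists k l phi,
    A0 Lambda S k l phi /\ v = - J Omega Lambda f F k l phi].

Definition P0_minimizer Omega Lambda q f S F u : Prop :=
  U1_S Omega Lambda q S u /\
  forall v, U1_S Omega Lambda q S v ->
    I0 Omega f S F u <= I0 Omega f S F v.

Definition D0_maximizer Omega Lambda f S F
    (k : E -> R) (l : E -> \bar R) phi : Prop :=
  A0 Lambda S k l phi /\
  forall k' l' phi', A0 Lambda S k' l' phi' ->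
    - J Omega Lambda f F k' l' phi' <= - J Omega Lambda f F k l phi.

End problem.

(* Main.v *)
Require Import Defs.
From HB Require Import structures.
From mathcomp Require Import all_boot all_order all_algebra.
From mathcomp Require Import all_classical all_reals all_analysis.
From mathcomp Require Import measurable_realfun.
From mathcomp Require Import ring lra.
Set Implicit Arguments.
Unset Strict Implicit.
Unset Printing Implicit Defensive.
Import Order.TTheory GRing.Theory Num.Theory.
Import numFieldNormedType.Exports.
Local Open Scope classical_set_scope.
Local Open Scope ring_scope.

(** The dual functional is minimised by the direct method.  Replacing [k] by
    the conjugate [k' v = sup_(y in Lambda) (y.v - l y)] can only decrease [J],
    and these potentials are equi-Lipschitz; since [S] is finite dimensional
    and [f^*] has superlinear growth, the coefficients of a minimising sequence
    in a basis of [S] stay bounded.  Tychonoff's theorem gives a limit, and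
    Fatou's lemma and dominated convergence show that, after biconjugation, it
    is a minimiser [(k0, l0, phi0)].  The Lipschitz convex function [k0] is
    differentiable almost everywhere, hence, by non-degeneracy, at
    [G = F + div phi0] almost everywhere in [Omega].  Perturbing [l0] by small
    multiples of a test function shows that [u0 = grad k0 (G)] transports the
    measure of [Omega] to that of [Lambda]; perturbing [phi0] inside the convex
    set [S] shows that [phi0] maximises [V].  Fenchel's inequality
    [u.G <= k (G) + l (u)] yields weak duality, and its equality case
    [u in subdifferential of k0 at G] yields optimality and uniqueness. *)

(** * Boxes and Lebesgue measure *)

Section matrix_norm.
Context (R : realType) (m n : nat).
Implicit Types (x : 'M[R]_(m, n)) (e : R).

(** Limits are taken of the [k_j] only: the support-function bound on their increments and the value
    at the origin pass to pointwise limits, while continuity of [l] and [inf l = 0] need not, so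
    [l0] is rebuilt as a conjugate. Its infimum on [Lambda] may then be positive; subtracting it
    from [l] and adding it to [k] leaves [J] unchanged because [Omega] and [Lambda] have equal
    volume. The coefficients stay bounded because the potential term falls at most linearly in them,
    whereas [f], bounded on bounded sets, has a conjugate that grows with any prescribed slope.
    Fields count modulo null sets and [weak_partial] is a chosen representative, so linear
    relations, independence and the rules for derivatives are all stated almost everywhere. The
    values of [l] on the boundary of [Lambda] are harmless, since a measure-preserving map sends
    almost every point of [Omega] into the open set [Lambda]. The perturbation of [l0] by a test
    function [h] gives only an inequality, through Fatou's lemma; using [h] and [- h] gives the
    equality. *)

Lemma mx_coord_le_norm x i j : `|x i j| <= `|x|.
Proof. by rewrite /Num.norm/= mx_normrE; apply: (le_bigmax _ (fun ij => `|x ij.1 ij.2|) (i, j)). Qed.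

Lemma mx_norm_le x e : 0 <= e -> (forall i j, `|x i j| <= e) -> `|x| <= e.
Proof.
move=> e0 xe; rewrite /Num.norm/= mx_normrE; exact: bigmax_le.
Qed.

End matrix_norm.

Section boxes.
Context (R : realType) (n : nat).
Notation E := 'rV[R]_n.
Implicit Types (a b x : E) (e : R).

Definition obox a b : set E := [set x | forall i, a ord0 i < x ord0 i < b ord0 i].
Definition cbox a b : set E := [set x | forall i, a ord0 i <= x ord0 i <= b ord0 i].

Lemma obox_bigcap a b : obox a b =
  \bigcap_(i in [set: 'I_n]) ((fun x : E => x ord0 i) @^-1` `]a ord0 i, b ord0 i[%classic).
Proof.
apply/seteqP; split => [x ab i _|x ab i]; first by rewrite /= in_itv/= ab.
by have := ab i Logic.I; rewrite /= in_itv.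
Qed.

Lemma cbox_bigcap a b : cbox a b =
  \bigcap_(i in [set: 'I_n]) ((fun x : E => x ord0 i) @^-1` `[a ord0 i, b ord0 i]%classic).
Proof.
apply/seteqP; split => [x ab i _|x ab i]; first by rewrite /= in_itv/= ab.
by have := ab i Logic.I; rewrite /= in_itv.
Qed.

Lemma measurable_obox a b : measurable (obox a b).
Proof.
rewrite obox_bigcap; apply: fin_bigcap_measurable => // i _.
by rewrite -[X in measurable X]setTI; apply: measurable_coord.
Qed.

Lemma measurable_cbox a b : measurable (cbox a b).
Proof.
rewrite cbox_bigcap; apply: fin_bigcap_measurable => // i _.
by rewrite -[X in measurable X]setTI; apply: measurable_coord.
Qed.

Lemma closed_cbox a b : closed (cbox a b).
Proof.
rewrite cbox_bigcap; apply: closed_bigI => i _.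
have /continuous_closedP := @coord_continuous R 1 n ord0 i; apply.
exact: interval_closed.
Qed.

Lemma compact_cbox a b : compact (cbox a b).
Proof.
have -> : cbox a b = [set v : E | forall i, `[a ord0 i, b ord0 i]%classic (v ord0 i)].
  by apply/seteqP; split=> x ab i; have := ab i; rewrite /= in_itv/=.
apply: (@rV_compact R n (fun i => `[a ord0 i, b ord0 i]%classic)).
by move=> i; exact: segment_compact.
Qed.

Lemma sub_obox_cbox a b : obox a b `<=` cbox a b.
Proof. by move=> x ab i; have /andP[/ltW -> /ltW ->] := ab i. Qed.

Lemma ball_obox x e : 0 < e -> ball x e = obox (x - const_mx e) (x + const_mx e).
Proof.
move=> e0; apply/seteqP; split=> y.
  move=> [_ xy] i; have := xy ord0 i; rewrite !mxE => /ltr_normlP[h1 h2].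
  by apply/andP; split; lra.
move=> xy; split => // i j; rewrite ord1.
have := xy j; rewrite !mxE => /andP[h1 h2].
by apply/ltr_normlP; split; lra.
Qed.

(** Rational centres and radii [1/(k+1)] leave countably many boxes. Asking the closed boxes to lie
    in [U] makes bump functions supported in them admissible test functions on [U]. *)
Lemma open_bigcup_obox (U : set E) : open U -> U !=set0 ->
  exists a b : nat -> E, (forall k, cbox (a k) (b k) `<=` U) /\
    U = \bigcup_k obox (a k) (b k).
Proof.
move=> oU [x0 Ux0].
pose A (c : 'M[rat]_(1, n) * nat) : E := map_mx ratr c.1 - const_mx c.2.+1%:R^-1.
pose B (c : 'M[rat]_(1, n) * nat) : E := map_mx ratr c.1 + const_mx c.2.+1%:R^-1.
have main x : U x -> exists c, cbox (A c) (B c) `<=` U /\ obox (A c) (B c) x.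
  move=> Ux.
  have /nbhs_ballP[e /= e0 ballU] : nbhs x U by exact: open_nbhs_nbhs.
  have e20 : 0 < e / 2 by rewrite divr_gt0.
  have [k _ /(_ _ (leqnn _)) ke] := near_infty_natSinv_lt (PosNum e20).
  rewrite /= in ke.
  have k0 : 0 < k.+1%:R^-1 :> R by rewrite invr_gt0.
  have q i j : {q : rat | `|ratr q - x i j| < k.+1%:R^-1}.
    apply: cid.
    have fxk : x i j - k.+1%:R^-1 < x i j + k.+1%:R^-1.
      by rewrite ltrBlDr -addrA ltrDl addr_gt0.
    have [q] := rat_in_itvoo fxk.
    by rewrite in_itv/= => /andP[q1 q2]; exists q; rewrite ltr_distl q1.
  exists (\matrix_(i, j) sval (q i j), k); split.
    move=> y yAB; apply: ballU; split => // i j; rewrite ord1.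
    have := yAB j; rewrite !mxE /= => /andP[h1 h2].
    have := svalP (q ord0 j) => /ltr_normlP[h3 h4].
    move: h1 h2 h3 h4 ke; set z := ratr _; set t := k.+1%:R^-1 => h1 h2 h3 h4 ke.
    by apply/ltr_normlP; split; lra.
  move=> i; rewrite !mxE /=.
  have := svalP (q ord0 i) => /ltr_normlP[h3 h4].
  move: h3 h4; set z := ratr _; set t := k.+1%:R^-1 => h3 h4.
  by apply/andP; split; lra.
have [c0 [c0U _]] := main _ Ux0.
(* Indices that decode to nothing, or to a box not contained in [U], are sent to the fallback box
   [c0]; this is where [U !=set0] enters. *)
pose c (k : nat) := if unpickle k is Some c then
  (if `[< cbox (A c) (B c) `<=` U >] then c else c0) else c0.
have cU k : cbox (A (c k)) (B (c k)) `<=` U.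
  by rewrite /c; case: unpickle => // c'; case: ifPn => // /asboolP.
exists (A \o c), (B \o c); split => //.
apply/seteqP; split=> [x Ux|x [k _] /sub_obox_cbox]; last exact: cU.
have [c' [cU' xc']] := main _ Ux.
exists (pickle c') => //=.
by rewrite /c pickleK asboolT.
Qed.

Lemma oboxI a b a' b' : obox a b `&` obox a' b' =
  obox (\row_i Num.max (a ord0 i) (a' ord0 i)) (\row_i Num.min (b ord0 i) (b' ord0 i)).
Proof.
apply/seteqP; split=> [x [h h'] i|x h].
  by rewrite !mxE gt_max lt_min; move: (h i) (h' i) => /andP[-> ->] /andP[-> ->].
by split=> i; move: (h i); rewrite !mxE gt_max lt_min => /andP[/andP[h1 h2] /andP[h3 h4]];
  rewrite ?h1 ?h2 ?h3 ?h4.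
Qed.

Lemma obox_cover : \bigcup_k obox (const_mx (- k%:R)) (const_mx k%:R) = setT.
Proof.
apply/seteqP; split=> // x _.
exists (Num.trunc `|x|).+1 => // i; rewrite !mxE -ltr_norml.
apply: le_lt_trans (mx_coord_le_norm x ord0 i) _.
exact: truncnS_gt.
Qed.

(** Open boxes are stable under intersection and generate the Borel sets; the cubes of half-side [k]
    exhaust the space with finite measure. *)
Lemma rV_measure_unique (m1 m2 : {measure set E -> \bar R}) :
  (forall a b, m1 (obox a b) = m2 (obox a b)) ->
  (forall k : nat, (m1 (obox (const_mx (- k%:R)%R) (const_mx k%:R%R)) < +oo)%E) ->
  forall A, measurable A -> m1 A = m2 A.
Proof.
move=> m12 fin A mA.
pose G : set (set E) := [set B | exists a b, B = obox a b].
apply: (measure_unique G (fun k => obox (const_mx (- k%:R)) (const_mx k%:R))) => //.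
- apply/seteqP; split; last first.
    apply: smallest_sub; first exact: sigma_algebra_measurable.
    by move=> _ [a [b ->]]; exact: measurable_obox.
  apply: smallest_sub; first exact: smallest_sigma_algebra.
  move=> U oU; have [->|/set0P U0] := eqVneq U set0; first exact: sigma_algebra0.
  have [a [b [_ ->]]] := open_bigcup_obox oU U0.
  apply: sigma_algebra_bigcup => k; apply: sub_sigma_algebra.
  by exists (a k), (b k).
- by move=> _ _ [a [b ->]] [a' [b' ->]]; rewrite oboxI; eexists; eexists.
- by move=> k; eexists; eexists.
- exact: obox_cover.
- by move=> _ [a [b ->]].
Qed.

Lemma cbox_eq0 a b i : b ord0 i < a ord0 i -> cbox a b = set0.
Proof.
move=> ba; apply/seteqP; split=> // x /(_ i) /andP[ax xb].
by have := le_lt_trans (le_trans ax xb) ba; rewrite ltxx.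
Qed.

Lemma cbox_cases a b : (forall i, a ord0 i <= b ord0 i) \/ cbox a b = set0.
Proof.
have [ab|/existsNP[i /negP]] := pselect (forall i, a ord0 i <= b ord0 i); first by left.
by rewrite -ltNge => ba; right; exact: cbox_eq0 ba.
Qed.

Lemma obox_bigcup_cbox a b : obox a b =
  \bigcup_k cbox (a + const_mx k.+1%:R^-1) (b - const_mx k.+1%:R^-1).
Proof.
apply/seteqP; split=> [x xab|x [k _ xk] i]; last first.
  have := xk i; rewrite !mxE => /andP[h1 h2].
  have k0 : 0 < k.+1%:R^-1 :> R by rewrite invr_gt0.
  by apply/andP; split; move: h1 h2 k0; set t := k.+1%:R^-1; lra.
have [e e0 He] : exists2 e, 0 < e & forall i, a ord0 i + e <= x ord0 i <= b ord0 i - e.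
  exists (\big[Num.min/1]_i Num.min (x ord0 i - a ord0 i) (b ord0 i - x ord0 i)).
    apply: lt_bigmin => // i _; rewrite lt_min !subr_gt0; exact: xab.
  move=> i; set e := \big[_/_]_i _.
  have : e <= Num.min (x ord0 i - a ord0 i) (b ord0 i - x ord0 i).
    exact: (bigmin_le _ i (fun i => Num.min (x ord0 i - a ord0 i) (b ord0 i - x ord0 i))).
  by rewrite le_min => /andP[h1 h2]; apply/andP; split; lra.
have [k _ /(_ _ (leqnn _)) /= ke] := near_infty_natSinv_lt (PosNum e0).
exists k => // i; rewrite !mxE; have /andP[] := He i.
by move: ke; set t := k.+1%:R^-1 => h1 h2 h3; apply/andP; split; lra.
Qed.

(** The Lebesgue measure is known through its values on closed boxes, and these pass to open boxes
    by increasing unions. *)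
Lemma cbox_measure_unique (m1 m2 : {measure set E -> \bar R}) :
  (forall a b, (forall i, a ord0 i <= b ord0 i) -> m1 (cbox a b) = m2 (cbox a b)) ->
  (forall a b, (m1 (cbox a b) < +oo)%E) ->
  forall A, measurable A -> m1 A = m2 A.
Proof.
move=> m12 fin; apply: rV_measure_unique; last first.
  move=> k; apply: le_lt_trans (fin (const_mx (- k%:R)%R) (const_mx k%:R%R)).
  apply: le_measure; rewrite ?inE; [exact: measurable_obox|exact: measurable_cbox|].
  exact: sub_obox_cbox.
have m12' a b : m1 (cbox a b) = m2 (cbox a b).
  by have [/m12//|->] := cbox_cases a b; rewrite !measure0.
move=> a b; rewrite obox_bigcup_cbox.
pose B k := cbox (a + const_mx k.+1%:R^-1) (b - const_mx k.+1%:R^-1).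
have mB k : measurable (B k) by exact: measurable_cbox.
have mUB : measurable (\bigcup_k B k) by exact: bigcupT_measurable.
have ndB : {homo B : n m / (n <= m)%N >-> (n <= m)%O}.
  move=> i j ij; apply/subsetPset => x xi k; have := xi k; rewrite !mxE => /andP[h1 h2].
  have : j.+1%:R^-1 <= i.+1%:R^-1 :> R by rewrite lef_pV2 ?posrE// ler_nat.
  move: h1 h2; set t := i.+1%:R^-1; set u := j.+1%:R^-1 => h1 h2 h3.
  by apply/andP; split; lra.
have h1 := nondecreasing_cvg_mu mB mUB ndB (mu := m1).
have h2 := nondecreasing_cvg_mu mB mUB ndB (mu := m2).
rewrite -(cvg_lim _ h1)// -(cvg_lim _ h2)//; congr (limn _).
by apply/funext => k /=; rewrite m12'.
Qed.

End boxes.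

Section lebesgue_rV_facts.
Context (R : realType) (n : nat).
Notation E := 'rV[R]_n.
Notation leb := (lebesgue_rV R n).
Implicit Types (a b v x : E) (A : set E).

Lemma leb_cbox a b : (forall i, a ord0 i <= b ord0 i) ->
  leb (cbox a b) = (\prod_i (b ord0 i - a ord0 i))%:E.
Proof.
by move=> ab; rewrite -lebesgue_rV_box//; congr (leb _).
Qed.

Lemma leb_cbox_lty a b : (leb (cbox a b) < +oo)%E.
Proof.
by have [/leb_cbox ->|->] := cbox_cases a b; rewrite ?ltry// measure0.
Qed.

Lemma leb_obox_gt0 a b : (forall i, a ord0 i < b ord0 i) -> (0 < leb (obox a b))%E.
Proof.
move=> ab.
(* [[a', b']] is the closed box with the same centre and half the side lengths. *)
pose c := (2^-1 *: (a + b)); pose a' := 2^-1 *: (a + c); pose b' := 2^-1 *: (c + b).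
have ab' i : a' ord0 i < b' ord0 i by rewrite /a' /b' /c !mxE; have := ab i; lra.
apply: (@lt_le_trans _ _ (leb (cbox a' b'))).
  rewrite leb_cbox; last by move=> i; exact: ltW.
  by rewrite lte_fin; apply: prodr_gt0 => i _; rewrite subr_gt0.
apply: le_measure; rewrite ?inE; [exact: measurable_cbox|exact: measurable_obox|].
move=> x xab i; have := xab i; rewrite /a' /b' /c !mxE => /andP[].
by have := ab i => ? ? ?; apply/andP; split; lra.
Qed.

Lemma measurable_open (U : set E) : open U -> measurable U.
Proof. exact: open_measurable_mx. Qed.

Lemma leb_open_gt0 (U : set E) x : open U -> U x -> (0 < leb U)%E.
Proof.
move=> oU Ux; have /nbhs_ballP[e /= e0 ballU] : nbhs x U by exact: open_nbhs_nbhs.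
apply: (@lt_le_trans _ _ (leb (obox (x - const_mx e) (x + const_mx e)))).
  by apply: leb_obox_gt0 => i; rewrite !mxE; lra.
apply: le_measure; rewrite ?inE; [exact: measurable_obox|exact: measurable_open|].
by rewrite -ball_obox.
Qed.

Lemma bounded_set_cbox A : bounded_set A ->
  exists2 M : R, 0 < M & A `<=` cbox (const_mx (- M)) (const_mx M).
Proof.
move=> [M [_ HM]]; exists (Num.max 1 (M + 1)); first by rewrite lt_max ltr01.
move=> x Ax i; rewrite !mxE -ler_norml.
apply: le_trans (mx_coord_le_norm x ord0 i) _.
by rewrite le_max; apply/orP; right; apply: HM => //; rewrite ltrDl.
Qed.

Lemma leb_bounded_lty A : bounded_set A -> measurable A -> (leb A < +oo)%E.
Proof.
move=> /bounded_set_cbox[M _ AM] mA.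
apply: le_lt_trans (leb_cbox_lty (const_mx (- M)) (const_mx M)).
by apply: le_measure; rewrite ?inE//; exact: measurable_cbox.
Qed.

Let measurable_translate v : measurable_fun [set: E] (fun x : E => v + x).
Proof.
apply/measurable_fun_mxP => i j.
under eq_fun do rewrite mxE.
by apply: measurable_funD => //; exact: measurable_coord.
Qed.

Let measurable_reflect v : measurable_fun [set: E] (fun x : E => v - x).
Proof.
apply/measurable_fun_mxP => i j.
under eq_fun do rewrite mxE mxE.
by apply: measurable_funB => //; exact: measurable_coord.
Qed.

Lemma leb_translate v A : measurable A -> leb [set x | A (v + x)] = leb A.
Proof.
move=> mA; rewrite -[LHS]/(pushforward leb (fun x : E => v + x) A).
have pre a b : (fun x => v + x) @^-1` cbox a b = cbox (a - v) (b - v).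
  by apply/seteqP; split=> x h i; have := h i; rewrite !mxE lerBlDl lerBrDl.
apply: (@cbox_measure_unique _ _ (pushforward leb (fun x : E => v + x)) leb) => //.
- move=> a b ab; rewrite -[LHS]/(leb ((fun x => v + x) @^-1` cbox a b)) pre.
  transitivity (\prod_i (b ord0 i - a ord0 i))%:E; last exact/esym/leb_cbox.
  rewrite leb_cbox; last by move=> i; rewrite !mxE lerD2r.
  by congr EFin; apply: eq_bigr => i _; rewrite !mxE; ring.
- by move=> a b; rewrite -[X in (X < _)%E]/(leb ((fun x => v + x) @^-1` cbox a b)) pre; exact: leb_cbox_lty.
Qed.

(** Point reflection through [v / 2]; it serves the symmetry argument of [legendre_finite], as
    translations serve that of [leb_kinks_bounded]. *)
Lemma leb_reflect v A : measurable A -> leb [set x | A (v - x)] = leb A.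
Proof.
move=> mA; rewrite -[LHS]/(pushforward leb (fun x : E => v - x) A).
have pre a b : (fun x => v - x) @^-1` cbox a b = cbox (v - b) (v - a).
  apply/seteqP; split=> x h i; have := h i; rewrite !mxE => /andP[h1 h2];
  by apply/andP; split; lra.
apply: (@cbox_measure_unique _ _ (pushforward leb (fun x : E => v - x)) leb) => //.
- move=> a b ab; rewrite -[LHS]/(leb ((fun x => v - x) @^-1` cbox a b)) pre.
  transitivity (\prod_i (b ord0 i - a ord0 i))%:E; last exact/esym/leb_cbox.
  rewrite leb_cbox; last by move=> i; rewrite !mxE lerD2l lerN2.
  by congr EFin; apply: eq_bigr => i _; rewrite !mxE; ring.
- by move=> a b; rewrite -[X in (X < _)%E]/(leb ((fun x => v - x) @^-1` cbox a b)) pre; exact: leb_cbox_lty.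
Qed.

End lebesgue_rV_facts.

(** * Legendre transform and gradients *)

Section dot_product.
Context (R : realType) (m n : nat).
Implicit Types (x y z w : 'M[R]_(m, n)) (a : R).

Lemma dotC x y : dot x y = dot y x.
Proof. by apply: eq_bigr => i _; apply: eq_bigr => j _; rewrite mulrC. Qed.

Lemma dotDr x y z : dot x (y + z) = dot x y + dot x z.
Proof.
rewrite /dot -big_split; apply: eq_bigr => i _; rewrite -big_split.
by apply: eq_bigr => j _; rewrite mxE mulrDr.
Qed.

Lemma dotZr a x y : dot x (a *: y) = a * dot x y.
Proof.
rewrite /dot mulr_sumr; apply: eq_bigr => i _; rewrite mulr_sumr.
by apply: eq_bigr => j _; rewrite mxE mulrCA.
Qed.

Lemma dotNr x y : dot x (- y) = - dot x y.
Proof. by rewrite -scaleN1r dotZr mulN1r. Qed.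

Lemma dotBr x y z : dot x (y - z) = dot x y - dot x z.
Proof. by rewrite dotDr dotNr. Qed.

Lemma dotDl x y z : dot (x + y) z = dot x z + dot y z.
Proof. by rewrite dotC dotDr !(dotC z). Qed.

Lemma dotZl a x y : dot (a *: x) y = a * dot x y.
Proof. by rewrite dotC dotZr dotC. Qed.

Lemma dotBl x y z : dot (x - y) z = dot x z - dot y z.
Proof. by rewrite dotC dotBr !(dotC z). Qed.

Lemma dot0r x : dot x 0 = 0.
Proof. by rewrite -(scale0r 0) dotZr mul0r. Qed.

Lemma dot_sumr (I : finType) x (F : I -> 'M[R]_(m, n)) :
  dot x (\sum_i F i) = \sum_i dot x (F i).
Proof. by apply: (big_morph _ (dotDr x) (dot0r x)). Qed.

Lemma dot_norm_le x y : `|dot x y| <= (m * n)%:R * (`|x| * `|y|).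
Proof.
apply: le_trans (ler_norm_sum _ _ _) _.
apply: (@le_trans _ _ (\sum_(i < m) \sum_(j < n) `|x| * `|y|)).
  apply: ler_sum => i _; apply: le_trans (ler_norm_sum _ _ _) _.
  apply: ler_sum => j _; rewrite normrM.
  by apply: ler_pM => //; exact: mx_coord_le_norm.
by rewrite !sumr_const !card_ord -mulrnA mulr_natl mulnC.
Qed.

Lemma sqr_norm_le_dot x : `|x| ^+ 2 <= dot x x.
Proof.
have dot_ge0 : 0 <= dot x x.
  by apply: sumr_ge0 => i _; apply: sumr_ge0 => j _; rewrite -expr2 sqr_ge0.
rewrite -[leRHS]sqr_sqrtr// lerXn2r ?nnegrE ?sqrtr_ge0//.
apply: mx_norm_le; first exact: sqrtr_ge0.
move=> i j; rewrite -sqrtr_sqr ler_wsqrtr//.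
rewrite /dot (bigD1 i)//= (bigD1 j)//= -expr2 -addrA lerDl addr_ge0//.
  by apply: sumr_ge0 => k _; rewrite -expr2 sqr_ge0.
by apply: sumr_ge0 => k _; apply: sumr_ge0 => l _; rewrite -expr2 sqr_ge0.
Qed.

Lemma enorm_ge_norm x : `|x| <= enorm x.
Proof.
rewrite -[leLHS]ger0_norm// -sqrtr_sqr ler_wsqrtr//; exact: sqr_norm_le_dot.
Qed.

Lemma enorm_le_norm x : enorm x <= (m * n)%:R * `|x|.
Proof.
have h : 0 <= (m * n)%:R * `|x| by rewrite mulr_ge0.
rewrite -[leRHS]ger0_norm// -sqrtr_sqr ler_wsqrtr// exprMn.
apply: le_trans (ler_norm _) _; apply: le_trans (dot_norm_le x x) _.
rewrite -expr2 ler_wpM2r ?sqr_ge0// -natrX ler_nat.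
by case: (m * n)%N => // k; rewrite leq_pmulr.
Qed.

Lemma continuous_dotl y : continuous (fun x => dot x y : R).
Proof.
rewrite /dot; apply: continuous_big => [|i _]; first exact: add_continuous.
apply: continuous_big => [|j _]; first exact: add_continuous.
by move=> x; apply: continuousM; [exact: coord_continuous|exact: cst_continuous].
Qed.

Lemma continuous_dotr y : continuous (fun x => dot y x : R).
Proof.
by under eq_fun do rewrite dotC; exact: continuous_dotl.
Qed.

End dot_product.

Section legendre_facts.
Context (R : realType) (m n : nat).
Notation M := 'M[R]_(m, n).
Implicit Types (h : M -> \bar R) (x y z : M) (a b t : R).
Local Open Scope ereal_scope.

Lemma legendre_ge h x y : (dot x y)%:E - h x <= legendre h y.
Proof. by apply: ereal_sup_ubound; exists x. Qed.

Lemma legendre_le h y c : (forall x, (dot x y)%:E - h x <= c) -> legendre h y <= c.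
Proof. by move=> hc; apply: ge_ereal_sup => _ [x _ <-]. Qed.

Lemma legendre_gtP h y c : c < legendre h y -> exists x, c < (dot x y)%:E - h x.
Proof. by move=> /ereal_sup_gt[_ [x _ <-] cx]; exists x. Qed.

Lemma open_legendre_gt h c : open [set y | c < legendre h y].
Proof.
have -> : [set y | c < legendre h y] = \bigcup_x [set y | c < (dot x y)%:E - h x].
  apply/seteqP; split=> y; first by move=> /legendre_gtP[x xy]; exists x.
  by move=> [x _] /lt_le_trans; apply; exact: legendre_ge.
apply: bigcup_open => x _.
case: (h x) => [r| |]; last 2 first.
- have -> : [set y | c < (dot x y)%:E - +oo] = set0.
    by apply/seteqP; split=> // y; rewrite /= ltNge leNye.
  exact: open0.
- have [cy|cy] := eqVneq c +oo.
    rewrite cy (_ : [set _ | _] = set0); first exact: open0.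
    by apply/seteqP; split=> // y; rewrite /= ltxx.
  rewrite (_ : [set _ | _] = setT); first exact: openT.
  by apply/seteqP; split=> // y _; rewrite /= ltey.
case: c => [c| |].
- have -> : [set y | c%:E < (dot x y)%:E - r%:E] = (fun y => dot x y) @^-1` `]c + r, +oo[%classic%R.
    by apply/seteqP; split=> y; rewrite /= in_itv/= andbT -EFinB lte_fin ltrBrDr.
  have /continuousP := @continuous_dotr R m n x; apply; exact: interval_open.
- have -> : [set y | +oo < (dot x y)%:E - r%:E] = set0 by apply/seteqP; split.
  exact: open0.
- have -> : [set y | -oo < (dot x y)%:E - r%:E] = setT.
    by apply/seteqP; split => // y _ /=; rewrite -EFinB ltNyr.
  exact: openT.
Qed.

Lemma measurable_legendre h : measurable_fun [set: M] (legendre h).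
Proof.
apply: (measurability _ (ErealGenOInfty.measurableE R)) => _ [_ [c ->]] <-.
rewrite setTI; apply: open_measurable_mx.
have -> : legendre h @^-1` `]c%:E, +oo[%classic = [set y | c%:E < legendre h y].
  by apply/seteqP; split=> y /=; rewrite in_itv/= andbT.
exact: open_legendre_gt.
Qed.

Lemma legendre_convex h x y t a b : (0 <= t <= 1)%R ->
  legendre h x <= a%:E -> legendre h y <= b%:E ->
  legendre h (t *: x + (1 - t) *: y)%R <= (t * a + (1 - t) * b)%:E.
Proof.
move=> /andP[t0 t1] hx hy; apply: legendre_le => z.
have := le_trans (legendre_ge h z x) hx; have := le_trans (legendre_ge h z y) hy.
case: (h z) => [r| |]//=; rewrite ?addeNy ?leNye//.
rewrite -!EFinB !lee_fin => zy zx; rewrite dotDr !dotZr.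
have h1 := ler_wpM2l t0 zx.
have t1' : (0 <= 1 - t)%R by rewrite subr_ge0.
have h2 := ler_wpM2l t1' zy.
by move: h1 h2; rewrite !mulrBr !mulrBl; lra.
Qed.

Lemma legendre_involution_le h z : legendre (legendre h) z <= h z.
Proof.
apply: legendre_le => y; have := legendre_ge h z y.
rewrite dotC; case: (h z) => [r| |]; case: (legendre h y) => [s| |]//=;
  rewrite ?leey ?leNye// ?addeNy ?leNye//.
by rewrite -!EFinB !lee_fin; lra.
Qed.

Lemma legendreS h h' : (forall x, h x <= h' x) -> forall y, legendre h' y <= legendre h y.
Proof.
move=> hh' y; apply: legendre_le => x; apply: le_trans (legendre_ge h x y).
by rewrite leeB.
Qed.

Lemma legendre3 h : legendre (legendre (legendre h)) = legendre h.
Proof.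
apply/funext => y; apply/le_anti/andP; split; first exact: legendre_involution_le.
by apply: legendreS => x; exact: legendre_involution_le.
Qed.

End legendre_facts.

Section limn_einf_facts.
Context (R : realType).
Local Open Scope ereal_scope.

Lemma le_limn_einf (a u : (\bar R)^nat) :
  (forall n, a n <= u n) -> limn_einf a <= limn_einf u.
Proof.
move=> au; rewrite !limn_einf_lim.
apply: lee_lim; [exact: is_cvg_einfs|exact: is_cvg_einfs|].
apply: nearW => n; apply: le_ereal_inf_tmp => _ [k /= nk <-].
by apply: le_trans (au k); apply: ereal_inf_lbound; exists k.
Qed.

(** A supremum of convergent quantities is lower semicontinuous: each competitor [x] is bounded
    separately. The function and the argument may vary together. *)
Lemma legendre_le_limn_einf (m n : nat) (h_ : nat -> 'M[R]_(m, n) -> \bar R) h y_ y :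
  (forall x, (dot x (y_ k))%:E - h_ k x @[k --> \oo] --> (dot x y)%:E - h x) ->
  legendre h y <= limn_einf (fun k => legendre (h_ k) (y_ k)).
Proof.
move=> hy; apply: legendre_le => x.
have [<- _] := cvg_limn_einf_sup (hy x).
by apply: le_limn_einf => k; exact: legendre_ge.
Qed.

End limn_einf_facts.

Lemma is_diff_eps (R : realType) (V W : normedModType R) (f : V -> W)
    (df : {linear V -> W}) (x : V) : continuous df ->
  (forall eta, 0 < eta -> exists2 rho, 0 < rho &
    forall w, `|w| <= rho -> `|f (x + w) - f x - df w| <= eta * `|w|) ->
  differentiable f x /\ 'd f x = df :> (V -> W).
Proof.
move=> cdf fxdf.
have o : f \o shift x = cst (f x) + df +o_ 0 id.
  apply/eqaddoP => eta eta0; have [rho rho0 H] := fxdf _ eta0.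
  near=> w.
  have := H w; rewrite /= !fctE/= [w + x]addrC opprD addrA; apply.
  near: w; apply/nbhs_ballP; exists rho => // w.
  by rewrite -ball_normE/= sub0r normrN => /ltW.
have dE : 'd f x = df :> (V -> W) by exact: diff_unique cdf o.
by split=> //; apply/diff_locallyP; rewrite dE.
Unshelve. all: by end_near. Qed.

Section dot_linear.
Context (R : realType) (m n : nat).
Implicit Types (x v u : 'M[R]_(m, n)).

Fact dot_is_linear x : linear (dot x : 'M[R]_(m, n) -> R^o).
Proof. by move=> a v w; rewrite dotDr dotZr. Qed.

HB.instance Definition _ x := GRing.isLinear.Build R 'M[R]_(m, n) R^o
  *:%R (dot x) (dot_is_linear x).

(** Differentiability as an explicit increment estimate in the sup norm: convexity yields it in this
    form, and subgradients are compared with it in this form. *)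
Definition has_gradient (f : 'M[R]_(m, n) -> R) v u :=
  forall eta : R, 0 < eta -> exists2 rho : R, 0 < rho &
    forall w, `|w| <= rho -> `|f (v + w) - f v - dot u w| <= eta * `|w|.

Lemma has_gradient_is_gradient f v u : has_gradient f v u -> is_gradient f v u.
Proof.
move=> fvu.
have [df dE] := @is_diff_eps R _ R^o f (dot u) v (@continuous_dotr R m n u) fvu.
by split => // w; rewrite dE.
Qed.

(* An approximate subgradient at a point of differentiability is close to the gradient: test it in the direction [y - u]. *)
Lemma has_gradient_subdiff f v u : has_gradient f v u ->
  forall eps, 0 < eps -> exists2 delta, 0 < delta &
    forall y, (forall w, f v + dot y w - delta <= f (v + w)) -> `|y - u| <= eps.
Proof.
move=> fvu eps eps0; have eps20 : 0 < eps / 2 by rewrite divr_gt0.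
have [rho rho0 H] := fvu _ eps20.
(* At a test vector [w] of length [rho] along [y - u], differentiability and the approximate
   subgradient inequality each cost [rho * eps / 2], while [dot (y - u) w] is at least
   [rho * |y - u|]. *)
exists (rho * (eps / 2)); first by rewrite mulr_gt0.
move=> y yd; have [->|yu] := eqVneq y u; first by rewrite subrr normr0 ltW.
have yu0 : 0 < `|y - u| by rewrite normr_gt0 subr_eq0.
pose w := (rho / `|y - u|) *: (y - u).
have wrho : `|w| = rho.
  by rewrite normrZ gtr0_norm ?divr_gt0// divfK// gt_eqF.
have wr : `|w| <= rho by rewrite wrho.
have := H w wr; rewrite wrho => /ler_normlP[_ h1].
have h2 := yd w.
have h3 : dot (y - u) w <= rho * eps by rewrite dotBl; lra.
have h4 : rho * `|y - u| <= dot (y - u) w.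
  rewrite dotZr -mulrA ler_pM2l// mulrC ler_pdivlMr// -expr2.
  exact: sqr_norm_le_dot.
by rewrite -(ler_pM2l rho0); exact: le_trans h4 h3.
Qed.

End dot_linear.

(** * Almost everywhere differentiability of Lipschitz convex functions *)

Section convex_on.
Context (R : realType) (d : nat).
Notation E := 'rV[R]_d.
Notation e_ i := (delta_mx ord0 i : E).
Implicit Types (U : set E) (f : E -> R) (x y v w : E) (t : R).

(** Convexity of the domain is bundled with that of the function, so that every use also yields
    membership of the intermediate point. *)
Definition convex_on U f := forall x y t, U x -> U y -> 0 <= t <= 1 ->
  U (t *: x + (1 - t) *: y) /\ f (t *: x + (1 - t) *: y) <= t * f x + (1 - t) * f y.

Lemma convex_on_avg U f (n : nat) (x : 'I_n.+1 -> E) : convex_on U f ->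
  (forall i, U (x i)) ->
  U (n.+1%:R^-1 *: \sum_i x i) /\
  f (n.+1%:R^-1 *: \sum_i x i) <= n.+1%:R^-1 * \sum_i f (x i).
Proof.
move=> cf; elim: n x => [|n IH] x Ux.
  by rewrite !big_ord_recl !big_ord0 !addr0 invr1 scale1r mul1r.
have [UI fI] := IH (fun i => x (lift ord0 i)) (fun i => Ux _).
have n2 : 2 + n%:R != 0 :> R by rewrite -natrD pnatr_eq0.
have n1 : 1 + n%:R != 0 :> R by rewrite nat1r pnatr_eq0.
have e1 : 1 - n.+2%:R^-1 = n.+1%:R / n.+2%:R :> R by field.
have t01 : 0 <= (n.+2%:R^-1 : R) <= 1.
  by rewrite invr_ge0 ler0n invf_le1 ?ltr0n// ler1n.
have := cf _ _ _ (Ux ord0) UI t01.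
have -> : n.+2%:R^-1 *: x ord0 +
    (1 - n.+2%:R^-1) *: (n.+1%:R^-1 *: \sum_(i < n.+1) x (lift ord0 i)) =
    n.+2%:R^-1 *: \sum_i x i.
  rewrite [in RHS]big_ord_recl scalerDr; congr (_ + _); rewrite scalerA; congr (_ *: _).
  by field; rewrite n1 n2.
move=> [UU ff]; split=> //; apply: le_trans ff _.
rewrite [in leRHS]big_ord_recl mulrDr lerD2l e1.
apply: le_trans (ler_wpM2l _ fI) _; first by rewrite mulr_ge0.
rewrite [leLHS]mulrA [X in X * _ <= _]mulrAC mulfV ?pnatr_eq0// mul1r.
by [].
Qed.

(** The point [y + w] is the average of the [d] points [y + d w_i e_i]. Both local boundedness and
    differentiability are reduced by this to the coordinate axes. *)
Lemma convex_on_axes U f y w : (0 < d)%N -> convex_on U f ->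
  (forall i, U (y + (d%:R * w ord0 i) *: e_ i)) ->
  U (y + w) /\ f (y + w) <= d%:R^-1 * \sum_i f (y + (d%:R * w ord0 i) *: e_ i).
Proof.
move=> d0 cf Uy.
have avg n (x : 'I_n -> E) : (0 < n)%N -> (forall i, U (x i)) ->
    U (n%:R^-1 *: \sum_i x i) /\ f (n%:R^-1 *: \sum_i x i) <= n%:R^-1 * \sum_i f (x i).
  by case: n x => // n x _ Ux; exact: convex_on_avg.
have d0' : d%:R != 0 :> R by rewrite pnatr_eq0 -lt0n.
have := avg _ _ d0 Uy.
have -> : d%:R^-1 *: (\sum_i (y + (d%:R * w ord0 i) *: e_ i)) = y + w.
  rewrite big_split/= sumr_const card_ord scalerDr -(scaler_nat d y) scalerA mulVf// scale1r.
  congr (_ + _).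
  rewrite scaler_sumr [RHS]row_sum_delta; apply: eq_bigr => i _.
  by rewrite scalerA mulrA mulVf// mul1r.
by [].
Qed.

Lemma convex_on_bounded U f y : (0 < d)%N -> open U -> convex_on U f -> U y ->
  exists rho M : R, 0 < rho /\ forall w, `|w| <= rho -> U (y + w) /\ f (y + w) <= M.
Proof.
move=> d0 oU cf Uy; have /nbhs_ballP[r /= r0 ballU] : nbhs y U by exact: open_nbhs_nbhs.
have d0' : 0 < d%:R :> R by rewrite ltr0n.
have Ur s i : `|s| < r -> U (y + s *: e_ i).
  move=> sr; apply: ballU; rewrite -ball_normE/= opprD addrA subrr sub0r normrN.
  rewrite normrZ; apply: le_lt_trans sr; rewrite -[leRHS]mulr1 ler_wpM2l//.
  apply: mx_norm_le => // k l; rewrite !mxE.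
  by case: (_ && _); rewrite ?normr1 ?normr0.
pose B i := `|f (y + (r / 2) *: e_ i)| + `|f (y + (- (r / 2)) *: e_ i)|.
pose M := \sum_i B i.
exists (r / 2 / d%:R), (d%:R^-1 * \sum_(i < d) M); split; first by rewrite !divr_gt0.
move=> w wr.
have key i : U (y + (d%:R * w ord0 i) *: e_ i) /\ f (y + (d%:R * w ord0 i) *: e_ i) <= M.
  (* Barycentric coordinate of [d * w_i] in the interval from [- r / 2] to [r / 2]. *)
  pose s := (1 + d%:R * w ord0 i / (r / 2)) / 2.
  have : `|w ord0 i| <= r / 2 / d%:R by apply: le_trans wr; exact: mx_coord_le_norm.
  rewrite ler_pdivlMr// mulrC -{1}(gtr0_norm d0') -normrM => /ler_normlP[w1 w2].
  have r2 : 0 < r / 2 by rewrite divr_gt0.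
  have s1 : -1 <= d%:R * w ord0 i / (r / 2) by rewrite ler_pdivlMr// mulN1r lerNl.
  have s2 : d%:R * w ord0 i / (r / 2) <= 1 by rewrite ler_pdivrMr// mul1r.
  have s01 : 0 <= s <= 1 by apply/andP; rewrite /s; split; lra.
  have h1 : U (y + (r / 2) *: e_ i).
    by apply: Ur; rewrite gtr0_norm// ltr_pdivrMr// ltr_pMr// ltr1n.
  have h2 : U (y + (- (r / 2)) *: e_ i).
    by apply: Ur; rewrite normrN gtr0_norm// ltr_pdivrMr// ltr_pMr// ltr1n.
  have := cf _ _ _ h1 h2 s01.
  have -> : s *: (y + (r / 2) *: e_ i) + (1 - s) *: (y + (- (r / 2)) *: e_ i) =
      y + (d%:R * w ord0 i) *: e_ i.
    rewrite !scalerDr addrACA -scalerDl subrKC scale1r; congr (_ + _).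
    rewrite !scalerA -scalerDl; congr (_ *: _).
    by rewrite /s; field; rewrite gt_eqF.
  move=> [? fs]; split => //; apply: le_trans fs _.
  apply: (@le_trans _ _ (B i)).
    move: s01 => /andP[s0 s1'].
    apply: lerD.
      apply: le_trans (ler_wpM2l s0 (ler_norm _)) _.
      by rewrite ler_piMl.
    apply: le_trans (ler_wpM2l _ (ler_norm _)) _; first by rewrite subr_ge0.
    by rewrite ler_piMl// gerBl.
  rewrite /M (bigD1 i)//= lerDl; apply: sumr_ge0 => j _.
  by rewrite addr_ge0.
have [Uyw fyw] := convex_on_axes d0 cf (fun i => (key i).1).
split => //; apply: le_trans fyw _; rewrite ler_pM2l ?invr_gt0//.
by apply: ler_sum => i _; exact: (key i).2.
Qed.

(** A local upper bound [M] suffices. With [w = e w'], the point [y + w] lies between [y] and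
    [y + w'], which bounds [f (y + w)] above; [y] lies between [y + w] and [y - w'], which bounds it
    below. *)
Lemma convex_on_continuous U f y : (0 < d)%N -> open U -> convex_on U f -> U y ->
  forall eta : R, 0 < eta -> exists2 rho : R, 0 < rho &
    forall w, `|w| <= rho -> `|f (y + w) - f y| <= eta.
Proof.
move=> d0 oU cf Uy eta eta0.
have [rho [M [rho0 H]]] := convex_on_bounded d0 oU cf Uy.
have My : f y <= M.
  have [|_] := H 0; first by rewrite normr0 ltW.
  by rewrite addr0.
(* Chosen so that [e <= 1] and [e * (M - f y) <= eta]; adding [eta] keeps the denominator positive
   when [f y = M]. *)
pose e := eta / (M - f y + eta).
have D0 : 0 < M - f y + eta by rewrite ltr_wpDl// subr_ge0.
have e0 : 0 < e by rewrite divr_gt0.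
have e1 : e <= 1 by rewrite ler_pdivrMr// mul1r lerDr subr_ge0.
have eM : e * (M - f y) <= eta.
  by rewrite mulrAC ler_pdivrMr// ler_pM2l// lerDl ltW.
exists (e * rho); first by rewrite mulr_gt0.
move=> w wr; pose w' := e^-1 *: w.
have w'r : `|w'| <= rho.
  by rewrite normrZ gtr0_norm ?invr_gt0// ler_pdivrMl.
have wE : w = e *: w' by rewrite scalerA mulfV ?scale1r// gt_eqF.
have [U1 f1] := H w' w'r.
have [U2 f2] : U (y - w') /\ f (y - w') <= M by apply: H; rewrite normrN.
have [Uw fw1] : U (y + w) /\ f (y + w) <= e * f (y + w') + (1 - e) * f y.
  have -> : y + w = e *: (y + w') + (1 - e) *: y.
    by rewrite scalerDr addrAC -scalerDl subrKC scale1r -wE addrC.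
  by apply: cf => //; rewrite (ltW e0).
have fw2 : (1 + e) * f y <= f (y + w) + e * f (y - w').
  have t01 : 0 <= (1 + e)^-1 <= 1.
    have : 1 <= 1 + e by rewrite lerDl ltW.
    by move=> h; rewrite invr_ge0 (le_trans _ h)//= invf_le1// (lt_le_trans _ h).
  have e10 : 1 + e != 0 by rewrite gt_eqF// addr_gt0.
  have en0 : e != 0 by rewrite gt_eqF.
  have [_] := cf _ _ _ Uw U2 t01.
  have -> : (1 + e)^-1 *: (y + w) + (1 - (1 + e)^-1) *: (y - w') = y.
    rewrite wE !scalerDr addrACA -scalerDl subrKC scale1r.
    rewrite scalerN !scalerA -scalerBl (_ : _ - _ = 0) ?scale0r ?addr0//.
    by field; rewrite ?e10 ?en0.
  rewrite -(ler_pM2l (_ : 0 < 1 + e)) ?addr_gt0//.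
  move/le_trans; apply.
  by rewrite mulrDr !mulrA mulfV// mul1r mulrBr mulr1 mulfV// addrAC subrr add0r.
have h1 := ler_wpM2l (ltW e0) f1; have h2 := ler_wpM2l (ltW e0) f2.
apply/ler_normlP; split.
  by move: fw2 h2 eM; rewrite mulrDl mul1r mulrBr; lra.
by move: fw1 h1 eM; rewrite mulrBl mul1r mulrBr; lra.
Qed.

End convex_on.

Lemma continuous_measurable_mx (R : realType) (m n : nat) (f : 'M[R]_(m, n) -> R) :
  continuous f -> measurable_fun [set: 'M[R]_(m, n)] f.
Proof.
move=> /continuousP cf.
apply: (measurability _ (RGenOInfty.measurableE R)) => _ [_ [a ->]] <-.
rewrite setTI; apply: open_measurable_mx; apply: cf; exact: interval_open.
Qed.

Lemma lipschitz_continuous (R : realType) (V : normedModType R) (f : V -> R) (L : R) :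
  (forall v w, `|f (v + w) - f v| <= L * `|w|) -> continuous f.
Proof.
move=> lf x; apply/cvgrPdist_le => eta eta0; near=> y.
rewrite -[y](subrKC x) distrC; apply: le_trans (lf _ _) _.
have L0 : 0 < `|L| + 1 by rewrite ltr_wpDl.
apply: (@le_trans _ _ ((`|L| + 1) * `|y - x|)).
  by rewrite ler_wpM2r// (le_trans (ler_norm _))// lerDl.
rewrite -ler_pdivlMl// mulrC; near: y.
apply/nbhs_ballP; exists (eta / (`|L| + 1)); first by rewrite /= divr_gt0.
by move=> y; rewrite -ball_normE/= distrC => /ltW.
Unshelve. all: by end_near. Qed.

Lemma dot_row (R : realType) (d : nat) (u w : 'rV[R]_d) :
  dot u w = \sum_i u ord0 i * w ord0 i.
Proof. by rewrite /dot big_ord1. Qed.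

Section convex_differentiability.
Context (R : realType) (d : nat).
Notation E := 'rV[R]_d.
Notation leb := (lebesgue_rV R d).
Notation e_ i := (delta_mx ord0 i : E).
Context (k : E -> R) (L : R).
Hypothesis L_ge0 : 0 <= L.
Hypothesis ck : convex_on setT k.
Hypothesis lk : forall v w, `|k (v + w) - k v| <= L * `|w|.
Implicit Types (x e w : E) (s t : R).

(** Monotonicity of the difference quotients of a convex function, cleared of denominators so that
    [s = 0] is allowed. *)
Lemma slope_le x e s t : 0 <= s -> s <= t ->
  t * (k (x + s *: e) - k x) <= s * (k (x + t *: e) - k x).
Proof.
move=> s0; rewrite le_eqVlt => /predU1P[->//|st].
have t0 : 0 < t by exact: le_lt_trans st.
have t01 : 0 <= s / t <= 1 by rewrite divr_ge0 ?(ltW t0)//= ler_pdivrMr// mul1r ltW.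
have [_] := ck (x := x + t *: e) (y := x) Logic.I Logic.I t01.
have -> : (s / t) *: (x + t *: e) + (1 - s / t) *: x = x + s *: e.
  by rewrite scalerDr addrAC -scalerDl subrKC scale1r scalerA divfK// gt_eqF.
move=> /(ler_wpM2l (ltW t0)).
have -> : t * (s / t * k (x + t *: e) + (1 - s / t) * k x) =
    s * k (x + t *: e) + (t - s) * k x by field; rewrite gt_eqF.
by lra.
Qed.

(** Scaled second difference with step [1/(n+1)]. It is the sum of the right quotients along [e] and
    [- e], hence nonnegative and nonincreasing in [n]; its limit is the jump of the one-sided
    derivatives along [e]. *)
Definition sdq e (n : nat) x : R :=
  n.+1%:R * (k (x + n.+1%:R^-1 *: e) + k (x - n.+1%:R^-1 *: e) - 2 * k x).

Definition rdq e (n : nat) x : R := n.+1%:R * (k (x + n.+1%:R^-1 *: e) - k x).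

Lemma midpoint x w : 2 * k x <= k (x + w) + k (x - w).
Proof.
have h : 0 <= (2^-1 : R) <= 1 by apply/andP; split; lra.
have [_] := ck (x := x + w) (y := x - w) Logic.I Logic.I h.
have -> : 2^-1 *: (x + w) + (1 - 2^-1) *: (x - w) = x.
  by apply/matrixP => i j; rewrite !mxE; lra.
lra.
Qed.

Lemma sdq_ge0 e n x : 0 <= sdq e n x.
Proof. by rewrite mulr_ge0// subr_ge0 midpoint. Qed.

Lemma sdqE e n x : sdq e n x = rdq e n x + rdq (- e) n x.
Proof. by rewrite /sdq /rdq scalerN; ring. Qed.

Lemma rdq_nonincreasing e x n m : (n <= m)%N -> rdq e m x <= rdq e n x.
Proof.
move=> nm; rewrite /rdq.
have := @slope_le x e m.+1%:R^-1 n.+1%:R^-1; rewrite invr_ge0 ler0n => /(_ isT).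
rewrite lef_pV2 ?posrE// ler_nat ltnS => /(_ nm).
by rewrite ler_pdivrMl// mulrCA ler_pdivlMl.
Qed.

Lemma sdq_nonincreasing e x n m : (n <= m)%N -> sdq e m x <= sdq e n x.
Proof. by move=> nm; rewrite !sdqE lerD// rdq_nonincreasing. Qed.

Lemma rdq_bounded e n x : `|rdq e n x| <= L * `|e|.
Proof.
rewrite normrM gtr0_norm// -ler_pdivlMl// mulrCA; apply: le_trans (lk _ _) _.
by rewrite normrZ gtr0_norm ?invr_gt0.
Qed.

Let continuous_k : continuous k.
Proof. exact: lipschitz_continuous lk. Qed.

Lemma continuous_k_shift w : continuous (fun x => k (x + w)).
Proof.
apply: (@lipschitz_continuous R _ (fun x => k (x + w)) L) => u v.
by rewrite -addrA (addrC v) addrA.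
Qed.

Lemma measurable_rdq e n : measurable_fun setT (rdq e n).
Proof.
apply: measurable_funM => //; apply: measurable_funB.
  exact: continuous_measurable_mx (@continuous_k_shift _).
exact: continuous_measurable_mx.
Qed.

Lemma measurable_sdq e n : measurable_fun setT (sdq e n).
Proof.
have -> : sdq e n = rdq e n \+ rdq (- e) n by apply/funext => x; rewrite sdqE.
by apply: measurable_funD; exact: measurable_rdq.
Qed.
(* Second differences telescope along a line, so the sum of the kinks of [k] on a segment is at most twice its Lipschitz constant. *)
Lemma sum_sdq_le e m x :
  \sum_(j < m.+1) sdq e m (x + (j%:R / m.+1%:R) *: e) <= 2 * (L * `|e|).
Proof.
pose b (j : nat) := k (x + ((j%:R - 1) / m.+1%:R) *: e).
have m0 : m.+1%:R != 0 :> R by rewrite pnatr_eq0.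
have bE (j : nat) : sdq e m (x + (j%:R / m.+1%:R) *: e) =
    m.+1%:R * (b j.+2 + b j - 2 * b j.+1).
  rewrite /sdq /b -!(addrA x) -!scalerBl -!scalerDl.
  have -> : j%:R / m.+1%:R + m.+1%:R^-1 = (j.+2%:R - 1) / m.+1%:R :> R.
    by rewrite -[j.+2]addn2 natrD; set t := m.+1%:R^-1; ring.
  have -> : j%:R / m.+1%:R - m.+1%:R^-1 = (j%:R - 1) / m.+1%:R :> R.
    by rewrite mulrBl div1r.
  by have -> : j%:R / m.+1%:R = (j.+1%:R - 1) / m.+1%:R :> R by rewrite -[j.+1]addn1 natrD addrK.
under eq_bigr do rewrite bE.
rewrite -mulr_sumr.
have tele (n : nat) : \sum_(j < n) (b j.+2 + b j - 2 * b j.+1) =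
    (b n.+1 - b n) - (b 1%N - b 0%N).
  elim: n => [|n IH]; first by rewrite big_ord0 subrr.
  by rewrite big_ord_recr/= IH; ring.
rewrite tele -ler_pdivlMl// .
have step (j : nat) : `|b j.+1 - b j| <= m.+1%:R^-1 * (L * `|e|).
  have -> : b j.+1 = k (x + ((j%:R - 1) / m.+1%:R) *: e + m.+1%:R^-1 *: e).
    rewrite /b -addrA -scalerDl; congr (k (x + _ *: e)).
    by rewrite -[j.+1]addn1 natrD; set t := m.+1%:R^-1; ring.
  apply: le_trans (lk _ _) _; rewrite normrZ gtr0_norm ?invr_gt0//.
  by rewrite mulrCA.
have := step 0%N; have := step m.+1 => /ler_normlP[h1 h2] /ler_normlP[h3 h4].
by rewrite [leRHS]mulrCA mulr_natl mulr2n; exact: lerD.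
Qed.

(** By monotonicity in [n], these are the points where the one-sided derivatives along [e] jump by
    at least [eps]. *)
Definition kinks e (eps : R) : set E := [set x | forall n, eps <= sdq e n x].

Lemma measurable_kinks e eps : measurable (kinks e eps).
Proof.
have -> : kinks e eps = \bigcap_n (sdq e n @^-1` `[eps, +oo[%classic).
  apply/seteqP; split=> x h n; first by move=> _; rewrite /= in_itv/= h.
  by have := h n Logic.I; rewrite /= in_itv/= andbT.
apply: bigcapT_measurable => n.
by rewrite -[X in measurable X]setTI; apply: measurable_sdq.
Qed.

(** By [sum_sdq_le], a point belongs to at most [c = 2 L |e| / eps] of the [m + 1] translates of [B]
    by multiples of [e / (m + 1)]. Integrating this count over a box [C] containing them all gives
    [(m + 1) * leb B <= c * leb C] for every [m], which forces [leb B = 0] without slicing along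
    lines. *)
Lemma leb_kinks_bounded e (eps : R) (K : R) : 0 < eps ->
  leb (kinks e eps `&` cbox (const_mx (- K)) (const_mx K)) = 0%E.
Proof.
move=> eps0; set B := _ `&` _.
have mB : measurable B.
  by apply: measurableI; [exact: measurable_kinks|exact: measurable_cbox].
(* Translations by at most [e] keep the cube of half-side [K] inside this one. *)
pose K' := K + `|e|; pose C := cbox (const_mx (- K') : E) (const_mx K').
pose c := 2 * (L * `|e|) / eps.
have c0 : 0 <= c by rewrite divr_ge0 ?(ltW eps0)// !mulr_ge0.
have mC : measurable C by exact: measurable_cbox.
have Cfin : leb C \is a fin_num by rewrite ge0_fin_numE//; exact: leb_cbox_lty.
have Bfin : leb B \is a fin_num.
  rewrite ge0_fin_numE//; apply: le_lt_trans (leb_cbox_lty (const_mx (- K) : E) (const_mx K)).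
  by apply: le_measure; rewrite ?inE//; [exact: measurable_cbox|move=> x []].
pose T (m j : nat) := [set x | B ((j%:R / m.+1%:R) *: e + x)].
have mT m j : measurable (T m j).
  rewrite -[X in measurable X]setTI.
  apply: (_ : measurable_fun setT (fun x : E => (j%:R / m.+1%:R) *: e + x)) => //.
  apply/measurable_fun_mxP => i l; under eq_fun do rewrite mxE.
  by apply: measurable_funD => //; exact: measurable_coord.
have key m x : (\sum_(j < m.+1) (\1_(T m j) x)%:E <= c%:E * (\1_C x)%:E)%E.
  rewrite sumEFin -EFinM lee_fin indicE.
  have [xC|xC] := boolP (x \in C); last first.
    rewrite mulr0 big1// => j _; rewrite indicE memNset//.
    move=> [_ xB]; move/negP : xC; apply; rewrite inE => i.
    have := xB i; rewrite !mxE -!ler_norml /K' => xi.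
    have -> : x ord0 i = (j%:R / m.+1%:R * e ord0 i + x ord0 i) - j%:R / m.+1%:R * e ord0 i by ring.
    apply: le_trans (ler_normB _ _) _; apply: lerD => //.
    rewrite normrM ger0_norm ?divr_ge0//; apply: le_trans (ler_piMl _ _) _ => //.
      by rewrite ler_pdivrMr// mul1r ler_nat ltnW.
    exact: mx_coord_le_norm.
  rewrite mulr1 /c ler_pdivlMr// mulr_suml.
  apply: le_trans _ (sum_sdq_le e m x); apply: ler_sum => j _.
  rewrite indicE; have [xT|xT] := boolP (x \in T m j); last by rewrite mul0r sdq_ge0.
  rewrite mul1r; move: xT; rewrite inE => -[xT _].
  by rewrite addrC; exact: xT.
have bound m : (m.+1%:R%:E * leb B <= c%:E * leb C)%E.
  have -> : (m.+1%:R%:E * leb B = \int[leb]_x \sum_(j < m.+1) (\1_(T m j) x)%:E)%E.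
    rewrite ge0_integral_sum//; last first.
      by move=> j; apply/measurable_EFinP; exact: measurable_indic.
    rewrite (eq_bigr (fun=> leb B)); last first.
      by move=> j _; rewrite integral_indic// setIT; exact: leb_translate.
    by rewrite sumr_const card_ord mule_natl.
  have -> : (c%:E * leb C = \int[leb]_x (c%:E * (\1_C x)%:E))%E.
    rewrite ge0_integralZl//; last first.
      by apply/measurable_EFinP; exact: measurable_indic.
    by rewrite integral_indic// setIT.
  apply: ge0_le_integral => //.
  - by move=> x _; apply: sume_ge0 => j _; rewrite lee_fin.
  - apply: emeasurable_sum => j; apply/measurable_EFinP; exact: measurable_indic.
  - by apply: measurable_funeM; apply/measurable_EFinP; exact: measurable_indic.
apply/eqP; rewrite eq_le measure_ge0 andbT.
rewrite -(fineK Bfin) -[X in (_ <= X)%E]/(0%:E) lee_fin leNgt; apply/negP => B0.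
(* This is the first [m] for which [m + 1] exceeds [c * leb C / leb B]. *)
have := bound (Num.trunc (c * fine (leb C) / fine (leb B))).
rewrite -(fineK Bfin) -(fineK Cfin) -!EFinM lee_fin -ler_pdivlMr// leNgt.
by rewrite truncnS_gt.
Qed.

Lemma negligible_kinks e (eps : R) : 0 < eps -> leb.-negligible (kinks e eps).
Proof.
move=> eps0.
have -> : kinks e eps =
    \bigcup_n (kinks e eps `&` cbox (const_mx (- n%:R)) (const_mx n%:R)).
  apply/seteqP; split=> [x kx|x [n _ []//]].
  exists (Num.trunc `|x|).+1 => //; split => // i; rewrite !mxE -ler_norml.
  apply: le_trans (mx_coord_le_norm x ord0 i) _.
  by apply: ltW; exact: truncnS_gt.
apply: negligible_bigcup => n; apply/negligibleP.
  by apply: measurableI; [exact: measurable_kinks|exact: measurable_cbox].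
exact: leb_kinks_bounded.
Qed.

(** The points without a kink along any coordinate axis. For a convex function this already gives
    full differentiability ([has_gradient_smooth]), and countably many conditions keep the set
    Borel. *)
Definition smooth_pts : set E :=
  [set x | forall i (p : nat), exists n, sdq (e_ i) n x < p.+1%:R^-1].

Lemma measurable_smooth_pts : measurable smooth_pts.
Proof.
have -> : smooth_pts = \bigcap_(i in [set: 'I_d]) \bigcap_p ~` kinks (e_ i) p.+1%:R^-1.
  apply/seteqP; split=> [x h i _ p _|x h i p].
    by move=> kx; have [n] := h i p; rewrite ltNge => /negP; apply; exact: kx.
  have /existsNP[n /negP] := h i Logic.I p Logic.I.
  by rewrite -ltNge => ?; exists n.
apply: fin_bigcap_measurable => // i _; apply: bigcapT_measurable => p.
by apply: measurableC; exact: measurable_kinks.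
Qed.

Lemma negligible_smooth_ptsC : leb.-negligible (~` smooth_pts).
Proof.
pose F (c : nat) := if unpickle c is Some (i, p) then
  kinks (e_ (i : 'I_d)) (p : nat).+1%:R^-1 else set0.
apply: (@negligibleS _ _ _ _ (\bigcup_c F c)); last first.
  apply: negligible_bigcup => c; rewrite /F.
  case: unpickle => [[i p]|]; last exact: negligible_set0.
  by apply: negligible_kinks; rewrite invr_gt0.
move=> x /existsNP[i /existsNP[p xp]].
exists (pickle (i, p)) => //; rewrite /F pickleK => n.
by rewrite leNgt; apply/negP => h; apply: xp; exists n.
Qed.

(** Right derivatives along the axes exist everywhere, by monotonicity and the Lipschitz bound; so
    [grad] is measurable on the whole space, although it is a gradient only at points such as those
    of [smooth_pts]. *)
Definition grad x : E := \row_i limn (fun n => rdq (e_ i) n x).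

Lemma cvg_rdq e x : cvgn (fun n => rdq e n x).
Proof.
apply: nonincreasing_is_cvgn; first by move=> n m; exact: rdq_nonincreasing.
by exists (- (L * `|e|)) => _ [n _ <-]; have /ler_normlP[] := rdq_bounded e n x; rewrite lerNl.
Qed.

Lemma measurable_grad : measurable_fun setT grad.
Proof.
apply/measurable_fun_mxP => i j; rewrite (ord1 i).
apply: (@measurable_fun_cvg _ _ _ _ (fun n => rdq (e_ j) n)).
  by move=> n; exact: measurable_rdq.
by move=> x _; rewrite mxE; exact: cvg_rdq.
Qed.

(** For [s >= 0] the right quotient is close to its limit; for [s < 0] the left one is controlled by
    the right one and a small second difference. Both quantities decrease in [n], so one index
    serves for both. *)
Lemma axis_le_grad x i : smooth_pts x -> forall eta : R, 0 < eta ->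
  exists2 rho : R, 0 < rho & forall s, `|s| <= rho ->
    k (x + s *: e_ i) - k x - s * grad x ord0 i <= eta * `|s|.
Proof.
move=> xs eta eta0; set g := grad x ord0 i.
have gE : g = limn (fun n => rdq (e_ i) n x) by rewrite /g mxE.
have rg n : g <= rdq (e_ i) n x.
  rewrite gE; apply: nonincreasing_cvgn_ge (@cvg_rdq _ _) n.
  by move=> a b; exact: rdq_nonincreasing.
have [n1 rn1] : exists n, rdq (e_ i) n x <= g + eta.
  have /cvgrPdist_le/(_ _ eta0)[n _ /(_ n (leqnn n)) /=] := @cvg_rdq (e_ i) x.
  by rewrite -gE => /ler_normlP[h1 h2]; exists n; lra.
have [n2 sn2] : exists n, sdq (e_ i) n x <= eta.
  have [p _ /(_ _ (leqnn _)) /= pe] := near_infty_natSinv_lt (PosNum eta0).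
  by have [n /ltW h] := xs i p; exists n; apply: le_trans h (ltW pe).
pose n := maxn n1 n2.
have rn : rdq (e_ i) n x <= g + eta.
  by apply: le_trans rn1; apply: rdq_nonincreasing; rewrite leq_maxl.
have sn : sdq (e_ i) n x <= eta.
  by apply: le_trans sn2; apply: sdq_nonincreasing; rewrite leq_maxr.
have N0 : 0 < n.+1%:R :> R by rewrite ltr0n.
exists n.+1%:R^-1; first by rewrite invr_gt0.
move=> s; have [s0|s0] := leP 0 s.
  rewrite ger0_norm// => sN.
  have := slope_le x (e_ i) s0 sN; rewrite ler_pdivrMl// mulrCA => h.
  have := ler_wpM2l s0 rn; rewrite /rdq mulrDr => h2.
  by move: h h2; rewrite (mulrC eta); lra.
rewrite ltr0_norm// => sN; have s0' : 0 <= - s by rewrite oppr_ge0 ltW.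
have := slope_le x (- e_ i) s0' sN; rewrite ler_pdivrMl// mulrCA scaleNr scalerN opprK => h.
have h1 : rdq (- e_ i) n x <= eta - g.
  by have := sdqE (e_ i) n x; have := rg n; lra.
have := ler_wpM2l s0' h1; rewrite {1}/rdq => h2.
by move: h h2; rewrite (mulrC eta) mulrBr !mulNr; lra.
Qed.

(** Averaging the axis estimates bounds the increment from above; the bound from below follows from
    the one at [- w] and midpoint convexity. *)
Lemma has_gradient_smooth x : (0 < d)%N -> smooth_pts x -> has_gradient k x (grad x).
Proof.
move=> d0 xs eta eta0.
have d0' : 0 < d%:R :> R by rewrite ltr0n.
have ed0 : 0 < eta / d%:R by rewrite divr_gt0.
have rho i : {rho : R | 0 < rho & forall s, `|s| <= rho ->
    k (x + s *: e_ i) - k x - s * grad x ord0 i <= eta / d%:R * `|s|}.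
  by apply: cid2; exact: axis_le_grad.
pose r := \big[Num.min/1]_i s2val (rho i).
have r0 : 0 < r by apply: lt_bigmin => // i _; exact: (s2valP (rho i)).
have ri i : r <= s2val (rho i) by exact: (bigmin_le _ i (fun i => s2val (rho i))).
have upper w : `|w| <= r / d%:R -> k (x + w) - k x - dot (grad x) w <= eta * `|w|.
  move=> wr.
  have [_ kw] := convex_on_axes (w := w) d0 ck (y := x) (fun _ => Logic.I).
  have dw i : `|d%:R * w ord0 i| <= d%:R * `|w|.
    by rewrite normrM gtr0_norm// ler_pM2l//; exact: mx_coord_le_norm.
  have wi i : k (x + (d%:R * w ord0 i) *: e_ i) <=
      k x + d%:R * (grad x ord0 i * w ord0 i) + eta * `|w|.
    have h : `|d%:R * w ord0 i| <= s2val (rho i).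
      apply: le_trans (ri i); apply: le_trans (dw i) _.
      by rewrite mulrC -ler_pdivlMr.
    have h2 := s2valP' (rho i) _ h.
    have h1 : eta / d%:R * `|d%:R * w ord0 i| <= eta * `|w|.
      by rewrite mulrAC ler_pdivrMr// -mulrA ler_pM2l// [leRHS]mulrC.
    have -> : d%:R * (grad x ord0 i * w ord0 i) = d%:R * w ord0 i * grad x ord0 i by ring.
    by lra.
  have : k (x + w) <= k x + dot (grad x) w + eta * `|w|.
    apply: le_trans kw _; rewrite ler_pdivrMl//.
    apply: le_trans (ler_sum _ (fun i _ => wi i)) _.
    rewrite !big_split/= !sumr_const card_ord -mulr_sumr -dot_row.
    by rewrite -[k x *+ d]mulr_natl -[(eta * _) *+ d]mulr_natl -!mulrDr.
  lra.
exists (r / d%:R); first by rewrite divr_gt0.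
move=> w wr; apply/ler_normlP; split; last exact: upper.
have := @upper (- w); rewrite normrN => /(_ wr).
by have := midpoint x w; rewrite dotNr; lra.
Qed.

End convex_differentiability.

(** * Potentials on a convex body *)

Lemma convex_set_comb (R : realType) (V : lmodType R) (A : set (convex_lmodType V))
    (x y : V) (t : R) :
  convex_set A -> A x -> A y -> 0 <= t <= 1 -> A (t *: x + (1 - t) *: y).
Proof.
move=> cA Ax Ay /andP[t0 t1].
by have := cA x y (Itv01 t0 t1) (mem_set Ax) (mem_set Ay); rewrite inE.
Qed.

Lemma closure_normP (R : realType) (V : normedModType R) (A : set V) x :
  closure A x <-> forall e : R, 0 < e -> exists2 y, A y & `|x - y| < e.
Proof.
split=> [clx e e0|H B].
  have [y [Ay xy]] := clx (ball x e) (nbhsx_ballx x e e0).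
  by exists y => //; move: xy; rewrite -ball_normE.
move=> /nbhs_ballP[e /= e0 eB]; have [y Ay xy] := H _ e0.
by exists y; split => //; apply: eB; rewrite -ball_normE.
Qed.

Lemma closure_convex_comb (R : realType) (d : nat) (A : set (convex_lmodType 'rV[R]_d))
    (x y : 'rV[R]_d) (t : R) : convex_set A ->
  closure (A : set 'rV[R]_d) x -> (A : set 'rV[R]_d) y -> 0 <= t <= 1 ->
  closure (A : set 'rV[R]_d) (t *: x + (1 - t) *: y).
Proof.
move=> cA /closure_normP clx Ay t01; apply/closure_normP => e e0.
have [z Az xz] := clx _ e0; exists (t *: z + (1 - t) *: y).
  exact: convex_set_comb.
rewrite opprD addrACA subrr addr0 -scalerBr normrZ; apply: le_lt_trans xz.
by case/andP: t01 => t0 t1; rewrite ger0_norm// ler_piMl.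
Qed.

(** The separating direction joins [z] to its Euclidean projection [p] on the compact closure of
    [A]: a point of [A] beyond the hyperplane through [p] would allow a move that decreases the
    distance to [z]. *)
Lemma separation (R : realType) (d : nat) (A : set (convex_lmodType 'rV[R]_d))
    (z : 'rV[R]_d) : convex_set A -> (A : set 'rV[R]_d) !=set0 ->
  bounded_set (A : set 'rV[R]_d) -> ~ closure (A : set 'rV[R]_d) z ->
  exists (w : 'rV[R]_d) (c : R), (forall y, (A : set 'rV[R]_d) y -> dot y w <= c) /\
    c < dot z w.
Proof.
move=> cA [a Aa] bA nz; set A' := (A : set 'rV[R]_d).
pose N (y : 'rV[R]_d) : R := dot (y - z) (y - z).
have cN : continuous N.
  have -> : N = fun y => \sum_i (y ord0 i - z ord0 i) * (y ord0 i - z ord0 i).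
    by apply/funext => y; rewrite /N dot_row; apply: eq_bigr => i _; rewrite !mxE.
  apply: continuous_big => [|i _]; first exact: add_continuous.
  have cyi : continuous (fun y : 'rV[R]_d => y ord0 i - z ord0 i).
    by move=> y; apply: continuousB; [exact: coord_continuous|exact: cst_continuous].
  move=> y; exact: (continuousM (cyi y) (cyi y)).
have [p clp pmin] : exists2 p, closure A' p & forall y, closure A' y -> N p <= N y.
  have [|||p] := @EVT_min_rV _ _ N (closure A').
  - by exists a; exact: subset_closure.
  - apply: bounded_closed_compact; last exact: closed_closure.
    have [M M0 AM] := bounded_set_cbox bA.
    exists M; split; first exact: num_real.
    move=> M' MM' y /= cly; apply: le_trans (ltW MM').
    have := @closed_cbox _ _ _ _ _ (closure_subset AM cly).
    move=> yM; apply: mx_norm_le; first exact: ltW.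
    by move=> i j; rewrite ord1; have := yM j; rewrite !mxE ler_norml.
  - exact: continuous_subspaceT.
  - rewrite inE => clp pmin; exists p => // y cly; apply: pmin; rewrite inE//.
have pz : 0 < dot (z - p) (z - p).
  rewrite lt_neqAle; apply/andP; split; last first.
    by apply: le_trans (sqr_norm_le_dot _); rewrite sqr_ge0.
  apply/eqP => h; apply: nz; suff -> : z = p by [].
  have := sqr_norm_le_dot (z - p); rewrite -h => h2.
  have : `|z - p| ^+ 2 == 0 by rewrite eq_le h2 sqr_ge0.
  by rewrite sqrf_eq0 normr_eq0 subr_eq0 => /eqP.
exists (z - p), (dot p (z - p)); split; last by rewrite -subr_gt0 -dotBl.
move=> y Ay; rewrite leNgt; apply/negP; rewrite -subr_gt0 -dotBl => yp.
pose D := dot (y - p) (y - p).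
have D0 : 0 <= D by apply: le_trans (sqr_norm_le_dot _); rewrite sqr_ge0.
(* Small enough for the first-order gain [2 t (y - p).(z - p)] to exceed the quadratic term [t^2 D];
   [D + 1] avoids a zero denominator. *)
pose t : R := Num.min 1 (dot (y - p) (z - p) / (D + 1)).
have D1 : 0 < D + 1 by rewrite ltr_wpDl.
have t0 : 0 < t by rewrite lt_min ltr01 divr_gt0.
have t1 : t <= 1 by rewrite ge_min lexx.
have tD : t * D < 2 * dot (y - p) (z - p).
  apply: (@le_lt_trans _ _ (dot (y - p) (z - p))); last by lra.
  have : t <= dot (y - p) (z - p) / (D + 1) by rewrite ge_min lexx orbT.
  rewrite ler_pdivlMr// => h; apply: le_trans h.
  by rewrite ler_pM2l// lerDl.
have cl1 : closure A' ((1 - t) *: p + (1 - (1 - t)) *: y).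
  by apply: closure_convex_comb => //; apply/andP; split; lra.
have := pmin _ cl1; rewrite leNgt => /negP; apply.
have -> : N ((1 - t) *: p + (1 - (1 - t)) *: y) = N p - t * (2 * dot (y - p) (z - p)) + t * (t * D).
  have -> : (1 - t) *: p + (1 - (1 - t)) *: y = p + t *: (y - p).
    by apply/matrixP => i j; rewrite !mxE; ring.
  rewrite /N /D [p + _ - z]addrAC -(opprB p z) dotNr.
  move: (p - z) (y - p) => u v.
  by rewrite dotDl !dotDr !dotZl !dotZr (dotC u v); ring.
rewrite -addrA gtrDl -mulrN -mulrDr pmulr_rlt0// addrC subr_lt0.
exact: tD.
Qed.

Lemma cvg_eps (R : realType) (V : normedModType R) (f : V -> R) (y : V) :
  (forall eta : R, 0 < eta -> exists2 rho : R, 0 < rho &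
    forall w : V, `|w| <= rho -> `|f (y + w) - f y| <= eta) -> f x @[x --> y] --> f y.
Proof.
move=> H; apply/cvgrPdist_le => eta eta0; have [rho rho0 {}H] := H _ eta0.
near=> x; rewrite distrC -{1}[x](subrKC y); apply: H.
near: x; apply/nbhs_ballP; exists rho => // x.
by rewrite -ball_normE/= distrC => /ltW.
Unshelve. all: by end_near. Qed.

Lemma within_open_continuous_fine (K : realType) (V : normedModType K) (h : V -> \bar K) (U : set V) :
  open U -> (forall x, U x -> h x \is a fin_num) ->
  (forall y : V, U y -> forall eta : K, 0 < eta -> exists2 rho : K, 0 < rho &
    forall w : V, `|w| <= rho -> `|fine (h (y + w)) - fine (h y)| <= eta) ->
  {within U, continuous h}.
Proof.
move=> oU hU H; apply: continuous_in_subspaceT => y; rewrite inE => Uy.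
have nU : \forall x \near y, U x by exact: open_nbhs_nbhs.
have key : fine (h x) @[x --> y] --> fine (h y) by apply: cvg_eps; exact: H.
rewrite /continuous_at -(fineK (hU _ Uy)).
by apply: cvg_EFin => //; apply: filterS nU => x; exact: hU.
Qed.

Section potentials.
Context (R : realType) (d : nat).
Notation E := 'rV[R]_d.
Notation leb := (lebesgue_rV R d).
Context (Lam : set E).
Implicit Types (k : E -> R) (g l h : E -> \bar R) (y z v w : E) (c L M : R).
Local Open Scope ereal_scope.

(* [k (v + w) - k v] is bounded by the support function of [Lam] at [w]. *)
Definition supp_lip k := forall v w c,
  (forall y, Lam y -> (dot y w <= c)%R) -> (k (v + w) <= k v + c)%R.

Lemma supp_lip_lipschitz k M : (forall y, Lam y -> (`|y| <= M)%R) -> supp_lip k ->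
  forall v w, (`|k (v + w)%R - k v| <= (1 * d)%:R * M * `|w|)%R.
Proof.
move=> LM sk v w.
have bnd (w' : E) : (`|w'| = `|w|)%R -> forall y, Lam y -> (dot y w' <= (1 * d)%:R * M * `|w|)%R.
  move=> ww' y Ly; apply: le_trans (ler_norm _) _; apply: le_trans (dot_norm_le _ _) _.
  by rewrite ww' -mulrA ler_wpM2l// ler_wpM2r// LM.
apply/ler_normlP; split; last first.
  by rewrite lerBlDl; apply: sk; exact: bnd.
rewrite opprB lerBlDl -{1}(addrK w v).
by apply: sk; apply: bnd; rewrite normrN.
Qed.

Definition ext_infty g : E -> \bar R := fun y => if y \in Lam then g y else +oo.

(** Taking [fine] loses nothing when [Lam] is bounded and [g] is nonnegative on [Lam] and finite at
    one of its points: see [kpot_fin_num]. *)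
Definition kpot g : E -> R := fun v => fine (legendre (ext_infty g) v).

Section kpot.
Context (M : R) (g : E -> \bar R) (y0 : E).
Hypothesis LM : forall y, Lam y -> (`|y| <= M)%R.
Hypothesis g_ge0 : forall y, Lam y -> 0 <= g y.
Hypothesis Ly0 : Lam y0.
Hypothesis gy0 : g y0 \is a fin_num.

Lemma kpot_fin_num v : legendre (ext_infty g) v \is a fin_num.
Proof.
rewrite fin_numE; apply/andP; split.
  rewrite gt_eqF//; apply: lt_le_trans (legendre_ge _ y0 _).
  by rewrite /ext_infty mem_set//; move: gy0; case: (g y0) => // r _; rewrite -EFinB ltNyr.
rewrite lt_eqF//; apply: (@le_lt_trans _ _ ((1 * d)%:R * (M * `|v|))%:E); last exact: ltry.
apply: legendre_le => y; rewrite /ext_infty.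
case: ifPn => [|_]; last by rewrite leNye.
rewrite inE => Ly.
apply: (@le_trans _ _ (dot y v)%:E).
  by have := g_ge0 Ly; case: (g y) => [r| |]//; rewrite ?leNye// -EFinB !lee_fin gerBl.
rewrite lee_fin; apply: le_trans (ler_norm _) _; apply: le_trans (dot_norm_le _ _) _.
by rewrite ler_wpM2l// ler_wpM2r// LM.
Qed.

Lemma kpotE : EFin \o kpot g = legendre (ext_infty g).
Proof. by apply/funext => v /=; rewrite fineK// kpot_fin_num. Qed.

Lemma kpot_ge y v : Lam y -> (dot y v)%:E <= (kpot g v)%:E + g y.
Proof.
move=> Ly; have := legendre_ge (ext_infty g) y v.
rewrite -[legendre _ _]/(legendre (ext_infty g) v) -kpotE /= /ext_infty mem_set//.
have := g_ge0 Ly; case: (g y) => [r| |]//; rewrite ?addey ?leey//.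
by rewrite -EFinB -EFinD !lee_fin lerBlDr.
Qed.

Lemma kpot_supp_lip : supp_lip (kpot g).
Proof.
move=> v w c wc; rewrite -lee_fin EFinD -[(kpot g _)%:E]/((EFin \o kpot g) (v + w)%R) kpotE.
apply: legendre_le => y; rewrite /ext_infty.
case: ifPn => [|_]; last by rewrite leNye.
rewrite inE => Ly; have := kpot_ge v Ly; have := g_ge0 Ly.
case: (g y) => [r| |]//; rewrite ?leNye// -EFinB -!EFinD !lee_fin dotDr => _ h.
by have := wc _ Ly; lra.
Qed.

Lemma kpot0 : ereal_inf (g @` Lam) = 0 -> kpot g 0%R = 0%R.
Proof.
move=> ig; apply: EFin_inj; rewrite -[LHS]/((EFin \o kpot g) 0%R) kpotE.
apply/eqP; rewrite eq_le; apply/andP; split.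
  apply: legendre_le => y; rewrite /ext_infty dot0r.
  case: ifPn => [|_]; last by rewrite leNye.
  by rewrite inE => Ly; rewrite sub0e oppe_le0; exact: g_ge0.
rewrite leNgt; apply/negP => lt0.
have : - legendre (ext_infty g) 0 <= ereal_inf (g @` Lam).
  apply: le_ereal_inf_tmp => _ [y Ly <-].
  have := legendre_ge (ext_infty g) y 0%R; rewrite dot0r sub0e leeNl.
  by rewrite /ext_infty mem_set.
by rewrite ig leeNl oppe0 leNgt lt0.
Qed.

Lemma legendre_kpot_le y : Lam y -> legendre (EFin \o kpot g) y <= g y.
Proof.
move=> Ly; rewrite kpotE; apply: le_trans (legendre_involution_le _ _) _.
by rewrite /ext_infty mem_set.
Qed.

Lemma legendre2_kpot : legendre (legendre (EFin \o kpot g)) = EFin \o kpot g.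
Proof. by rewrite kpotE legendre3. Qed.

End kpot.

Lemma legendre_ge0 k : k 0%R = 0%R -> forall z, 0 <= legendre (EFin \o k) z.
Proof.
by move=> k0 z; have := legendre_ge (EFin \o k) 0%R z; rewrite /= dotC dot0r k0 -EFinB subr0.
Qed.

Lemma fenchel_young k z v : k 0%R = 0%R ->
  (dot z v)%:E <= (k v)%:E + legendre (EFin \o k) z.
Proof.
move=> k0; have := legendre_ge (EFin \o k) v z; have := legendre_ge0 k0 z.
rewrite dotC /=; case: (legendre _ z) => [r| |]//; rewrite ?addey ?leey// => _.
by rewrite -EFinB -EFinD !lee_fin; lra.
Qed.

(** If [w] separates [z] from [Lam] with bound [c], then along the ray [t w] the function [k] grows
    with slope at most [c], whereas [t w . z] grows with a larger slope; the supremum over [t] is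
    infinite. *)
Lemma legendre_out k : convex_set (Lam : set (convex_lmodType E)) -> Lam !=set0 ->
  bounded_set Lam -> supp_lip k -> forall z, ~ closure Lam z -> legendre (EFin \o k) z = +oo.
Proof.
move=> cL L0 bL sk z nz; have [w [c [Lc cz]]] := separation cL L0 bL nz.
apply: eq_infty => A.
pose t : R := (Num.max 0 ((A + k 0) / (dot z w - c)))%R.
have t0 : (0 <= t)%R by rewrite le_max lexx.
apply: le_trans (legendre_ge _ (t *: w)%R z).
have kt : (k (t *: w) <= k 0 + t * c)%R.
  rewrite -[X in k X]add0r; apply: sk => y Ly.
  by rewrite dotZr ler_wpM2l// Lc.
rewrite /= -EFinB lee_fin dotC dotZr.
have D0 : (0 < dot z w - c)%R by rewrite subr_gt0.
have : ((A + k 0) / (dot z w - c) <= t)%R by rewrite le_max lexx orbT.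
by rewrite ler_pdivrMr// mulrBr; lra.
Qed.

Lemma legendre_convex_on h U : convex_set (U : set (convex_lmodType E)) ->
  (forall y, U y -> legendre h y \is a fin_num) -> convex_on U (fine \o legendre h).
Proof.
move=> cU hU x y t Ux Uy t01; have Uz := convex_set_comb cU Ux Uy t01; split => //.
rewrite -lee_fin /= fineK ?hU//; apply: legendre_convex => //.
  by rewrite fineK ?hU.
by rewrite fineK ?hU.
Qed.

Lemma legendre_continuous h : (0 < d)%N -> open Lam ->
  convex_set (Lam : set (convex_lmodType E)) ->
  (forall y, Lam y -> legendre h y \is a fin_num) -> {within Lam, continuous (legendre h)}.
Proof.
move=> d0 oL cL hL; apply: within_open_continuous_fine => // y Ly eta eta0.
by have [rho rho0 H] := convex_on_continuous d0 oL (legendre_convex_on cL hL) Ly eta0; exists rho.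
Qed.

(** Integrability only gives finiteness almost everywhere. If the conjugate were infinite at [y],
    convexity would make it infinite at [x] or at the mirror point [2 y - x] for each [x] near [y],
    so a ball would be covered by a null set and its reflection. *)
Lemma legendre_finite h : open Lam -> measurable Lam ->
  (forall y, Lam y -> 0 <= legendre h y) ->
  \int[leb]_(y in Lam) legendre h y < +oo -> forall y, Lam y -> legendre h y \is a fin_num.
Proof.
move=> oL mL h0 hoo y Ly; rewrite ge0_fin_numE ?h0// ltNge leye_eq; apply/negP => /eqP hy.
have intg : leb.-integrable Lam (legendre h).
  apply/integrableP; split; first exact: measurable_funS (@measurable_legendre _ _ _ _).
  rewrite (eq_integral (legendre h))// => x; rewrite inE => Lx.
  by rewrite gee0_abs// h0.
have [N [mN N0 subN]] := integrable_ae mL intg.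
have /nbhs_ballP[e /= e0 eL] : nbhs y Lam by exact: open_nbhs_nbhs.
have mB : measurable (ball y e) by apply: measurable_open; exact: ball_open.
have mrN : measurable [set x | N (2 *: y - x)%R].
  rewrite -[X in measurable X]setTI.
  apply: (_ : measurable_fun setT (fun x : E => 2 *: y - x)%R) => //.
  apply/measurable_fun_mxP => i j; under eq_fun do rewrite !mxE.
  by apply: measurable_funB => //; exact: measurable_coord.
have sub : ball y e `<=` N `|` [set x | N (2 *: y - x)%R].
  move=> x xe; have Lx := eL _ xe.
  have Lx' : Lam (2 *: y - x)%R.
    apply: eL; move: xe; rewrite -!ball_normE/=.
    have -> : (y - (2 *: y - x) = - (y - x))%R by apply/matrixP => i j; rewrite !mxE; ring.
    by rewrite normrN.
  have [fx|nfx] := boolP (legendre h x \is a fin_num); last first.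
    by left; apply: subN => /= /(_ Lx); exact/negP.
  have [fx'|nfx'] := boolP (legendre h (2 *: y - x)%R \is a fin_num); last first.
    by right; apply: subN => /= /(_ Lx'); exact/negP.
  exfalso; have t01 : (0 <= (2^-1 : R) <= 1)%R by apply/andP; split; lra.
  have := @legendre_convex R 1 d h x (2 *: y - x)%R 2^-1%R (fine (legendre h x))
    (fine (legendre h (2 *: y - x)%R)) t01.
  rewrite !fineK// => /(_ (lexx _) (lexx _)).
  have -> : (2^-1 *: x + (1 - 2^-1) *: (2 *: y - x) = y)%R.
    by apply/matrixP => i j; rewrite !mxE; lra.
  by rewrite hy leye_eq.
have : leb (ball y e) <= 0.
  apply: (@le_trans _ _ (leb (N `|` [set x | N (2 *: y - x)%R]))).
    by apply: le_measure; rewrite ?inE//; exact: measurableU.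
  apply: le_trans (measureU2 _ _ _) _ => //.
  have N1 : leb N <= 0 by rewrite N0.
  have N2 : leb [set x | N (2 *: y - x)%R] <= 0.
    by rewrite (etrans (leb_reflect (2 *: y)%R mN) N0).
  by rewrite -[leRHS]adde0; exact: leeD.
by rewrite leNgt (leb_open_gt0 (x := y))//; [exact: ball_open|exact: ballxx].
Qed.

End potentials.

(** * Smooth bump functions *)

Section flat.
Context (R : realType).
Implicit Types (n : nat) (s x : R).

(* For [n = 0], the classical smooth function which is flat at the origin. *)
Definition flat n s x : R := if 0 < x then x^-1 ^+ n * expR (- (s / x)) else 0.

Lemma flat_ge0 n s x : 0 <= flat n s x.
Proof.
rewrite /flat; case: ifPn => // x0.
by rewrite mulr_ge0 ?expR_ge0// exprn_ge0// invr_ge0 ltW.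
Qed.

(** The exponential dominates the term [y^n / n!] of its series, at [y = s / x]. *)
Lemma flat_le n s x : 0 < s -> flat n s x <= n`!%:R / s ^+ n.
Proof.
move=> s0; have D0 : 0 <= n`!%:R / s ^+ n :> R by rewrite divr_ge0// exprn_ge0// ltW.
rewrite /flat; case: ifPn => // x0.
set y := s / x; have y0 : 0 <= y by rewrite divr_ge0// ltW.
have ey : y ^+ n / n`!%:R <= expR y.
  case: n {D0} => [|n]; first by rewrite expr0 fact0 divr1 -expR0 ler_expR.
  by apply: le_trans (expR_ge1Dxn n y0); rewrite lerDr.
have -> : x^-1 = y / s by rewrite /y mulrAC mulfV ?mul1r// gt_eqF.
rewrite expr_div_n expRN mulrAC ler_pM2r ?invr_gt0 ?exprn_gt0//.
by rewrite ler_pdivrMr ?expR_gt0// mulrC -ler_pdivrMr// ltr0n fact_gt0.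
Qed.

Lemma flat0_le1 s x : 0 < s -> flat 0 s x <= 1.
Proof. by move=> /(flat_le 0 x); rewrite fact0 expr0 divr1. Qed.

Lemma flatS n s x : flat n s x = x * flat n.+1 s x.
Proof.
rewrite /flat; case: ifPn => [x0|]; last by rewrite mulr0.
by rewrite exprS !mulrA mulfV ?mul1r// gt_eqF.
Qed.

Lemma is_derive_flat n s x : 0 < s ->
  is_derive x 1 (flat n s : R -> R^o) (- n%:R * flat n.+1 s x + s * flat n.+2 s x).
Proof.
move=> s0; have [x0|x0|->] := ltgtP x 0.
- rewrite {2 3}/flat !ltNge (ltW x0)/= !mulr0 addr0.
  apply: (@near_eq_is_derive _ _ _ (cst 0)) => //.
  near=> y; rewrite /flat ltNge (_ : y <= 0)//.
  by apply: ltW; near: y; exact: lt_nbhsl.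
- have xn0 : x != 0 by rewrite gt_eqF.
  apply: (@near_eq_is_derive _ R R^o (fun y : R => y^-1 ^+ n * expR (- (s / y)))).
    near=> y; rewrite /flat (_ : 0 < y)//.
    by near: y; exact: lt_nbhsr.
  have dV : is_derive x 1 (fun y : R => y^-1) (- x ^- 2 *: 1).
    exact: (@is_deriveV R id).
  have dX := is_deriveX n dV.
  have dsV := is_deriveZ (- s) dV.
  have dE : is_derive x 1 (expR \o ((- s) \*: (fun y : R => y^-1)))
      (expR (- s * x^-1) * (- s *: (- x ^- 2 *: 1))).
    by apply: is_derive1_comp; exact: is_derive_expR.
  have -> : (fun y : R => y^-1 ^+ n * expR (- (s / y))) =
      ((fun y : R => y^-1) ^+ n) * (expR \o ((- s) \*: (fun y : R => y^-1))).
    apply/funext => y; rewrite [RHS]/(_ * _) /=; congr (_ * expR _).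
      by rewrite exprfctE.
    by rewrite -mulNr.
  apply: is_derive_eq; rewrite /flat x0 /= exprfctE -[s / x]/(s * x^-1) -mulNr -exprVn.
  move: (x^-1) => t; rewrite -![_ *: _]/(_ * _).
  case: n dX => [|n] _; first by rewrite expr0; ring.
  by rewrite /= !exprS; ring.
- rewrite {2 3}/flat ltxx !mulr0 addr0.
  have f0 : flat n s 0 = 0 by rewrite /flat ltxx.
  (* [flat n] equals [x^2 * flat (n + 2)], and [C] bounds the last factor; so [flat n] is
     quadratically small at the origin and has derivative zero there. *)
  pose C := (n.+2)`!%:R / s ^+ n.+2 : R.
  have C0 : 0 < C by rewrite divr_gt0 ?ltr0n ?fact_gt0// exprn_gt0.
  have [df dE] : differentiable (flat n s : R^o -> R^o) 0 /\ 'd (flat n s : R^o -> R^o) 0 = \0 :> (R^o -> R^o).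
    apply: is_diff_eps; first exact: cst_continuous.
    move=> eta eta0; exists (eta / C); first by rewrite divr_gt0.
    move=> w wr; rewrite add0r f0 !subr0 flatS flatS mulrA normrM -expr2 normrX.
    rewrite [X in _ * X]ger0_norm ?flat_ge0// expr2 -mulrA mulrC ler_wpM2r//.
    apply: le_trans (ler_wpM2l (normr_ge0 _) (flat_le _ _ s0)) _.
    by rewrite -ler_pdivlMr.
  by apply: DeriveDef; [exact: diff_derivable|rewrite deriveE// dE].
Unshelve. all: by end_near. Qed.

Lemma differentiable_flat n s x : 0 < s -> differentiable (flat n s : R^o -> R^o) x.
Proof. by move=> s0; apply/derivable1_diffP; have [] := is_derive_flat n x s0. Qed.

Lemma derive_flat n s x : 0 < s ->
  derive1 (flat n s : R -> R^o) x = - n%:R * flat n.+1 s x + s * flat n.+2 s x.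
Proof. by move=> s0; rewrite derive1E; have [_ ->] := is_derive_flat n x s0. Qed.

Lemma cvg_flat0 x : flat 0 k.+1%:R^-1 x @[k --> \oo] --> (if 0 < x then 1 else 0 : R).
Proof.
rewrite /flat; case: ifPn => x0; last exact: cvg_cst.
under eq_fun do rewrite expr0 mul1r.
suff : expR (- (k.+1%:R^-1 / x)) @[k --> \oo] --> expR (- (0 * x^-1)).
  by rewrite mul0r oppr0 expR0.
apply: continuous_cvg; first exact: continuous_expR.
by apply: cvgN; apply: cvgMr_tmp; exact: cvg_harmonic.
Qed.

End flat.

Section bump.
Context (R : realType) (d : nat).
Notation E := 'rV[R]_d.
Implicit Types (f g : E -> R) (u x : E) (c s : R).

(** A class containing the bump functions and closed under partial derivatives, all of whose members
    are differentiable and bounded; this gives smoothness and the bounds on derivatives by a single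
    induction each. *)
Inductive flat_poly : (E -> R) -> Prop :=
| fp_flat n s c u : 0 < s -> flat_poly (fun x => flat n s (c + dot u x))
| fp_cst c : flat_poly (fun=> c)
| fp_add f g : flat_poly f -> flat_poly g -> flat_poly (fun x => f x + g x)
| fp_mul f g : flat_poly f -> flat_poly g -> flat_poly (fun x => f x * g x).

Lemma diff_affine c u x : differentiable (fun y => c + dot u y : R^o) x /\
  'd (fun y => c + dot u y : R^o) x = dot u :> (E -> R^o).
Proof.
apply: (@is_diff_eps R E R^o _ (dot u)); first exact: continuous_dotr.
move=> eta eta0; exists 1 => // w _.
rewrite dotDr (_ : c + _ - _ - _ = 0) ?normr0 ?mulr_ge0 ?(ltW eta0)//; ring.
Qed.

Lemma flat_poly_differentiable f x : flat_poly f -> differentiable (f : E -> R^o) x.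
Proof.
elim=> [n s c u s0|c|{}f g _ df _ dg|{}f g _ df _ dg].
- apply: (@differentiable_comp _ _ _ _ (fun y => c + dot u y : R^o) (flat n s : R^o -> R^o)).
    by have [] := diff_affine c u x.
  exact: differentiable_flat.
- exact: differentiable_cst.
- exact: (differentiableD df dg).
- exact: (differentiableM df dg).
Qed.

Lemma flat_poly_partial f (j : 'I_d) : flat_poly f -> flat_poly (partial j f).
Proof.
elim=> [n s c u s0|c|{}f g pf df pg dg|{}f g pf df pg dg].
- have -> : partial j (fun x => flat n s (c + dot u x)) =
      (fun x => (- n%:R * flat n.+1 s (c + dot u x) + s * flat n.+2 s (c + dot u x)) * u ord0 j).
    apply/funext => x; rewrite /partial deriveE; last exact: (flat_poly_differentiable x (fp_flat n c u s0)).
    have [dl dlE] := diff_affine c u x.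
    rewrite (@diff_comp _ _ _ _ (fun y => c + dot u y : R^o) (flat n s : R^o -> R^o)) //=; last first.
      exact: differentiable_flat.
    rewrite dlE diff1E; last exact: differentiable_flat.
    rewrite derive_flat// -[_ *: _]/(_ * _) mulrC; congr (_ * _).
    rewrite dot_row (bigD1 j)//= mxE !eqxx mulr1 big1 ?addr0// => i ij.
    by rewrite mxE (negPf ij) andbF mulr0.
  apply: fp_mul; last exact: fp_cst.
  by apply: fp_add; (apply: fp_mul; [exact: fp_cst|exact: fp_flat]).
- have -> : partial j (fun=> c : R) = fun=> 0 :> R.
    by apply/funext => x; rewrite /partial derive_cst.
  exact: fp_cst.
- have -> : partial j (fun x => f x + g x) = (fun x => partial j f x + partial j g x).
    apply/funext => x; rewrite /partial.
    by rewrite [LHS]deriveD//; apply: diff_derivable; exact: flat_poly_differentiable.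
  exact: fp_add.
- have -> : partial j (fun x => f x * g x) = (fun x => f x * partial j g x + g x * partial j f x).
    apply/funext => x; rewrite /partial.
    by rewrite [LHS]deriveM//; apply: diff_derivable; exact: flat_poly_differentiable.
  by apply: fp_add; exact: fp_mul.
Qed.

Lemma flat_poly_smooth f : flat_poly f -> smooth f.
Proof.
move=> pf sq x; apply: flat_poly_differentiable.
by elim: sq => //= j sq; exact: flat_poly_partial.
Qed.

Lemma flat_poly_bounded f : flat_poly f -> exists C : R, forall x, `|f x| <= C.
Proof.
elim=> [n s c u s0|c|{}f g _ [C fC] _ [D gD]|{}f g _ [C fC] _ [D gD]].
- by exists (n`!%:R / s ^+ n) => x; rewrite ger0_norm ?flat_ge0// flat_le.
- by exists `|c|.
- by exists (C + D) => x; apply: le_trans (ler_normD _ _) _; exact: lerD.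
- by exists (C * D) => x; rewrite normrM; exact: ler_pM.
Qed.

Lemma flat_poly_measurable f : flat_poly f -> measurable_fun setT f.
Proof.
move=> pf; apply: continuous_measurable_mx => x.
exact: differentiable_continuous (flat_poly_differentiable x pf).
Qed.

(** Zero outside the open box and, as [s] tends to zero, convergent to its indicator while staying
    between 0 and 1. *)
Definition box_bump (a b : E) s x : R :=
  \prod_i (flat 0 s (x ord0 i - a ord0 i) * flat 0 s (b ord0 i - x ord0 i)).

Lemma flat_poly_bump a b s : 0 < s -> flat_poly (box_bump a b s).
Proof.
move=> s0; rewrite /box_bump; elim: (index_enum _) => [|i r IH].
  by rewrite (_ : (fun x => _) = fun=> 1)//; [exact: fp_cst|apply/funext => x; rewrite big_nil].
rewrite (_ : (fun x => _) = fun x => (flat 0 s (x ord0 i - a ord0 i) * flat 0 s (b ord0 i - x ord0 i)) *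
    \prod_(j <- r) (flat 0 s (x ord0 j - a ord0 j) * flat 0 s (b ord0 j - x ord0 j))); last first.
  by apply/funext => x; rewrite big_cons.
have dotE x : dot (delta_mx ord0 i) x = x ord0 i.
  rewrite dot_row (bigD1 i)//= mxE !eqxx mul1r big1 ?addr0// => j ij.
  by rewrite mxE (negPf ij) andbF mul0r.
apply: fp_mul => //; apply: fp_mul.
  rewrite (_ : (fun x => _) = fun x => flat 0 s (- a ord0 i + dot (delta_mx ord0 i) x)).
    exact: fp_flat.
  by apply/funext => x; rewrite dotE addrC.
rewrite (_ : (fun x => _) = fun x => flat 0 s (b ord0 i + dot (- delta_mx ord0 i) x)).
  exact: fp_flat.
by apply/funext => x; rewrite dotC dotNr dotC dotE.
Qed.

Lemma bump_out a b s x : ~ obox a b x -> box_bump a b s x = 0.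
Proof.
move=> /existsNP[i /negP]; rewrite negb_and => abi.
rewrite /box_bump (bigD1 i)//= /flat !subr_gt0.
by case/orP : abi => /negPf ->; rewrite ?mul0r// mulr0 mul0r.
Qed.

Lemma bump_ge0 a b s x : 0 <= box_bump a b s x.
Proof. by apply: prodr_ge0 => i _; rewrite mulr_ge0 ?flat_ge0. Qed.

Lemma bump_le1 a b s x : 0 < s -> box_bump a b s x <= 1.
Proof.
move=> s0; apply: prodr_ile1 => i _; rewrite mulr_ge0 ?flat_ge0//=.
by rewrite mulr_ile1 ?flat_ge0 ?flat0_le1.
Qed.

Lemma cvg_bump a b x : box_bump a b k.+1%:R^-1 x @[k --> \oo] --> (\1_(obox a b) x : R).
Proof.
rewrite indicE; have [|xab] := boolP (x \in obox a b).
  rewrite inE => xab.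
  suff : \prod_(i < d) (flat 0 k.+1%:R^-1 (x ord0 i - a ord0 i) * flat 0 k.+1%:R^-1 (b ord0 i - x ord0 i))
      @[k --> \oo] --> \prod_(i < d) (1 * 1 : R).
    by rewrite mul1r big1_eq.
  apply: cvg_big => [|i _]; first exact: mul_continuous.
  have /andP[ai bi] := xab i.
  apply: cvgM.
    by have := @cvg_flat0 R (x ord0 i - a ord0 i); rewrite subr_gt0 ai.
  by have := @cvg_flat0 R (b ord0 i - x ord0 i); rewrite subr_gt0 bi.
rewrite (_ : (fun k => _) = cst 0); first exact: cvg_cst.
by apply/funext => k; apply: bump_out; move: xab; rewrite notin_setE.
Qed.

Lemma closure_bump_sub a b s : closure [set x | box_bump a b s x != 0] `<=` cbox a b.
Proof.
have sub : [set x | box_bump a b s x != 0] `<=` cbox a b.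
  move=> x /= /eqP h; apply: sub_obox_cbox; apply: contrapT => /bump_out.
  by move=> /(_ s).
by move=> x /(closure_subset sub); exact: closed_cbox.
Qed.

Lemma test_bump (Omega : set E) a b s : 0 < s -> cbox a b `<=` Omega ->
  test_function Omega (box_bump a b s).
Proof.
move=> s0 abO; split.
- exact/flat_poly_smooth/flat_poly_bump.
- apply: (subclosed_compact _ (@compact_cbox R d a b)); first exact: closed_closure.
  exact: closure_bump_sub.
- exact: subset_trans (@closure_bump_sub a b s) abO.
Qed.

Lemma partial_bump_out a b s j x : ~ cbox a b x -> partial j (box_bump a b s) x = 0.
Proof.
move=> nab; rewrite /partial (@near_eq_derive _ _ _ _ (cst 0)) ?derive_cst//.
have : open (~` cbox a b) by rewrite openC; exact: closed_cbox.
rewrite openE => /(_ x nab); apply: filterS => y ny.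
by apply: bump_out => /sub_obox_cbox.
Qed.

End bump.

(** * Functions with zero integral over every box *)

Section density.
Context dp (T : measurableType dp) (R : realType) (mu : {measure set T -> \bar R}).
Context (D : set T) (f : T -> \bar R).
Hypotheses (mD : measurable D) (mf : measurable_fun D f).
Hypothesis f0 : forall x, D x -> (0 <= f x)%E.
Local Open Scope ereal_scope.

Definition density (A : set T) : \bar R := \int[mu]_(x in A `&` D) f x.

Let density0 : density set0 = 0.
Proof. by rewrite /density set0I integral_set0. Qed.

Let density_ge0 A : 0 <= density A.
Proof. by apply: integral_ge0 => x [_ /f0]. Qed.

Let density_sigma_additive : semi_sigma_additive density.
Proof.
move=> F mF tF mUF; rewrite /density setI_bigcupl ge0_integral_bigcup.
- by apply: is_cvg_ereal_nneg_natsum_cond => n _ _; exact: density_ge0.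
- by move=> k; exact: measurableI.
- by apply: measurable_funS mf => // x [k _ []].
- by move=> x [k _ [_ /f0]].
- by apply: trivIset_setIr.
Qed.

HB.instance Definition _ := isMeasure.Build _ _ _
  density density0 density_ge0 density_sigma_additive.

End density.

Section ae_zero.
Context (R : realType) (d : nat).
Notation E := 'rV[R]_d.
Notation leb := (lebesgue_rV R d).
Local Open Scope ereal_scope.

(** The positive and negative parts of [h] are densities of two finite measures that agree on boxes,
    hence on all Borel sets; comparing them on the sets where [h > 0] and where [h < 0] shows that
    both sets are null. *)
Lemma ae_eq0_of_obox (h : E -> R) (A B : E) :
  leb.-integrable (obox A B) (EFin \o h) ->
  (forall a b, cbox a b `<=` cbox A B -> \int[leb]_(x in obox a b) (h x)%:E = 0) ->
  {ae leb, forall x, obox A B x -> h x = 0%R}.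
Proof.
move=> ih h0; have mO : measurable (obox A B) by exact: measurable_obox.
have mh : measurable_fun (obox A B) (EFin \o h) by case/integrableP : ih.
pose hp := (EFin \o h)^\+; pose hn := (EFin \o h)^\-.
have mp : measurable_fun (obox A B) hp by exact: measurable_funepos.
have mn : measurable_fun (obox A B) hn by exact: measurable_funeneg.
have hp0 x : obox A B x -> 0 <= hp x by move=> _; exact: funepos_ge0.
have hn0 x : obox A B x -> 0 <= hn x by move=> _; exact: funeneg_ge0.
have ip : leb.-integrable (obox A B) hp by exact: integrable_funepos.
have in_ : leb.-integrable (obox A B) hn by exact: integrable_funeneg.
have fin (g : E -> \bar R) : leb.-integrable (obox A B) g -> (forall x, obox A B x -> 0 <= g x) ->
    forall S, measurable S -> density leb (obox A B) g S < +oo.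
  move=> /integrableP[mg ig] g0 S mS; apply: le_lt_trans ig; rewrite /density.
  rewrite [leRHS](eq_integral g); last by move=> x; rewrite inE => /g0 ?; rewrite gee0_abs.
  by apply: ge0_subset_integral => //; first [exact: measurableI|move=> x []].
have boxes a b : density leb (obox A B) hp (obox a b) = density leb (obox A B) hn (obox a b).
  rewrite /density oboxI; set O := obox _ _.
  have OAB : O `<=` obox A B by rewrite /O -oboxI => x [].
  have Pf (g : E -> \bar R) : leb.-integrable (obox A B) g ->
      (forall x, obox A B x -> 0 <= g x) -> \int[leb]_(x in O) g x \is a fin_num.
    move=> ig g0; rewrite ge0_fin_numE; last by apply: integral_ge0 => x /OAB /g0.
    have := fin _ ig g0 O (@measurable_obox _ _ _ _).
    by rewrite /density setIidl.
  (* An arbitrary box is first clipped to [obox A B]; the hypothesis applies only to boxes inside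
     it. *)
  have cAB : cbox (\row_i Num.max (a ord0 i) (A ord0 i))
      (\row_i Num.min (b ord0 i) (B ord0 i)) `<=` cbox A B.
    move=> x xab i; have := xab i.
    by rewrite !mxE ge_max le_min => /andP[/andP[_ ->] /andP[_ ->]].
  have := h0 _ _ cAB; rewrite -/O.
  rewrite -[X in X = 0]/(\int[leb]_(x in O) (EFin \o h) x) [X in X = 0]integralE -/hp -/hn.
  rewrite -(fineK (Pf _ ip hp0)) -(fineK (Pf _ in_ hn0)) -EFinB => -[/eqP].
  by rewrite subr_eq0 => /eqP ->.
have eqS S : measurable S -> density leb (obox A B) hp S = density leb (obox A B) hn S.
  apply: (@rV_measure_unique R d (density leb (obox A B) hp) (density leb (obox A B) hn)) => //.
  by move=> k; apply: fin => //; exact: measurable_obox.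
have null (S : set E) (g : E -> \bar R) : measurable S -> measurable_fun S g ->
    (forall x, S x -> 0 < g x) -> \int[leb]_(x in S) g x = 0 -> {ae leb, forall x, ~ S x}.
  move=> mS mg g0 ig.
  have /(ae_eq_integral_abs leb mS mg) : \int[leb]_(x in S) `|g x| = 0.
    by rewrite -[RHS]ig; apply: eq_integral => x; rewrite inE => /g0 /ltW ?; rewrite gee0_abs.
  apply: filterS => x /= gx Sx; have := gx Sx => /eqP.
  by rewrite gt_eqF// g0.
pose S1 := obox A B `&` [set x | 0 < (EFin \o h) x].
pose S2 := obox A B `&` [set x | (EFin \o h) x < 0].
have mS1 : measurable S1 by exact: emeasurable_fun_o_infty.
have mS2 : measurable S2 by exact: emeasurable_fun_infty_o.
have n1 : {ae leb, forall x, ~ S1 x}.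
  apply: (null _ hp) => //; first by apply: measurable_funS mp => // x [].
    by move=> x [_ hx]; rewrite /hp funeposE lt_max hx.
  have := eqS _ mS1; rewrite /density setIidl; last by move=> x [].
  move=> ->; rewrite -(integral0 leb S1); apply: eq_integral => x.
  rewrite inE => -[_ hx]; rewrite /hn funenegE; apply/max_idPr.
  by rewrite leeNl oppe0 ltW.
have n2 : {ae leb, forall x, ~ S2 x}.
  apply: (null _ hn) => //; first by apply: measurable_funS mn => // x [].
    by move=> x [_ hx]; rewrite /hn funenegE lt_max lteNr oppe0 hx.
  have := eqS _ mS2; rewrite /density setIidl; last by move=> x [].
  move=> <-; rewrite -(integral0 leb S2); apply: eq_integral => x.
  rewrite inE => -[_ hx]; rewrite /hp funeposE; apply/max_idPr.
  by rewrite ltW.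
apply: filterS2 n1 n2 => x x1 x2 Ox; have [hx|hx|//] := ltgtP (h x) 0%R.
  by exfalso; apply: x2; split => //=; rewrite lte_fin.
by exfalso; apply: x1; split => //=; rewrite lte_fin.
Qed.

End ae_zero.

(** * Weak derivatives *)

Section integral_helpers.
Context dp (T : measurableType dp) (R : realType) (mu : {measure set T -> \bar R}).
Context (D : set T) (mD : measurable D).
Implicit Types (f g h b : T -> R).
Local Open Scope ereal_scope.

Lemma integrable_mul_bounded f b (C : R) : mu.-integrable D (EFin \o f) ->
  measurable_fun D b -> (forall x, (`|b x| <= C)%R) ->
  mu.-integrable D (EFin \o (fun x => f x * b x)%R).
Proof.
move=> fi mb bC; have := integrableMl mD fi mb; apply.
exists C; split; first exact: num_real.
by move=> M CM x _; apply: le_trans (ltW CM); exact: bC.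
Qed.

Lemma integrable_EFin_sum (I : finType) (c : I -> R) (f : I -> T -> R) :
  (forall i, mu.-integrable D (EFin \o f i)) ->
  mu.-integrable D (EFin \o (fun x => \sum_i c i * f i x)%R).
Proof.
move=> fi; rewrite (_ : _ \o _ = fun x => \sum_i ((c i)%:E * (f i x)%:E)); last first.
  by apply/funext => x /=; rewrite -sumEFin.
by apply: integrable_sum => // i _; exact: (integrableZl mD _ (fi i)).
Qed.

Lemma integral_EFin_sum (I : finType) (c : I -> R) (f : I -> T -> R) :
  (forall i, mu.-integrable D (EFin \o f i)) ->
  \int[mu]_(x in D) (\sum_i c i * f i x)%:E =
  \sum_i (c i)%:E * \int[mu]_(x in D) (f i x)%:E.
Proof.
move=> fi; under eq_integral do rewrite -sumEFin.
under eq_integral do under eq_bigr do rewrite EFinM.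
rewrite integral_sum//; last by move=> i; exact: (integrableZl mD _ (fi i)).
by apply: eq_bigr => i _; rewrite integralZl//; exact: fi.
Qed.

Lemma integral_supp (D' : set T) (f : T -> \bar R) :
  D' `<=` D -> (forall x, D x -> ~ D' x -> f x = 0) ->
  \int[mu]_(x in D) f x = \int[mu]_(x in D') f x.
Proof.
move=> DD f0; rewrite integral_mkcond [RHS]integral_mkcond; apply: eq_integral => x _.
rewrite /patch; case: ifPn => [|xD]; last first.
  by case: ifPn => //; rewrite inE => /DD xD'; move: xD; rewrite notin_setE.
rewrite inE => Dx; case: ifPn => //; rewrite notin_setE => nx.
exact: f0.
Qed.

End integral_helpers.

Section weak_partial.
Context (R : realType) (d : nat).
Notation E := 'rV[R]_d.
Notation leb := (lebesgue_rV R d).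
Context (Omega : set E).
Hypothesis oOmega : open Omega.
Local Open Scope ereal_scope.

Lemma ae_on_open (P : E -> Prop) :
  (forall a b, cbox a b `<=` Omega -> {ae leb, forall x, obox a b x -> P x}) ->
  {ae leb, forall x, Omega x -> P x}.
Proof.
move=> H; have [->|/set0P O0] := eqVneq Omega set0; first by apply: aeW.
have [a [b [cab ->]]] := open_bigcup_obox oOmega O0.
have : {ae leb, forall x n, obox (a n) (b n) x -> P x} by apply: ae_foralln => n; exact: H.
by apply: filterS => x Hx [n _]; exact: Hx.
Qed.

Lemma measurable_on_open (f : E -> R) :
  (forall a b, cbox a b `<=` Omega -> measurable_fun (cbox a b) f) -> measurable_fun Omega f.
Proof.
move=> H; have [->|/set0P O0] := eqVneq Omega set0; first exact: measurable_fun_set0.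
have [a [b [cab ->]]] := open_bigcup_obox oOmega O0.
apply/measurable_fun_bigcup => [n|n]; first exact: measurable_obox.
apply: measurable_funS (H _ _ (cab n)); first exact: measurable_cbox.
exact: sub_obox_cbox.
Qed.

Lemma is_weak_partial_measurable j (f g : E -> R) :
  is_weak_partial Omega j f g -> measurable_fun Omega g.
Proof.
move=> [_ lg _]; apply: measurable_on_open => a b cab.
have /integrableP[mg _] := lg _ (@compact_cbox R d a b) cab.
exact/measurable_EFinP.
Qed.

Lemma weak_partial_bump j (f g : E -> R) a b s : is_weak_partial Omega j f g ->
  cbox a b `<=` Omega -> (0 < s)%R ->
  \int[leb]_(x in cbox a b) (f x * partial j (box_bump a b s) x)%:E =
  - \int[leb]_(x in cbox a b) (g x * box_bump a b s x)%:E.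
Proof.
move=> [_ _ H] cab s0; have := H _ (test_bump s0 cab).
rewrite (integral_supp _ cab); last first.
  by move=> x _ /(partial_bump_out) ->; rewrite mulr0.
rewrite [in X in _ = - X](integral_supp _ cab)//.
by move=> x _ nx; rewrite bump_out ?mulr0// => /sub_obox_cbox.
Qed.

(** Fundamental lemma of the calculus of variations, for a linear relation: tested against bumps,
    the combination of the derivatives has zero integral over every small box. Uniqueness and
    linearity of weak derivatives are both instances. *)
Lemma weak_partial_lin0 j (I : finType) (c : I -> R) (f g : I -> E -> R) :
  (forall i, is_weak_partial Omega j (f i) (g i)) ->
  {ae leb, forall x, Omega x -> (\sum_i c i * f i x = 0)%R} ->
  {ae leb, forall x, Omega x -> (\sum_i c i * g i x = 0)%R}.
Proof.
move=> fg f0; apply: ae_on_open => A B cAB.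
have gi a b i : cbox a b `<=` Omega -> leb.-integrable (cbox a b) (EFin \o g i).
  by move=> cab; have [_ lg _] := fg i; exact: lg (@compact_cbox R d a b) cab.
have fi a b i : cbox a b `<=` Omega -> leb.-integrable (cbox a b) (EFin \o f i).
  by move=> cab; have [lf _ _] := fg i; exact: lf (@compact_cbox R d a b) cab.
pose h x := (\sum_i c i * g i x)%R.
have hi a b : cbox a b `<=` Omega -> leb.-integrable (cbox a b) (EFin \o h).
  move=> cab; apply: integrable_EFin_sum; first exact: measurable_cbox.
  by move=> i; exact: gi.
apply: ae_eq0_of_obox.
  apply: integrableS (hi _ _ cAB); [exact: measurable_cbox|exact: measurable_obox|].
  exact: sub_obox_cbox.
move=> a b cab'; have cab : cbox a b `<=` Omega by exact: subset_trans cab' cAB.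
have mc : measurable (cbox a b) by exact: measurable_cbox.
have hb0 s : (0 < s)%R -> \int[leb]_(x in cbox a b) (h x * box_bump a b s x)%:E = 0.
  move=> s0; have pb := flat_poly_bump a b s0.
  have mb : measurable_fun (cbox a b) (box_bump a b s).
    exact: measurable_funS (flat_poly_measurable pb).
  have bb x : (`|box_bump a b s x| <= 1)%R by rewrite ger0_norm ?bump_ge0// bump_le1.
  have mp : measurable_fun (cbox a b) (partial j (box_bump a b s)).
    exact: measurable_funS (flat_poly_measurable (flat_poly_partial j pb)).
  have [C pC] := flat_poly_bounded (flat_poly_partial j pb).
  have gbi i := integrable_mul_bounded mc (gi _ _ i cab) mb bb.
  have fpi i := integrable_mul_bounded mc (fi _ _ i cab) mp pC.
  under eq_integral do rewrite /h mulr_suml.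
  under eq_integral do under eq_bigr do rewrite -mulrA.
  rewrite (integral_EFin_sum mc c gbi).
  transitivity (- \sum_i (c i)%:E * \int[leb]_(x in cbox a b) (f i x * partial j (box_bump a b s) x)%:E).
    rewrite -sumeN; last first.
      move=> i k _ _; apply: fin_num_adde_defl; rewrite fin_numM//.
      by apply: integrable_fin_num => //; exact: fpi.
    by apply: eq_bigr => i _; rewrite (weak_partial_bump (fg i) cab s0) muleN oppeK.
  rewrite -(integral_EFin_sum mc c fpi) (ae_eq_integral (cst 0))//.
  - by rewrite integral0 oppe0.
  - by apply/measurable_EFinP; apply: measurable_sum => i; apply: measurable_funM => //;
      have /integrableP[/measurable_EFinP] := fpi i.
  - apply: filterS f0 => x f0 /cab Ox.
    under eq_bigr do rewrite mulrA.
    by rewrite -mulr_suml f0// mul0r.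
(* Shrinking the parameter of the bump replaces it by the indicator of the open box, with [|h|] as
   integrable majorant. *)
have lim0 : \int[leb]_(x in cbox a b) (h x * box_bump a b k.+1%:R^-1 x)%:E @[k --> \oo] -->
    \int[leb]_(x in cbox a b) (h x * \1_(obox a b) x)%:E.
  have mh : measurable_fun (cbox a b) h by have /integrableP[/measurable_EFinP] := hi _ _ cab.
  have [] := @dominated_convergence _ _ _ leb (cbox a b) mc
      (fun k x => (h x * box_bump a b k.+1%:R^-1 x)%:E) (fun x => (h x * \1_(obox a b) x)%:E)
      (fun x => `|(h x)%:E|) => //.
  - move=> k; apply/measurable_EFinP; apply: measurable_funM => //.
    apply: measurable_funS (flat_poly_measurable (flat_poly_bump _ _ _)) => //.
  - apply/measurable_EFinP; apply: measurable_funM => //.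
    by apply: measurable_indic; exact: measurable_obox.
  - apply: aeW => x _; apply: cvg_EFin; first exact: nearW.
    by apply: cvgMl_tmp; exact: cvg_bump.
  - by apply: integrable_abse; exact: hi.
  - apply: aeW => x k _; rewrite /= lee_fin normrM ler_piMr// ger0_norm ?bump_ge0//.
    exact: bump_le1.
have -> : \int[leb]_(x in obox a b) (h x)%:E = \int[leb]_(x in cbox a b) (h x * \1_(obox a b) x)%:E.
  have E1 : cbox a b `&` obox a b = obox a b.
    by rewrite setIC setIidl//; exact: sub_obox_cbox.
  rewrite -{1}E1 integral_mkcondr.
  by apply: eq_integral => x _; rewrite /patch indicE; case: ifPn; rewrite ?mulr1 ?mulr0.
rewrite -(cvg_lim _ lim0)//; apply/cvg_lim => //.
rewrite (_ : (fun k => _) = cst 0); first exact: cvg_cst.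
by apply/funext => k; exact: hb0.
Qed.

End weak_partial.

(** * Restricted [L^q] norms *)

Section Lq.
Context (R : realType) (d : nat).
Notation E := 'rV[R]_d.
Notation leb := (lebesgue_rV R d).
Context (Omega : set E) (q : R).
Hypothesis mO : measurable Omega.
Hypothesis q1 : 1 <= q.
Implicit Types (f g : E -> R).
Local Open Scope ereal_scope.

Let q0 : (0 < q)%R.
Proof. exact: lt_le_trans q1. Qed.

(** Extension by zero outside [Omega], so that the Minkowski and Hölder inequalities on the whole
    space apply. *)
Definition LN f : \bar R := Lnorm leb q%:E (EFin \o (f \_ Omega)).

Lemma LN_ge0 f : 0 <= LN f.
Proof. exact: Lnorm_ge0. Qed.

Lemma LNE f : LN f = (\int[leb]_(x in Omega) (`|f x| `^ q)%:E) `^ q^-1.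
Proof.
rewrite /LN unlock; congr (_ `^ _); rewrite [RHS]integral_mkcond; apply: eq_integral => x _.
rewrite /= /patch; case: ifPn => // _; by rewrite normr0 powR0// gt_eqF.
Qed.

Lemma measurable_normq f : measurable_fun Omega f ->
  measurable_fun Omega (fun x => (`|f x| `^ q)%:E).
Proof.
move=> mf; apply/measurable_EFinP.
apply: (@measurableT_comp _ _ _ _ _ _ (fun y : R => y `^ q)%R) => //.
exact: measurableT_comp.
Qed.

Lemma le_LN f g : measurable_fun Omega f -> measurable_fun Omega g ->
  {ae leb, forall x, Omega x -> (`|f x| <= `|g x|)%R} -> LN f <= LN g.
Proof.
move=> mf mg fg; rewrite !LNE; apply: gt0_ler_poweR.
- by rewrite invr_ge0 ltW.
- by rewrite in_itv/= leey andbT; apply: integral_ge0 => x _; rewrite lee_fin powR_ge0.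
- by rewrite in_itv/= leey andbT; apply: integral_ge0 => x _; rewrite lee_fin powR_ge0.
- apply: ae_ge0_le_integral => //.
  + exact: measurable_normq.
  + exact: measurable_normq.
  + apply: filterS fg => x fg Ox; rewrite lee_fin ge0_ler_powR ?nnegrE ?(ltW q0)//.
    exact: fg.
Qed.

Lemma LN_add f g : measurable_fun Omega f -> measurable_fun Omega g ->
  LN (fun x => f x + g x)%R <= LN f + LN g.
Proof.
move=> mf mg; have := @minkowski_EFin _ _ _ leb (f \_ Omega) (g \_ Omega) q.
move=> /(_ (iffLR (measurable_restrictT _ mO) mf) (iffLR (measurable_restrictT _ mO) mg) q1).
apply: le_trans.
rewrite le_eqVlt; apply/orP; left; apply/eqP; apply: eq_Lnorm => x /=.
by rewrite /patch; case: ifPn => // _; rewrite addr0.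
Qed.

Lemma LN_scale c f : measurable_fun Omega f -> LN (fun x => c * f x)%R = `|c|%:E * LN f.
Proof.
move=> mf; rewrite !LNE.
under eq_integral do rewrite normrM powRM// EFinM.
rewrite ge0_integralZl//; last exact: measurable_normq.
rewrite poweRM ?lee_fin ?powR_ge0//; last first.
  by apply: integral_ge0 => x _; rewrite lee_fin powR_ge0.
by rewrite poweR_EFin -powRrM mulfV ?gt_eqF// powRr1.
Qed.

Lemma LN_sum (I : finType) (c : I -> R) (f : I -> E -> R) :
  (forall i, measurable_fun Omega (f i)) ->
  LN (fun x => \sum_i c i * f i x)%R <= \sum_i `|c i|%:E * LN (f i).
Proof.
move=> mf.
pose K (F : E -> R) (r : \bar R) := measurable_fun Omega F /\ LN F <= r.
suff : K (fun x => \sum_i c i * f i x)%R (\sum_i `|c i|%:E * LN (f i)) by case.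
rewrite (_ : (fun x => _) = (\sum_i (fun x => c i * f i x))%R); last first.
  by apply/funext => x; rewrite fct_sumE.
elim/big_ind2 : _ => [|F1 r1 F2 r2 [mF1 FR1] [mF2 FR2]|i _].
- split; first exact: measurable_cst.
  by rewrite LNE; under eq_integral do rewrite normr0 powR0 ?gt_eqF//; rewrite integral0 poweR0r// invr_neq0// gt_eqF.
- split; first exact: measurable_funD.
  by apply: le_trans (LN_add mF1 mF2) _; exact: leeD.
- by split; [exact: measurable_funM|rewrite LN_scale].
Qed.

(** Hölder's inequality against the indicator of [Omega], whose norm for the conjugate exponent is
    [C]. The case [q = 1], with infinite conjugate exponent, is direct. *)
Lemma integral_le_LN : leb Omega < +oo ->
  exists2 C : R, (0 <= C)%R & forall f, measurable_fun Omega f ->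
    \int[leb]_(x in Omega) `|f x|%:E <= C%:E * LN f.
Proof.
move=> Ooo; have [q1'|q1'] := eqVneq q 1%R.
  exists 1%R => // g mg; rewrite mul1e LNE q1' invr1 poweRe1; last first.
    by apply: integral_ge0 => x _; rewrite lee_fin powR_ge0.
  apply: ge0_le_integral => //.
  - by apply/measurable_EFinP; exact: measurableT_comp.
  - by have := measurable_normq mg; rewrite q1'.
  - by move=> x _; rewrite powRr1.
have q1'' : (1 < q)%R by rewrite lt_neqAle eq_sym q1' q1.
pose p : R := (q / (q - 1))%R.
have q10 : (0 < q - 1)%R by rewrite subr_gt0.
have p0 : (0 < p)%R by rewrite divr_gt0.
have pq : (p^-1 + q^-1 = 1)%R.
  by rewrite invf_div mulrBl mul1r mulfV ?gt_eqF// subrK.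
pose one := (cst 1%R : E -> R) \_ Omega.
have m1 : measurable_fun setT one by apply/(measurable_restrictT _ mO); exact: measurable_cst.
have N1 : Lnorm leb p%:E (EFin \o one) \is a fin_num.
  rewrite ge0_fin_numE ?Lnorm_ge0// unlock poweR_lty//.
  rewrite (_ : integral _ _ _ = leb Omega)// -(setIT Omega) -integral_indic//.
  apply: eq_integral => x _; rewrite /one /= /patch indicE.
  by case: ifPn => _; rewrite ?normr1 ?powR1// normr0 powR0// gt_eqF.
exists (fine (Lnorm leb p%:E (EFin \o one))).
  by rewrite fine_ge0// Lnorm_ge0.
move=> g mg; have := @hoelder _ _ _ leb one (g \_ Omega) p q m1
  (iffLR (measurable_restrictT _ mO) mg) p0 q0 pq.
rewrite fineK//; apply: le_trans.
rewrite Lnorm1 [leLHS]integral_mkcond le_eqVlt; apply/orP; left; apply/eqP; apply: eq_integral => x _.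
rewrite /one /= /patch; case: ifPn => _; rewrite ?mul1r//.
by rewrite mul0r normr0.
Qed.

End Lq.

Section matrix_Lq.
Context (R : realType) (m n : nat).
Notation Mx := 'M[R]_(m, n).
Implicit Types (A B : Mx).

Lemma enorm_ge0 A : 0 <= enorm A.
Proof. exact: sqrtr_ge0. Qed.

Lemma coord_le_enorm A i j : `|A i j| <= enorm A.
Proof. exact: le_trans (mx_coord_le_norm A i j) (enorm_ge_norm A). Qed.

Lemma enorm_le_sum A : enorm A <= \sum_i \sum_j `|A i j|.
Proof.
set s := \sum_i _; have s0 : 0 <= s by apply: sumr_ge0 => i _; apply: sumr_ge0 => j _.
rewrite -[leRHS]ger0_norm// -sqrtr_sqr ler_wsqrtr// expr2 {1}/s mulr_suml.
apply: ler_sum => i _; rewrite mulr_suml; apply: ler_sum => j _.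
rewrite -expr2 -real_normK ?num_real// expr2 ler_wpM2l//.
rewrite /s (bigD1 i)//= (bigD1 j)//= -addrA lerDl addr_ge0//.
  by apply: sumr_ge0 => k _.
by apply: sumr_ge0 => k _; apply: sumr_ge0 => l _.
Qed.

Lemma continuous_enorm : continuous (@enorm R m n).
Proof.
have cd : continuous (fun A : Mx => dot A A : R).
  rewrite /dot; apply: continuous_big => [|i _]; first exact: add_continuous.
  apply: continuous_big => [|j _]; first exact: add_continuous.
  by move=> x; apply: continuousM; exact: coord_continuous.
move=> A; apply: (@continuous_comp _ _ _ (fun A : Mx => dot A A : R) Num.sqrt).
  exact: cd.
exact: sqrt_continuous.
Qed.

Lemma measurable_enorm : measurable_fun setT (@enorm R m n).
Proof. exact: continuous_measurable_mx continuous_enorm. Qed.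

Context dp (T : measurableType dp) (D : set T).
Hypothesis mD : measurable D.
Implicit Types (phi psi : T -> Mx).

Lemma measurable_mx_entry phi i j : measurable_fun D phi -> measurable_fun D (fun x => phi x i j).
Proof. by move=> mphi; exact: (measurableT_comp (measurable_coord i j) mphi). Qed.

Lemma measurable_fun_mx phi : (forall i j, measurable_fun D (fun x => phi x i j)) ->
  measurable_fun D phi.
Proof.
move=> mphi; pose psi x : Mx := if x \in D then phi x else 0.
apply: (@eq_measurable_fun _ _ _ _ _ psi); first by move=> x xD; rewrite /psi xD.
apply: measurable_funS (_ : measurable_fun setT psi) => //.
apply/measurable_fun_mxP => i j.
have -> : (fun x => psi x i j) = (fun x => phi x i j) \_ D.
  by apply/funext => x; rewrite /psi /patch; case: ifPn => // _; rewrite mxE.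
exact/(measurable_restrictT _ mD).
Qed.

Lemma measurable_dot phi psi : measurable_fun D phi -> measurable_fun D psi ->
  measurable_fun D (fun x => dot (phi x) (psi x)).
Proof.
move=> mphi mpsi; rewrite /dot; apply: measurable_sum => i; apply: measurable_sum => j.
by apply: measurable_funM; exact: measurable_mx_entry.
Qed.

Lemma measurable_mx_comb (I : finType) (c : I -> R) (f : I -> T -> Mx) :
  (forall i, measurable_fun D (f i)) -> measurable_fun D (fun x => \sum_i c i *: f i x).
Proof.
move=> mf; apply: measurable_fun_mx => i j.
under eq_fun do rewrite summxE.
apply: measurable_sum => k; under eq_fun do rewrite mxE.
by apply: measurable_funM => //; exact: measurable_mx_entry.
Qed.

End matrix_Lq.

Section Lq_norm_facts.
Context (R : realType) (d m n : nat).
Notation E := 'rV[R]_d.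
Notation leb := (lebesgue_rV R d).
Notation Mx := 'M[R]_(m, n).
Context (Omega : set E) (q : R).
Hypothesis mO : measurable Omega.
Hypothesis q1 : 1 <= q.
Implicit Types (A B phi : E -> Mx).
Local Open Scope ereal_scope.

Lemma Lq_normE phi : Lq_norm Omega q phi = LN Omega q (fun x => enorm (phi x)).
Proof.
rewrite /Lq_norm /LN; congr (Lnorm _ _ _); apply/funext => x /=.
by rewrite /patch; case: ifPn.
Qed.

Lemma Lq_norm_ge0 phi : 0 <= Lq_norm Omega q phi.
Proof. by rewrite Lq_normE LN_ge0. Qed.

Lemma measurable_enorm_comp phi : measurable_fun Omega phi ->
  measurable_fun Omega (fun x => enorm (phi x)).
Proof. by move=> mphi; exact: (measurableT_comp (@measurable_enorm R m n) mphi). Qed.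

Lemma LN_entry_le phi i j : measurable_fun Omega phi ->
  LN Omega q (fun x => phi x i j) <= Lq_norm Omega q phi.
Proof.
move=> mphi; rewrite Lq_normE; apply: le_LN => //.
- exact: measurable_mx_entry.
- exact: measurable_enorm_comp.
- by apply: aeW => x _; rewrite [leRHS]ger0_norm ?enorm_ge0// coord_le_enorm.
Qed.

(** An entrywise inequality is assumed instead of an identity, because [weak_partial_perturb]
    delivers only inequalities. The factor [m * n] counts the entries. *)
Lemma Lq_norm_comb (I : finType) (c : I -> R) (B : I -> E -> Mx) A :
  measurable_fun Omega A -> (forall k, measurable_fun Omega (B k)) ->
  {ae leb, forall x, Omega x -> forall i j,
    (`|A x i j| <= \sum_k `|c k| * `|B k x i j|)%R} ->
  Lq_norm Omega q A <= (m * n)%:R%:E * \sum_k `|c k|%:E * Lq_norm Omega q (B k).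
Proof.
move=> mA mB AB; rewrite Lq_normE.
pose c' (t : 'I_m * 'I_n * I) := `|c t.2|%R.
pose B' (t : 'I_m * 'I_n * I) x := `|B t.2 x t.1.1 t.1.2|%R.
have mB' t : measurable_fun Omega (B' t).
  by apply: measurableT_comp => //; exact: measurable_mx_entry.
apply: (@le_trans _ _ (LN Omega q (fun x => \sum_t c' t * B' t x)%R)).
  apply: le_LN => //.
  - exact: measurable_enorm_comp.
  - by apply: measurable_sum => t; exact: measurable_funM.
  - apply: filterS AB => x AB /AB{}AB; rewrite ger0_norm ?enorm_ge0//.
    rewrite [leRHS]ger0_norm; last by apply: sumr_ge0 => t _; rewrite mulr_ge0// normr_ge0.
    apply: le_trans (enorm_le_sum _) _.
    rewrite pair_bigA_idem/= ?addr0//.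
    apply: (@le_trans _ _ (\sum_(ij : 'I_m * 'I_n) \sum_k `|c k| * `|B k x ij.1 ij.2|)%R).
      by apply: ler_sum => ij _; exact: AB.
    by rewrite pair_bigA.
apply: le_trans (LN_sum mO q1 c' mB') _.
rewrite -(pair_bigA _ (fun (ij : 'I_m * 'I_n) k => `|c' (ij, k)|%:E * LN Omega q (B' (ij, k))))/=.
apply: (@le_trans _ _ (\sum_(ij : 'I_m * 'I_n) \sum_k `|c k|%:E * Lq_norm Omega q (B k))).
  apply: lee_sum => ij _; apply: lee_sum => k _; rewrite normr_id; apply: lee_wpmul2l => //.
  apply: le_trans (LN_entry_le ij.1 ij.2 (mB k)).
  rewrite /B' /LN -[leRHS]Lnorm_abse le_eqVlt; apply/orP; left; apply/eqP; apply: eq_Lnorm => x /=.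
  by rewrite /patch; case: ifPn => // _; rewrite ?normr0.
by rewrite sumr_const card_prod !card_ord mule_natl.
Qed.

Lemma in_Lq_integrable phi i j : leb Omega < +oo -> in_Lq Omega q phi ->
  leb.-integrable Omega (EFin \o (fun x => phi x i j)).
Proof.
move=> Ooo [mphi Nphi]; have [C C0 HC] := integral_le_LN mO q1 Ooo.
apply/integrableP; split.
  by apply/measurable_EFinP; exact: measurable_mx_entry.
apply: le_lt_trans (HC _ (measurable_mx_entry i j mphi)) _.
apply: le_lt_trans (lee_wpmul2l _ (LN_entry_le i j mphi)) _; first by rewrite lee_fin.
by rewrite lte_mul_pinfty// lee_fin.
Qed.

End Lq_norm_facts.

(** * Linear combinations of Sobolev fields *)

Section test_functions.
Context (R : realType) (d : nat).
Notation E := 'rV[R]_d.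
Notation leb := (lebesgue_rV R d).
Implicit Types (f g psi : E -> R).

Lemma smooth_continuous f : smooth f -> continuous f.
Proof. by move=> sf x; exact: (@differentiable_continuous _ _ _ _ (f : E -> R^o) (sf [::] x)). Qed.

Lemma smooth_partial j f : smooth f -> smooth (partial j f).
Proof. by move=> sf s; have := sf (rcons s j); rewrite foldr_rcons. Qed.

Lemma supported_bounded (K : set E) f : compact K -> continuous f ->
  (forall x, ~ K x -> f x = 0) -> exists C : R, forall x, `|f x| <= C.
Proof.
move=> cK cf f0; have [[y Ky]|K0] := pselect (K !=set0); last first.
  by exists 0 => x; rewrite f0 ?normr0// => Kx; apply: K0; exists x.
have cn : {within K, continuous (fun x => `|f x| : R)}.
  apply: continuous_subspaceT => x; apply: (@continuous_comp _ _ _ f (fun y : R => `|y|)).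
    exact: cf.
  exact: norm_continuous.
have [c Kc cmax] := compact_EVT_max (ex_intro _ y Ky) cK cn.
exists `|f c| => x; have [Kx|nKx] := pselect (K x); first by apply: cmax; rewrite inE.
by rewrite f0// normr0.
Qed.

Section supp.
Context (Omega : set E) (psi : E -> R).
Hypothesis tpsi : test_function Omega psi.
Let K := closure [set x | psi x != 0].

Lemma test_supp x : ~ K x -> psi x = 0.
Proof.
move=> nK; apply/eqP; apply: contrapT => /negP px; apply: nK.
exact: subset_closure.
Qed.

Lemma test_partial_supp j x : ~ K x -> partial j psi x = 0.
Proof.
move=> nK; rewrite /partial.
rewrite (@near_eq_derive _ _ _ (psi : E -> R^o) (cst 0)) ?derive_cst//.
have oK : open (~` K) by apply: closed_openC; exact: closed_closure.
have : nbhs x (~` K) by exact: open_nbhs_nbhs.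
by apply: filterS => y /test_supp.
Qed.

Lemma test_bounded : exists C : R, forall x, `|psi x| <= C.
Proof.
case: tpsi => sp cK _; apply: (supported_bounded cK); last exact: test_supp.
exact: smooth_continuous.
Qed.

Lemma test_partial_bounded j : exists C : R, forall x, `|partial j psi x| <= C.
Proof.
case: tpsi => sp cK _; apply: (supported_bounded cK); last exact: test_partial_supp.
by apply: smooth_continuous; exact: smooth_partial.
Qed.

Lemma test_measurable : measurable_fun setT psi.
Proof. by case: tpsi => sp _ _; exact: continuous_measurable_mx (smooth_continuous sp). Qed.

Lemma test_partial_measurable j : measurable_fun setT (partial j psi).
Proof.
case: tpsi => sp _ _.
apply: continuous_measurable_mx; apply: smooth_continuous; exact: smooth_partial.
Qed.

End supp.

Lemma compact_measurable (K : set E) : compact K -> measurable K.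
Proof.
move=> cK; rewrite -(setCK K); apply: measurableC; apply: measurable_open.
apply: closed_openC; exact: compact_closed.
Qed.

End test_functions.

Lemma ae_integrable dp (T : measurableType dp) (R : realType)
    (mu : {measure set T -> \bar R}) (D : set T) (f g : T -> \bar R) :
  measurable D -> measurable_fun D g -> mu.-integrable D f ->
  {ae mu, forall x, D x -> f x = g x} -> mu.-integrable D g.
Proof.
move=> mD mg /integrableP[mf foo] fg; apply/integrableP; split=> //.
rewrite (ae_eq_integral (abse \o f))//; try exact: measurableT_comp.
by apply: filterS fg => x fg Dx /=; rewrite fg.
Qed.

Section weak_partial_combinations.
Context (R : realType) (d : nat).
Notation E := 'rV[R]_d.
Notation leb := (lebesgue_rV R d).
Context (Omega : set E).
Hypothesis oOmega : open Omega.
Local Open Scope ereal_scope.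

(** All integrals are first restricted to the compact support of the test function, where local
    integrability permits the exchange with the finite sum. *)
Lemma is_weak_partial_comb j (I : finType) (c : I -> R) (f g : I -> E -> R) f0 :
  measurable_fun Omega f0 -> (forall i, is_weak_partial Omega j (f i) (g i)) ->
  {ae leb, forall x, Omega x -> (f0 x = \sum_i c i * f i x)%R} ->
  is_weak_partial Omega j f0 (fun x => \sum_i c i * g i x)%R.
Proof.
move=> mf0 fg f0E.
have fi i K : compact K -> K `<=` Omega -> leb.-integrable K (EFin \o f i).
  by move=> cK KO; have [lf _ _] := fg i; exact: lf.
have gi i K : compact K -> K `<=` Omega -> leb.-integrable K (EFin \o g i).
  by move=> cK KO; have [_ lg _] := fg i; exact: lg.
split.
- move=> K cK KO; have mK := compact_measurable cK.
  apply: (ae_integrable mK _ (integrable_EFin_sum mK c (fun i => fi i K cK KO))).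
    by apply/measurable_EFinP; apply: (measurable_funS _ KO mf0); exact: measurable_open.
  by apply: filterS f0E => x f0E /KO/f0E /= ->.
- move=> K cK KO; have mK := compact_measurable cK.
  by apply: integrable_EFin_sum => // i; exact: gi.
move=> psi tpsi; have [_ cK KO] := tpsi; set K := closure _ in cK KO.
have mK := compact_measurable cK.
rewrite (integral_supp _ KO); last first.
  by move=> x _ /(test_partial_supp j) ->; rewrite mulr0.
rewrite [in RHS](integral_supp _ KO); last first.
  by move=> x _ /test_supp ->; rewrite mulr0.
have [C HC] := test_bounded tpsi; have [C' HC'] := test_partial_bounded tpsi j.
have mpsi : measurable_fun K psi by apply: measurable_funS (test_measurable tpsi).
have mppsi : measurable_fun K (partial j psi).
  by apply: measurable_funS (test_partial_measurable tpsi j).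
have gbi i := integrable_mul_bounded mK (gi i K cK KO) mpsi HC.
have fpi i := integrable_mul_bounded mK (fi i K cK KO) mppsi HC'.
under [in RHS]eq_integral do rewrite mulr_suml.
under [in RHS]eq_integral do under eq_bigr do rewrite -mulrA.
rewrite (integral_EFin_sum mK c gbi) -sumeN; last first.
  move=> i k _ _; apply: fin_num_adde_defl; rewrite fin_numM//.
  by apply: integrable_fin_num => //; exact: gbi.
transitivity (\sum_i (c i)%:E * \int[leb]_(x in K) (f i x * partial j psi x)%:E).
  rewrite -(integral_EFin_sum mK c fpi); apply: ae_eq_integral => //.
  - apply/measurable_EFinP; apply: measurable_funM => //.
    by apply: (measurable_funS _ KO mf0); exact: measurable_open.
  - by apply/measurable_EFinP; apply: measurable_sum => i; apply: measurable_funM => //;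
      have /integrableP[/measurable_EFinP] := fpi i.
  - apply: filterS f0E => x f0E /KO Ox; rewrite f0E// mulr_suml.
    by under eq_bigr do rewrite -mulrA.
apply: eq_bigr => i _; rewrite -muleN; congr (_ * _).
have [_ _ /(_ _ tpsi)] := fg i.
rewrite (integral_supp _ KO); last first.
  by move=> x _ /(test_partial_supp j) ->; rewrite mulr0.
rewrite [X in _ = - X -> _](integral_supp _ KO)//.
by move=> x _ /(test_supp) ->; rewrite mulr0.
Qed.

Section with_head.
Context (I : finType).

(** Adjoins one distinguished term to a finite family, so that statements on sums also cover
    [f0 = \sum_i c i * f i] (coefficient -1 on the head) and [f1 + \sum_i c i * f i] (coefficient
    1). *)
Definition with_head (T : Type) (x0 : T) (x : I -> T) (o : unit + I) : T :=
  match o with inl _ => x0 | inr i => x i end.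

Lemma sum_with_head (c0 : R) (c : I -> R) (a0 : R) (a : I -> R) :
  (\sum_o with_head c0 c o * with_head a0 a o = c0 * a0 + \sum_i c i * a i)%R.
Proof.
rewrite big_sumType/=; congr (_ + _)%R.
by rewrite (big_pred1 tt)// => -[].
Qed.

Lemma sum_with_head_fun (c0 : R) (c : I -> R) (f0 : E -> R) (f : I -> E -> R) x :
  (\sum_o with_head c0 c o * with_head f0 f o x = c0 * f0 x + \sum_i c i * f i x)%R.
Proof.
rewrite -sum_with_head; apply: eq_bigr => -[?|i] _ //.
Qed.

End with_head.

Lemma weak_partial_ae_comb j (I : finType) (c : I -> R) (f g : I -> E -> R) f0 g0 :
  is_weak_partial Omega j f0 g0 -> (forall i, is_weak_partial Omega j (f i) (g i)) ->
  {ae leb, forall x, Omega x -> (f0 x = \sum_i c i * f i x)%R} ->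
  {ae leb, forall x, Omega x -> (g0 x = \sum_i c i * g i x)%R}.
Proof.
move=> fg0 fg f0E.
have := @weak_partial_lin0 R d Omega oOmega j _ (with_head (-1)%R c)
  (with_head f0 f) (with_head g0 g) _ _; move=> H.
have : {ae leb, forall x, Omega x ->
    (\sum_o with_head (-1)%R c o * with_head g0 g o x = 0)%R}.
  apply: H; first by case.
  apply: filterS f0E => x f0E /f0E E; rewrite sum_with_head_fun E mulN1r.
  by rewrite addrC subrr.
apply: filterS => x H' /H'; rewrite sum_with_head_fun mulN1r addrC => /eqP.
by rewrite subr_eq0 => /eqP ->.
Qed.

Lemma weak_partialP j f : (exists g, is_weak_partial Omega j f g) ->
  is_weak_partial Omega j f (weak_partial Omega j f).
Proof. exact: (xgetPex (cst 0%R)). Qed.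

Lemma measurable_weak_partial j f : measurable_fun Omega (weak_partial Omega j f).
Proof.
have [/weak_partialP wf|nf] := pselect (exists g, is_weak_partial Omega j f g).
  exact: is_weak_partial_measurable wf.
rewrite /weak_partial xgetPN; first exact: measurable_cst.
by move=> g fg; apply: nf; exists g.
Qed.

(** No derivative of [h0] or [h1] is assumed to exist: differences with approximating fields have to
    be estimated through the raw definition of the Sobolev norm. *)
Lemma weak_partial_perturb j (I : finType) (c : I -> R) (f g : I -> E -> R)
    (h0 h1 : E -> R) :
  measurable_fun Omega h0 -> measurable_fun Omega h1 ->
  (forall i, is_weak_partial Omega j (f i) (g i)) ->
  {ae leb, forall x, Omega x -> (h0 x = h1 x + \sum_i c i * f i x)%R} ->
  {ae leb, forall x, Omega x -> (`|weak_partial Omega j h0 x| <=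
     `|weak_partial Omega j h1 x| + \sum_i `|c i| * `|g i x|)%R}.
Proof.
move=> mh0 mh1 fg h0E.
have [/weak_partialP w1|nw1] := pselect (exists g1, is_weak_partial Omega j h1 g1).
  have fg' o : is_weak_partial Omega j (with_head h1 f o)
      (with_head (weak_partial Omega j h1) g o) by case: o.
  have h0E' : {ae leb, forall x, Omega x ->
      (h0 x = \sum_o with_head 1 c o * with_head h1 f o x)%R}.
    by apply: filterS h0E => x h0E /h0E ->; rewrite sum_with_head_fun mul1r.
  have w0 := is_weak_partial_comb mh0 fg' h0E'.
  have w0' := weak_partialP (ex_intro _ _ w0).
  apply: filterS (weak_partial_ae_comb w0' fg' h0E') => x H /H ->.
  rewrite sum_with_head_fun mul1r; apply: le_trans (ler_normD _ _) _.
  rewrite lerD2l; apply: le_trans (ler_norm_sum _ _ _) _.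
  by apply: ler_sum => i _; rewrite normrM.
(* If [h1] has no weak derivative, neither has [h0], since [h1] differs from it by a differentiable
   combination; the default value of [weak_partial] is then zero. *)
suff W0 : weak_partial Omega j h0 = cst 0%R.
  apply: aeW => x Ox; rewrite W0 /= normr0; apply: addr_ge0 => //.
  by apply: sumr_ge0 => i _; exact: mulr_ge0.
apply: xgetPN => g0 w0; apply: nw1.
have fg' o : is_weak_partial Omega j (with_head h0 f o) (with_head g0 g o) by case: o.
exists (fun x => \sum_o with_head 1 (fun i => - c i) o * with_head g0 g o x)%R.
apply: (is_weak_partial_comb mh1 fg').
apply: filterS h0E => x h0E /h0E E; rewrite sum_with_head_fun mul1r E.
by rewrite -addrA -big_split/= big1 ?addr0// => i _; rewrite mulNr subrr.
Qed.

End weak_partial_combinations.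

Section W1q_combinations.
Context (R : realType) (d m n : nat).
Notation E := 'rV[R]_d.
Notation leb := (lebesgue_rV R d).
Notation Mx := 'M[R]_(m, n).
Context (Omega : set E) (q : R).
Hypothesis oOmega : open Omega.
Hypothesis q1 : 1 <= q.
Implicit Types (phi psi : E -> Mx).
Local Open Scope ereal_scope.

Let mO : measurable Omega := measurable_open oOmega.

Lemma measurable_weak_partial_mx j phi :
  measurable_fun Omega (weak_partial_mx Omega j phi).
Proof.
apply: measurable_fun_mx => // a b; under eq_fun do rewrite mxE.
exact: measurable_weak_partial.
Qed.

Lemma W1qP phi : W1q Omega q phi -> forall j a b,
  is_weak_partial Omega j (fun x => phi x a b) (weak_partial Omega j (fun x => phi x a b)).
Proof. by move=> [_ H] j a b; apply: weak_partialP; have [] := H j. Qed.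

Lemma W1q_norm_ge0 phi : 0 <= W1q_norm Omega q phi.
Proof. by rewrite adde_ge0 ?Lq_norm_ge0// sume_ge0// => j _; rewrite Lq_norm_ge0. Qed.

Lemma Lq_norm_le_W1q phi : Lq_norm Omega q phi <= W1q_norm Omega q phi.
Proof. by rewrite leeDl// sume_ge0// => j _; rewrite Lq_norm_ge0. Qed.

Lemma Lq_norm_partial_le_W1q j phi :
  Lq_norm Omega q (weak_partial_mx Omega j phi) <= W1q_norm Omega q phi.
Proof.
rewrite /W1q_norm (bigD1 j)//= addeCA leeDl// adde_ge0 ?Lq_norm_ge0// sume_ge0// => k _.
by rewrite Lq_norm_ge0.
Qed.

Lemma W1q_norm_lty phi : W1q Omega q phi -> W1q_norm Omega q phi < +oo.
Proof.
move=> [[_ L] H]; rewrite lte_add_pinfty//; apply/lte_sum_pinfty => j _.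
by have [_ []] := H j.
Qed.

Let W1q_norm_le phi (X : \bar R) : Lq_norm Omega q phi <= X ->
  (forall j, Lq_norm Omega q (weak_partial_mx Omega j phi) <= X) ->
  W1q_norm Omega q phi <= d.+1%:R%:E * X.
Proof.
move=> H0 H; rewrite /W1q_norm.
apply: (@le_trans _ _ (X + \sum_(j < d) X)).
  by apply: leeD => //; apply: lee_sum => j _; exact: H.
by rewrite sumr_const card_ord -mulrS mule_natl.
Qed.

(** The factor [d + 1] counts the field and its [d] partial derivatives, and [m * n] the entries. *)
Lemma W1q_norm_perturb (I : finType) (c : I -> R) (B : I -> E -> Mx) phi psi :
  measurable_fun Omega phi -> measurable_fun Omega psi ->
  (forall i, W1q Omega q (B i)) ->
  {ae leb, forall x, Omega x -> phi x = (psi x + \sum_i c i *: B i x)%R} ->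
  W1q_norm Omega q phi <= d.+1%:R%:E * ((m * n)%:R%:E *
    (W1q_norm Omega q psi + \sum_i `|c i|%:E * W1q_norm Omega q (B i))).
Proof.
move=> mphi mpsi WB phiE.
have entry : {ae leb, forall x, Omega x -> forall a b,
    phi x a b = (psi x a b + \sum_i c i * B i x a b)%R}.
  apply: filterS phiE => x H /H -> a b; rewrite mxE summxE; congr (_ + _)%R.
  by apply: eq_bigr => i _; rewrite mxE.
have key (A0 A1 : E -> Mx) (D : I -> E -> Mx) : measurable_fun Omega A0 ->
    measurable_fun Omega A1 -> (forall i, measurable_fun Omega (D i)) ->
    {ae leb, forall x, Omega x -> forall a b,
      (`|A0 x a b| <= `|A1 x a b| + \sum_i `|c i| * `|D i x a b|)%R} ->
    Lq_norm Omega q A0 <= (m * n)%:R%:E *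
      (Lq_norm Omega q A1 + \sum_i `|c i|%:E * Lq_norm Omega q (D i)).
  move=> mA0 mA1 mD AD.
  have := @Lq_norm_comb R d m n Omega q mO q1 (unit + I)%type (with_head 1%R c)
    (with_head A1 D) A0 mA0; rewrite big_sumType/=.
  rewrite (big_pred1 tt); last by case.
  rewrite normr1 mul1e; apply; first by case.
  apply: filterS AD => x AD Ox a b; rewrite big_sumType/= (big_pred1 tt); last by case.
  by rewrite normr1 mul1r; exact: AD.
have mB i : measurable_fun Omega (B i) by case: (WB i) => -[].
apply: W1q_norm_le => [|j].
  apply: le_trans (key _ _ _ mphi mpsi mB _) _.
    apply: filterS entry => x H Ox a b; rewrite H//; apply: le_trans (ler_normD _ _) _.
    rewrite lerD2l; apply: le_trans (ler_norm_sum _ _ _) _.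
    by apply: ler_sum => i _; rewrite normrM.
  rewrite lee_wpmul2l//; apply: leeD; first exact: Lq_norm_le_W1q.
  by apply: lee_sum => i _; rewrite lee_wpmul2l// Lq_norm_le_W1q.
apply: le_trans (key _ _ (fun i => weak_partial_mx Omega j (B i)) _ _ _ _) _.
- exact: measurable_weak_partial_mx.
- exact: measurable_weak_partial_mx.
- by move=> i; exact: measurable_weak_partial_mx.
- have : forall a b, {ae leb, forall x, Omega x ->
      (`|weak_partial_mx Omega j phi x a b| <= `|weak_partial_mx Omega j psi x a b| +
        \sum_i `|c i| * `|weak_partial_mx Omega j (B i) x a b|)%R}.
    move=> a b; have := @weak_partial_perturb R d Omega oOmega j I c
      (fun i x => B i x a b) _ _ _ (measurable_mx_entry a b mphi)
      (measurable_mx_entry a b mpsi) (fun i => W1qP (WB i) j a b).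
    move=> /(_ _)/filterS; apply.
      move=> x H Ox; rewrite !mxE.
      by apply: le_trans (H Ox) _; rewrite lerD2l; apply: ler_sum => i _; rewrite mxE.
    by apply: filterS entry => x H /H.
  move=> H; have : {ae leb, forall x, forall ab : 'I_m * 'I_n, Omega x ->
      (`|weak_partial_mx Omega j phi x ab.1 ab.2| <= `|weak_partial_mx Omega j psi x ab.1 ab.2| +
        \sum_i `|c i| * `|weak_partial_mx Omega j (B i) x ab.1 ab.2|)%R}.
    by apply: filter_forall => ab; exact: H.
  by apply: filterS => x H' Ox a b; exact: (H' (a, b) Ox).
- rewrite lee_wpmul2l//; apply: leeD; first exact: Lq_norm_partial_le_W1q.
  by apply: lee_sum => i _; rewrite lee_wpmul2l// Lq_norm_partial_le_W1q.
Qed.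

Lemma weak_partial_mx_ae_comb j (I : finType) (c : I -> R) (B : I -> E -> Mx) phi :
  W1q Omega q phi -> (forall i, W1q Omega q (B i)) ->
  {ae leb, forall x, Omega x -> phi x = (\sum_i c i *: B i x)%R} ->
  {ae leb, forall x, Omega x ->
     weak_partial_mx Omega j phi x = (\sum_i c i *: weak_partial_mx Omega j (B i) x)%R}.
Proof.
move=> Wphi WB phiE.
have H (ab : 'I_m * 'I_n) : {ae leb, forall x, Omega x ->
    (weak_partial Omega j (fun y => phi y ab.1 ab.2) x =
    \sum_i c i * weak_partial Omega j (fun y => B i y ab.1 ab.2) x)%R}.
  apply: (weak_partial_ae_comb oOmega (W1qP Wphi j ab.1 ab.2)
    (fun i => W1qP (WB i) j ab.1 ab.2)).
  apply: filterS phiE => x H /H ->; rewrite summxE.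
  by apply: eq_bigr => i _; rewrite mxE.
apply: filterS (filter_forall _ H) => x H' Ox.
apply/matrixP => a b; rewrite mxE (H' (a, b) Ox) summxE.
by apply: eq_bigr => i _; rewrite !mxE.
Qed.

Lemma W1q_comb (I : finType) (c : I -> R) (B : I -> E -> Mx) phi :
  measurable_fun Omega phi -> (forall i, W1q Omega q (B i)) ->
  {ae leb, forall x, Omega x -> phi x = (\sum_i c i *: B i x)%R} ->
  W1q Omega q phi /\ W1q_norm Omega q phi <=
    d.+1%:R%:E * ((m * n)%:R%:E * \sum_i `|c i|%:E * W1q_norm Omega q (B i)).
Proof.
move=> mphi WB phiE.
have key (A : E -> Mx) (D : I -> E -> Mx) : measurable_fun Omega A ->
    (forall i, measurable_fun Omega (D i)) ->
    (forall i, Lq_norm Omega q (D i) <= W1q_norm Omega q (B i)) ->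
    {ae leb, forall x, Omega x -> A x = (\sum_i c i *: D i x)%R} ->
    Lq_norm Omega q A <= (m * n)%:R%:E * \sum_i `|c i|%:E * W1q_norm Omega q (B i).
  move=> mA mD DB AD; apply: (@le_trans _ _ ((m * n)%:R%:E * \sum_i `|c i|%:E * Lq_norm Omega q (D i))).
    apply: (Lq_norm_comb mO q1 mA mD).
    apply: filterS AD => x H /H -> a b; rewrite summxE.
    apply: le_trans (ler_norm_sum _ _ _) _.
    by apply: ler_sum => i _; rewrite mxE normrM.
  by rewrite lee_wpmul2l//; apply: lee_sum => i _; rewrite lee_wpmul2l.
have finX : (m * n)%:R%:E * \sum_i `|c i|%:E * W1q_norm Omega q (B i) < +oo.
  rewrite lte_mul_pinfty//; apply/lte_sum_pinfty => i _.
  by rewrite lte_mul_pinfty// W1q_norm_lty.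
have H0 := key phi B mphi (fun i => (WB i).1.1) (fun i => Lq_norm_le_W1q _) phiE.
have Wphi : W1q Omega q phi.
  have ex j a b : is_weak_partial Omega j (fun x => phi x a b)
      (fun x => \sum_i c i * weak_partial Omega j (fun x => B i x a b) x)%R.
    apply: (is_weak_partial_comb oOmega (measurable_mx_entry a b mphi)
      (fun i => W1qP (WB i) j a b)).
    apply: filterS phiE => x H /H ->; rewrite summxE.
    by apply: eq_bigr => i _; rewrite mxE.
  split; first by split=> //; exact: le_lt_trans H0 _.
  move=> j; split; first by move=> a b; eexists; exact: ex.
  split; first exact: measurable_weak_partial_mx.
  apply: le_lt_trans finX; apply: (key _ (fun i => weak_partial_mx Omega j (B i))).
  - exact: measurable_weak_partial_mx.
  - by move=> i; exact: measurable_weak_partial_mx.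
  - by move=> i; exact: Lq_norm_partial_le_W1q.
  - have H (ab : 'I_m * 'I_n) : {ae leb, forall x, Omega x ->
        (weak_partial Omega j (fun y => phi y ab.1 ab.2) x =
        \sum_i c i * weak_partial Omega j (fun y => B i y ab.1 ab.2) x)%R}.
      apply: (weak_partial_ae_comb oOmega _ (fun i => W1qP (WB i) j ab.1 ab.2)).
        by apply: weak_partialP; eexists; exact: ex.
      apply: filterS phiE => x H /H ->; rewrite summxE.
      by apply: eq_bigr => i _; rewrite mxE.
    apply: filterS (filter_forall _ H) => x H' Ox.
    apply/matrixP => a b; rewrite mxE (H' (a, b) Ox) summxE.
    by apply: eq_bigr => i _; rewrite !mxE.
split=> //; apply: W1q_norm_le => // j.
apply: (key _ (fun i => weak_partial_mx Omega j (B i))).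
- exact: measurable_weak_partial_mx.
- by move=> i; exact: measurable_weak_partial_mx.
- by move=> i; exact: Lq_norm_partial_le_W1q.
- exact: weak_partial_mx_ae_comb.
Qed.

(** A smooth field close to [psi] is also close to [phi], because the difference [phi - psi] is a
    combination of the [B i] with small total norm. *)
Lemma W01q_approx (I : finType) (B : I -> E -> Mx) phi :
  W1q Omega q phi -> (forall i, W1q Omega q (B i)) ->
  (forall eps : R, (0 < eps)%R -> exists psi (c : I -> R), [/\ W01q Omega q psi,
    {ae leb, forall x, Omega x -> phi x = (psi x + \sum_i c i *: B i x)%R} &
    \sum_i `|c i|%:E * W1q_norm Omega q (B i) < eps%:E]) ->
  W01q Omega q phi.
Proof.
move=> Wphi WB H; split=> // eps eps0.
pose K : R := (d.+1%:R * (m * n)%:R)%R; have K0 : (0 <= K)%R by rewrite mulr_ge0.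
(* Two errors of size [e], amplified by [K], stay below [eps]; [K + 1] allows [K = 0]. *)
pose e : R := (eps / (2 * (K + 1)))%R.
have K1 : (0 < K + 1)%R by rewrite ltr_wpDl.
have e0 : (0 < e)%R by rewrite divr_gt0// mulr_gt0.
have [psi [c [[Wpsi apsi] phiE small]]] := H e e0.
have [chi [tchi chiE]] := apsi e e0; exists chi; split=> //.
have mchi : measurable_fun Omega chi.
  apply: measurable_fun_mx => // a b.
  exact: measurable_funS (test_measurable (tchi a b)).
have [[mphi _] _] := Wphi; have [[mpsi _] _] := Wpsi.
have mB (f g : E -> Mx) : measurable_fun Omega f -> measurable_fun Omega g ->
    measurable_fun Omega (f \- g)%R.
  move=> mf mg; apply: measurable_fun_mx => // a b; under eq_fun do rewrite !mxE.
  by apply: measurable_funB; exact: measurable_mx_entry.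
have := @W1q_norm_perturb I (fun i => - c i)%R B (chi \- phi)%R (chi \- psi)%R
  (mB _ _ mchi mphi) (mB _ _ mchi mpsi) WB.
move=> /(_ _)/le_lt_trans; apply.
  apply: filterS phiE => x E' /E' /= ->.
  rewrite opprD addrA; congr (_ + _)%R; rewrite -sumrN.
  by apply: eq_bigr => i _; rewrite scaleNr.
under eq_bigr do rewrite normrN.
rewrite muleA -EFinM -/K.
apply: (@le_lt_trans _ _ (K%:E * (e%:E + e%:E))).
  by rewrite lee_wpmul2l// leeD// ltW.
rewrite -EFinD -EFinM lte_fin /e.
have -> : (K * (eps / (2 * (K + 1)) + eps / (2 * (K + 1))) = eps * (K / (K + 1)))%R.
  by field; rewrite gt_eqF.
by rewrite -[ltRHS]mulr1 ltr_pM2l// ltr_pdivrMr// mul1r ltrDl.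
Qed.

End W1q_combinations.

(** * Finite-dimensional sets of fields *)

Section ae_basis.
Context (R : realType) (d m n : nat).
Notation E := 'rV[R]_d.
Notation leb := (lebesgue_rV R d).
Notation Mx := 'M[R]_(m, n).
Context (Omega : set E) (S : set (E -> Mx)).
Implicit Types (phi : E -> Mx).

Definition ae_comb (I : finType) (c : I -> R) (s : I -> E -> Mx) phi :=
  {ae leb, forall x, Omega x -> phi x = \sum_i c i *: s i x}.

(** The generators are taken in [S] itself, not merely in its span, so that they inherit Sobolev
    regularity and integrability. *)
Definition ae_generates (I : finType) (s : I -> E -> Mx) :=
  (forall i, S (s i)) /\ forall phi, S phi -> exists c, ae_comb c s phi.

Lemma ae_generates_ord (I : finType) (s : I -> E -> Mx) : ae_generates s ->
  ae_generates (fun j : 'I_#|I| => s (enum_val j)).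
Proof.
move=> [Ss gs]; split=> [j|phi /gs [c cphi]]; first exact: Ss.
exists (fun j => c (enum_val j)); apply: filterS cphi => x H /H ->.
rewrite (reindex (@enum_val I predT))//=; exact/onW_bij/enum_val_bij.
Qed.

(** Each vector of the given family spanning the linear hull is a combination of finitely many
    elements of [S]; all these elements together generate. *)
Lemma ae_generates_ex : finite_dimensional Omega S ->
  exists (k : nat) (s : 'I_k -> E -> Mx), ae_generates s.
Proof.
move=> [k [e [Se ge]]].
have : forall i, exists t : {l : nat & ('I_l -> R) * ('I_l -> E -> Mx)}%type,
    (forall j, S ((projT2 t).2 j)) /\
    e i = (fun x => \sum_(j < projT1 t) (projT2 t).1 j *: (projT2 t).2 j x).
  move=> i; have [l [c [s [Ss es]]]] := Se i.
  by exists (existT (fun l => (('I_l -> R) * ('I_l -> E -> Mx))%type) l (c, s)).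
move=> /choice[t tP].
pose s (p : {i : 'I_k & 'I_(projT1 (t i))}) := (projT2 (t (tag p))).2 (tagged p).
have gs : ae_generates s.
  split=> [p|phi Sphi]; first by have [H _] := tP (tag p); exact: H.
  have [c cphi] : exists c : 'I_k -> R,
      {ae leb, forall x, Omega x -> phi x = \sum_(i < k) c i *: e i x}.
    apply: ge; exists 1%N, (fun=> 1), (fun=> phi); split=> //.
    by apply/funext => x; rewrite big_ord1 scale1r.
  exists (fun p => c (tag p) * (projT2 (t (tag p))).1 (tagged p)).
  apply: filterS cphi => x H /H ->.
  rewrite -(@sig_big_dep _ _ _ _ (fun i => 'I_(projT1 (t i))) xpredT (fun _ _ => true)
    (fun i j => (c i * (projT2 (t i)).1 j) *: (projT2 (t i)).2 j x))/=.
  apply: eq_bigr => i _; have [_ ->] := tP i.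
  by rewrite scaler_sumr; apply: eq_bigr => j _; rewrite scalerA.
by eexists; eexists; exact: ae_generates_ord gs.
Qed.

Lemma ae_basis : finite_dimensional Omega S ->
  exists (k : nat) (s : 'I_k -> E -> Mx), ae_generates s /\
    forall c, ae_comb c s (cst 0) -> forall i, c i = 0.
Proof.
move=> /ae_generates_ex ex.
pose P k := `[< exists s : 'I_k -> E -> Mx, ae_generates s >].
have exP : exists k, P k by have [k [s gs]] := ex; exists k; apply/asboolP; exists s.
have [k /asboolP[s [Ss gs]] mink] := ex_minnP exP.
exists k, s; split=> // c c0 i0; apply: contrapT => /eqP ci0.
case: k => [|k] in s Ss gs mink c c0 i0 ci0 *; first by case: (i0) => j; rewrite ltn0.
suff /mink : P k by rewrite ltnn.
apply/asboolP; exists (fun j => s (lift i0 j)); split=> [j|phi /gs [b bphi]]; first exact: Ss.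
exists (fun j => b (lift i0 j) - b i0 * (c (lift i0 j) / c i0)).
apply: filterS2 c0 bphi => x c0 bphi Ox.
have := c0 Ox; rewrite bphi// !(bigD1_ord i0)//= => /eqP.
rewrite eq_sym addrC addr_eq0 => /eqP H.
have -> : s i0 x = - \sum_j (c (lift i0 j) / c i0) *: s (lift i0 j) x.
  rewrite -[LHS](scalerK ci0) -[X in _ *: X]opprK -H scalerN scaler_sumr.
  by congr (- _); apply: eq_bigr => j _; rewrite scalerA mulrC.
rewrite scalerN scaler_sumr addrC -sumrB; apply: eq_bigr => j _.
by rewrite scalerA -scalerBl.
Qed.

End ae_basis.

(** * Coercivity of the integral norm on coefficients *)

Section coercive.
Context dp (T : measurableType dp) (R : realType) (mu : {measure set T -> \bar R}).
Context (D : set T) (mD : measurable D) (k : nat) (J : finType) (h : 'I_k -> J -> T -> R).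
Hypothesis ih : forall i j, mu.-integrable D (EFin \o h i j).
Hypothesis free_h : forall c : 'I_k -> R,
  {ae mu, forall x, D x -> forall j, \sum_i c i * h i j x = 0} -> forall i, c i = 0.

Let P (c : 'rV[R]_k) x : R := \sum_j `|\sum_i c ord0 i * h i j x|.

Let iP c : mu.-integrable D (EFin \o P c).
Proof.
rewrite (_ : _ \o _ = EFin \o (fun x => \sum_(j : J) 1 * `|\sum_i c ord0 i * h i j x|)%R).
  apply: integrable_EFin_sum => // j.
  have := integrable_abse (integrable_EFin_sum mD (c ord0) (fun i => ih i j)).
  exact.
by apply/funext => x; rewrite /= /P; under [in RHS]eq_bigr do rewrite mul1r.
Qed.

Let N c := \int[mu]_(x in D) P c x.

Let NE c : (N c)%:E = (\int[mu]_(x in D) (P c x)%:E)%E.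
Proof. by rewrite /N /Rintegral fineK//; apply: integrable_fin_num => //; exact: iP. Qed.

Let P_ge0 c x : 0 <= P c x.
Proof. by apply: sumr_ge0. Qed.

Let N_ge0 c : 0 <= N c.
Proof. by rewrite -lee_fin NE; apply: integral_ge0 => x _; rewrite lee_fin. Qed.

Let N_scale t c : N (t *: c) = `|t| * N c.
Proof.
apply: EFin_inj; rewrite EFinM !NE -ge0_integralZl//; last first.
- by move=> x _; rewrite lee_fin.
- by have /integrableP[] := iP c.
apply: eq_integral => x _; rewrite -EFinM /P mulr_sumr; congr EFin.
apply: eq_bigr => j _; rewrite -normrM mulr_sumr; congr (Num.norm _).
by apply: eq_bigr => i _; rewrite mxE mulrA.
Qed.

Let N_add c w : N (c + w) <= N c + N w.
Proof.
rewrite -lee_fin EFinD !NE -ge0_integralD//.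
- apply: ge0_le_integral => //.
  + by move=> x _; rewrite lee_fin.
  + by have /integrableP[] := iP (c + w).
  + by apply: emeasurable_funD; [have /integrableP[] := iP c|have /integrableP[] := iP w].
  + move=> x _; rewrite -EFinD lee_fin /P -big_split/=; apply: ler_sum => j _.
    apply: le_trans (ler_normD _ _); rewrite -big_split/= le_eqVlt; apply/orP; left.
    by apply/eqP; congr (Num.norm _); apply: eq_bigr => i _; rewrite mxE mulrDl.
- by move=> x _; rewrite lee_fin.
- by have /integrableP[] := iP c.
- by move=> x _; rewrite lee_fin.
- by have /integrableP[] := iP w.
Qed.

Let N_lip : exists2 L, 0 <= L & forall w, N w <= L * `|w|.
Proof.
pose e i : 'rV[R]_k := delta_mx ord0 i.
exists (\sum_i N (e i)); first by apply: sumr_ge0.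
move=> w; rewrite mulr_suml {1}(row_sum_delta w).
pose K (v : 'rV[R]_k) (r : R) := N v <= r.
apply: (@big_ind2 _ _ K) => [|v r v' r' H H'|i _].
- by rewrite /K -(scale0r (0 : 'rV[R]_k)) N_scale normr0 mul0r.
- by apply: le_trans (N_add _ _) _; exact: lerD.
- by rewrite /K N_scale mulrC ler_wpM2l// mx_coord_le_norm.
Qed.

Let N_continuous : continuous N.
Proof.
have [L L0 HL] := N_lip; apply: (@lipschitz_continuous _ _ _ L) => v w.
rewrite ler_norml; apply/andP; split; last first.
  by rewrite lerBlDl; apply: le_trans (N_add _ _) _; rewrite lerD2l.
rewrite lerBrDl; have := N_add (v + w) (- w); rewrite addrK => H.
have NN : N (- w) = N w by rewrite -scaleN1r N_scale normrN normr1 mul1r.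
by rewrite lerBlDr; apply: le_trans H _; rewrite NN lerD2l.
Qed.

Let N_gt0 c : c != 0 -> 0 < N c.
Proof.
move=> c0; rewrite lt_neqAle N_ge0 andbT; apply/negP => /eqP N0.
case/negP : c0; apply/eqP/rowP => i; rewrite mxE.
apply: (free_h (c := c ord0)) i.
have : {ae mu, forall x, D x -> (P c x)%:E = 0%E}.
  apply/ae_eq_integral_abs => //; first by have /integrableP[] := iP c.
  under eq_integral do rewrite gee0_abs ?lee_fin//.
  by rewrite -NE -N0.
apply: filterS => x H Dx j; apply/eqP; rewrite -normr_eq0.
by have [/eqP] := H Dx; rewrite psumr_eq0// => /allP/(_ j); rewrite mem_index_enum; apply.
Qed.

(** Equivalence of norms in finite dimension: [N] is a continuous seminorm of the coefficients,
    positive off the origin by freeness, hence bounded below on the compact unit sphere. *)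
Lemma free_integral_coercive : exists2 alpha : R, 0 < alpha & forall c : 'I_k -> R,
  ((alpha * \sum_i `|c i|)%:E <=
    \int[mu]_(x in D) (\sum_j `|\sum_i c i * h i j x|)%:E)%E.
Proof.
pose K : set 'rV[R]_k := [set c | `|c| = 1].
have norm_row (c : 'rV[R]_k) : \sum_i `|c ord0 i| <= k%:R * `|c|.
  apply: (@le_trans _ _ (\sum_(i < k) `|c|)).
    by apply: ler_sum => i _; exact: mx_coord_le_norm.
  by rewrite sumr_const card_ord mulr_natl.
have inK (c : 'rV[R]_k) : c != 0 -> K (`|c|^-1 *: c).
  by move=> c0; rewrite /K /= normrZ normrV ?unitfE ?normr_eq0// normr_id mulVf// normr_eq0.
suff [a a0 Ha] : exists2 a : R, 0 < a & forall c, a * `|c| <= N c.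
  (* The sum of the [|c_i|] is at most [k] times the sup norm; [k + 1] covers the empty family. *)
  exists (a / k.+1%:R); first by rewrite divr_gt0.
  move=> c; pose c' : 'rV[R]_k := \row_i c i.
  have -> : (\int[mu]_(x in D) (\sum_j `|\sum_i c i * h i j x|)%:E)%E = (N c')%:E.
    rewrite NE; apply: eq_integral => x _; congr EFin; apply: eq_bigr => j _.
    by congr (Num.norm _); apply: eq_bigr => i _; rewrite mxE.
  rewrite lee_fin; apply: le_trans (Ha c'); rewrite -mulrA ler_pM2l//.
  rewrite ler_pdivrMl//; apply: (@le_trans _ _ (k%:R * `|c'|)); last first.
    by rewrite ler_wpM2r// ler_nat.
  apply: le_trans (norm_row c'); rewrite le_eqVlt; apply/orP; left; apply/eqP.
  by apply: eq_bigr => i _; rewrite mxE.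
(* An empty unit sphere means that zero is the only vector, as for [k = 0]. *)
have [[c Kc]|K0] := pselect (K !=set0); last first.
  exists 1 => // c; have [->|/inK Kc] := eqVneq c 0; first by rewrite normr0 mulr0.
  by exfalso; apply: K0; eexists; exact: Kc.
have cK : compact K.
  apply: bounded_closed_compact.
    by exists 1; split=> // M M1 x /= ->; exact: ltW.
  apply: (@preimage_closed _ _ (fun c : 'rV[R]_k => `|c|) [set 1]).
    by move=> x _; exact: norm_continuous.
  exact: closed_eq.
have cN : {within K, continuous N} by exact: continuous_subspaceT.
have [c0 Kc0 minN] := compact_EVT_min (ex_intro _ c Kc) cK cN.
exists (N c0).
  apply: N_gt0; apply/eqP => c00; move: Kc0; rewrite inE /K /= c00 normr0.
  by move/esym/eqP; rewrite oner_eq0.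
move=> v; have [->|v0] := eqVneq v 0; first by rewrite normr0 mulr0.
have := minN (`|v|^-1 *: v); rewrite inE => /(_ (inK _ v0)).
rewrite N_scale normrV ?unitfE ?normr_eq0// normr_id mulrC ler_pdivlMr ?normr_gt0//.
Qed.

End coercive.

(** * Closedness and divergence bounds in finite dimension *)

Section finite_dimensional_fields.
Context (R : realType) (d : nat).
Notation E := 'rV[R]_d.
Notation leb := (lebesgue_rV R d).
Notation Mx := 'M[R]_d.
Context (Omega : set E) (q : R) (S : set (E -> Mx)).
Hypothesis oOmega : open Omega.
Hypothesis bOmega : bounded_set Omega.
Hypothesis q1 : 1 <= q.
Hypothesis SW : S `<=` W01q Omega q.
Hypothesis S_closed : closed_in_W01q Omega q S.
Hypothesis S_fin : finite_dimensional Omega S.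
Implicit Types (phi : E -> Mx) (u : E -> E).

Let mO : measurable Omega := measurable_open oOmega.
Let Ooo : (leb Omega < +oo)%E := leb_bounded_lty bOmega mO.

Lemma S_W1q phi : S phi -> W1q Omega q phi.
Proof. by move=> /SW[]. Qed.

Lemma S_measurable phi : S phi -> measurable_fun Omega phi.
Proof. by move=> /S_W1q[[]]. Qed.

Lemma S_integrable phi i j : S phi -> leb.-integrable Omega (EFin \o (fun x => phi x i j)).
Proof. by move=> /S_W1q[Wphi _]; exact: (in_Lq_integrable mO q1). Qed.

Lemma measurable_wdiv phi : measurable_fun Omega (wdiv Omega phi).
Proof.
apply: measurable_fun_mx => // i j; under eq_fun do rewrite mxE.
by apply: measurable_sum => k; exact: measurable_weak_partial.
Qed.

Lemma S_wdiv_integrable phi i j : S phi ->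
  leb.-integrable Omega (EFin \o (fun x => wdiv Omega phi x i j)).
Proof.
move=> /S_W1q[_ Wphi].
have I (l : 'I_d) := in_Lq_integrable mO q1 j l Ooo (Wphi l).2.
rewrite (_ : _ \o _ = EFin \o (fun x => \sum_l 1 * weak_partial_mx Omega l phi x j l)%R).
  exact: integrable_EFin_sum.
apply/funext => x; rewrite /= mxE; congr EFin; apply: eq_bigr => l _.
by rewrite mxE mul1r.
Qed.

Lemma wdiv_ae_comb (I : finType) (c : I -> R) (B : I -> E -> Mx) phi :
  W1q Omega q phi -> (forall i, W1q Omega q (B i)) -> ae_comb Omega c B phi ->
  {ae leb, forall x, Omega x -> wdiv Omega phi x = \sum_i c i *: wdiv Omega (B i) x}.
Proof.
move=> Wphi WB phiE.
have := filter_forall _ (fun j => weak_partial_mx_ae_comb oOmega j Wphi WB phiE).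
move=> /(_ _)/filterS; apply => x H Ox; apply/rowP => a; rewrite mxE summxE.
rewrite (eq_bigr (fun j => \sum_i c i * weak_partial_mx Omega j (B i) x a j)); last first.
  move=> j _; have := H j Ox; move=> /matrixP/(_ a j); rewrite mxE => ->.
  by rewrite summxE; apply: eq_bigr => i _; rewrite mxE.
rewrite exchange_big/=; apply: eq_bigr => i _; rewrite !mxE mulr_sumr.
by apply: eq_bigr => j _; rewrite mxE.
Qed.

Lemma S_basis : exists (k : nat) (s : 'I_k -> E -> Mx), ae_generates Omega S s /\
  exists2 alpha : R, 0 < alpha & forall c phi, ae_comb Omega c s phi ->
    measurable_fun Omega phi ->
    ((alpha * \sum_i `|c i|)%:E <=
      \int[leb]_(x in Omega) (\sum_(p : 'I_d * 'I_d) `|phi x p.1 p.2|)%:E)%E.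
Proof.
have [k [s [[Ss gs] free]]] := ae_basis S_fin.
exists k, s; split=> //.
have [i p|c H|alpha a0 Ha] := @free_integral_coercive _ _ R leb Omega mO k ('I_d * 'I_d)%type
    (fun i p x => s i x p.1 p.2).
- exact: S_integrable.
- apply: free; apply: filterS H => x H Ox; apply/matrixP => a b.
  rewrite mxE summxE -[LHS](H Ox (a, b)).
  by apply: eq_bigr => i _; rewrite mxE.
exists alpha => // c phi cphi mphi; apply: le_trans (Ha c) _.
rewrite le_eqVlt; apply/orP; left; apply/eqP; apply: ae_eq_integral => //.
- apply/measurable_EFinP; apply: measurable_sum => p; apply: measurableT_comp => //.
  apply: measurable_sum => i; apply: measurable_funM => //.
  by apply: measurable_mx_entry; exact: S_measurable.
- apply/measurable_EFinP; apply: measurable_sum => p; apply: measurableT_comp => //.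
  exact: measurable_mx_entry.
- apply: filterS cphi => x H Ox; congr EFin; apply: eq_bigr => p _.
  by rewrite H// summxE; congr (Num.norm _); apply: eq_bigr => i _; rewrite mxE.
Qed.

(** Convergence of coefficients is convergence in the Sobolev norm. Since closedness of [S] is
    relative to [W01q], membership of the limit in [W01q] has to be proved beforehand, from that of
    the approximants. *)
Lemma S_comb_cvg (I : finType) (s : I -> E -> Mx) (c_ : nat -> I -> R) (c : I -> R)
    (phi_ : nat -> E -> Mx) :
  (forall i, S (s i)) -> (forall n, S (phi_ n)) -> (forall n, ae_comb Omega (c_ n) s (phi_ n)) ->
  (forall i, c_ n i @[n --> \oo] --> c i) -> S (fun x => \sum_i c i *: s i x).
Proof.
move=> Ss Sphi cphi cc; set phi := fun x => _.
have Ws i : W1q Omega q (s i) by exact: S_W1q.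
have mphi : measurable_fun Omega phi.
  by apply: measurable_mx_comb => // i; exact: S_measurable.
have [Wphi _] := @W1q_comb R d d d Omega q oOmega q1 I c s phi mphi Ws
  (aeW _ (fun x _ => erefl)).
pose N i := fine (W1q_norm Omega q (s i)).
have NE i : W1q_norm Omega q (s i) = (N i)%:E.
  by rewrite fineK// ge0_fin_numE ?W1q_norm_ge0 ?W1q_norm_lty.
have N0 i : 0 <= N i by rewrite fine_ge0// W1q_norm_ge0.
have small (eps : R) : 0 < eps -> exists n, \sum_i `|c_ n i - c i| * N i < eps.
  move=> eps0; pose K := \sum_i N i + 1.
  have K0 : 0 < K by rewrite ltr_wpDl// sumr_ge0.
  have : \forall n \near \oo, forall i, `|c i - c_ n i| < eps / K.
    apply: filter_forall => i; move/cvgrPdist_lt : (cc i); apply.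
    by rewrite divr_gt0.
  case=> n _ /(_ n (leqnn n)) H; exists n.
  apply: (@le_lt_trans _ _ (eps / K * \sum_i N i)).
    rewrite mulr_sumr; apply: ler_sum => i _; rewrite ler_wpM2r// distrC ltW//.
  by rewrite -mulrA -[ltRHS]mulr1 ltr_pM2l// ltr_pdivrMl// mulr1 ltrDl.
have Wphi01 : W01q Omega q phi.
  apply: (W01q_approx oOmega q1 Wphi Ws) => eps /small[n Hn].
  exists (phi_ n), (fun i => c i - c_ n i); split.
  - exact: SW.
  - apply: filterS (cphi n) => x H Ox; rewrite H// -big_split/=.
    by apply: eq_bigr => i _; rewrite -scalerDl subrKC.
  - under eq_bigr do rewrite NE -EFinM distrC.
    by rewrite sumEFin lte_fin.
apply: S_closed => // eps eps0.
pose K : R := (d.+1%:R * (d * d)%:R)%R; have K0 : (0 <= K)%R by rewrite mulr_ge0.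
have K1 : (0 < K + 1)%R by rewrite ltr_wpDl.
have e0 : 0 < eps / (K + 1) by rewrite divr_gt0.
have [n Hn] := small _ e0; exists (phi_ n) => //.
have mB : measurable_fun Omega (phi_ n \- phi).
  apply: measurable_fun_mx => // a b; under eq_fun do rewrite !mxE.
  by apply: measurable_funB; apply: measurable_mx_entry => //; exact: S_measurable.
have cB : ae_comb Omega (fun i => c_ n i - c i) s (phi_ n \- phi).
  apply: filterS (cphi n) => x H Ox /=; rewrite H// -sumrB.
  by apply: eq_bigr => i _; rewrite scalerBl.
have [_] := W1q_comb oOmega q1 mB Ws cB.
move/le_lt_trans; apply.
under eq_bigr do rewrite NE -EFinM.
rewrite sumEFin -!EFinM lte_fin mulrA -/K.
apply: (@le_lt_trans _ _ (K * (eps / (K + 1)))); first by rewrite ler_wpM2l// ltW.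
by rewrite mulrCA -[ltRHS]mulr1 ltr_pM2l// ltr_pdivrMr// mul1r ltrDl.
Qed.

(** The divergence is controlled by the coefficients, these by the integral of the entries
    ([S_basis]), and that by the [L^q] norm on a bounded set. Hence a bounded map satisfies the
    estimate defining [U_S]. *)
Lemma S_wdiv_bound (M : R) : 0 <= M -> exists2 C : R, 0 <= C & forall u phi, S phi ->
  measurable_fun Omega u -> (forall x, Omega x -> forall i, `|u x ord0 i| <= M) ->
  (`| \int[leb]_(x in Omega) (dot (u x) (wdiv Omega phi x))%:E | <= C%:E * Lq_norm Omega q phi)%E.
Proof.
move=> M0; have [k [s [[Ss gs] [alpha a0 Ha]]]] := S_basis.
have [C1 C10 HC1] := integral_le_LN mO q1 Ooo.
pose Q i x : R := \sum_(j < d) `|wdiv Omega (s i) x ord0 j|.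
have iQ i : leb.-integrable Omega (EFin \o Q i).
  rewrite (_ : _ \o _ = EFin \o (fun x => \sum_(j < d) 1 * `|wdiv Omega (s i) x ord0 j|)%R).
    apply: integrable_EFin_sum => // j.
    have := integrable_abse (S_wdiv_integrable ord0 j (Ss i)).
    exact.
  by apply/funext => x /=; congr EFin; apply: eq_bigr => j _; rewrite mul1r.
pose q_ i := fine (\int[leb]_(x in Omega) (Q i x)%:E).
have qE i : (\int[leb]_(x in Omega) (Q i x)%:E = (q_ i)%:E)%E.
  by rewrite fineK//; apply: integrable_fin_num => //; exact: iQ.
have Q0 i x : 0 <= Q i x by apply: sumr_ge0.
have q0 i : 0 <= q_ i by rewrite -lee_fin -qE; apply: integral_ge0 => x _; rewrite lee_fin.
pose A := \sum_i q_ i; have A0 : 0 <= A by apply: sumr_ge0.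
exists (M * A / alpha * ((d * d)%:R * C1)).
  by rewrite !mulr_ge0// invr_ge0 ltW.
move=> u phi Sphi mu uM; have [c cphi] := gs _ Sphi.
have mphi := S_measurable Sphi.
have step1 : (`| \int[leb]_(x in Omega) (dot (u x) (wdiv Omega phi x))%:E | <=
    (M * \sum_i `|c i| * q_ i)%:E)%E.
  have mdot : measurable_fun Omega (fun x => (dot (u x) (wdiv Omega phi x))%:E).
    apply/measurable_EFinP; apply: measurable_dot => //; exact: measurable_wdiv.
  apply: le_trans (le_abse_integral _ _ mdot) _ => //.
  have -> : ((M * \sum_i `|c i| * q_ i)%:E =
      \int[leb]_(x in Omega) (\sum_i (M * `|c i|) * Q i x)%:E)%E.
    rewrite integral_EFin_sum//; under [in RHS]eq_bigr do rewrite qE -EFinM.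
    by rewrite sumEFin; congr EFin; rewrite mulr_sumr; apply: eq_bigr => i _; rewrite mulrA.
  apply: ae_ge0_le_integral => //.
  - exact: measurableT_comp.
  - by move=> x _; rewrite lee_fin; apply: sumr_ge0 => i _; rewrite !mulr_ge0.
  - by have /integrableP[] := integrable_EFin_sum mO (fun i => M * `|c i|) iQ.
  - have := wdiv_ae_comb (S_W1q Sphi) (fun i => S_W1q (Ss i)) cphi.
    apply: filterS => x H Ox; rewrite lee_fin H// dot_row.
    apply: le_trans (ler_norm_sum _ _ _) _.
    apply: (@le_trans _ _ (\sum_(j < d) M * \sum_i `|c i| * `|wdiv Omega (s i) x ord0 j|)).
      apply: ler_sum => j _; rewrite normrM ler_pM//; first exact: uM.
      rewrite summxE; apply: le_trans (ler_norm_sum _ _ _) _.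
      by apply: ler_sum => i _; rewrite mxE normrM.
    rewrite -mulr_sumr exchange_big/= mulr_sumr; apply: ler_sum => i _.
    by rewrite -mulr_sumr mulrA.
apply: le_trans step1 _.
have step2 : ((M * \sum_i `|c i| * q_ i) <= (M * A / alpha) * (alpha * \sum_i `|c i|)).
  rewrite mulrA divfK ?gt_eqF// -mulrA ler_wpM2l// mulr_sumr; apply: ler_sum => i _.
  rewrite mulrC ler_wpM2r// /A (bigD1 i)//= lerDl; exact: sumr_ge0.
apply: (@le_trans _ _ ((M * A / alpha) * (alpha * \sum_i `|c i|))%:E); first by rewrite lee_fin.
rewrite EFinM [in leRHS]EFinM -muleA lee_wpmul2l ?lee_fin ?mulr_ge0 ?invr_ge0 ?(ltW a0)//.
apply: le_trans (Ha _ _ cphi mphi) _.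
have -> : (\int[leb]_(x in Omega) (\sum_(p : 'I_d * 'I_d) `|phi x p.1 p.2|)%:E =
    \sum_(p : 'I_d * 'I_d) \int[leb]_(x in Omega) (`|phi x p.1 p.2|)%:E)%E.
  under eq_integral do rewrite -sumEFin.
  rewrite ge0_integral_sum// => p; apply/measurable_EFinP; apply: measurableT_comp => //.
  exact: measurable_mx_entry.
apply: (@le_trans _ _ (\sum_(p : 'I_d * 'I_d) C1%:E * Lq_norm Omega q phi)%E).
  apply: lee_sum => p _; apply: le_trans (HC1 _ (measurable_mx_entry p.1 p.2 mphi)) _.
  by rewrite lee_wpmul2l ?lee_fin//; exact: LN_entry_le.
by rewrite sumr_const card_prod !card_ord EFinM -muleA mule_natl.
Qed.

End finite_dimensional_fields.

(** * Measure-preserving maps *)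

Section seq_cluster.
Import ArrowAsProduct.

(* Tychonoff's theorem, read along the tails of a sequence. *)
Lemma seq_cluster (R : realType) (I : choiceType) (h : nat -> I -> R) (b : I -> R) :
  (forall n i, `|h n i| <= b i) ->
  exists hb : I -> R, forall (l : seq I) (e : R) (m : nat), 0 < e ->
    exists2 n, (m <= n)%N & forall i, i \in l -> `|hb i - h n i| < e.
Proof.
move=> hbd.
have cpt := @tychonoff I (fun=> R) (fun i => `[- b i, b i]%classic)
  (fun i => @segment_compact R (- b i) (b i)).
have [|hb [_ clus]] := cpt (h @ \oo) _.
  by exists 0%N => // n _ i /=; rewrite in_itv/= -ler_norml.
exists hb => l e m e0.
have nb : nbhs hb [set g : I -> R | forall i, i \in l -> `|hb i - g i| < e].
  elim: l => [|i l IH]; first by apply: filterS filterT => g _ i; rewrite in_nil.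
  have ni : nbhs hb [set g : I -> R | `|hb i - g i| < e].
    have /(_ hb) := @proj_continuous I (fun=> R) i.
    by move/cvgrPdist_lt/(_ e e0).
  apply: filterS2 ni IH => g gi gl j; rewrite in_cons => /orP[/eqP ->//|]; exact: gl.
have A : (h @ \oo) (h @` [set n | (m <= n)%N]).
  by exists m => // n mn /=; exists n.
by have [_ [[n mn <-] H]] := clus _ _ A nb; exists n.
Qed.

End seq_cluster.

Section integral_bounds.
Context dp (T : measurableType dp) (R : realType) (mu : {measure set T -> \bar R}).
Context (D : set T) (mD : measurable D).
Local Open Scope ereal_scope.

Lemma le_integral_integrable (f g : T -> \bar R) : mu.-integrable D f ->
  measurable_fun D g -> (forall x, D x -> f x <= g x) ->
  \int[mu]_(x in D) f x <= \int[mu]_(x in D) g x.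
Proof.
move=> fi mg fg; rewrite [leLHS]integralE [leRHS]integralE; have fg' : {in D, forall x, f x <= g x} by move=> x; rewrite inE; exact: fg.
have mf : measurable_fun D f by case/integrableP: fi.
apply: leeB.
- apply: ge0_le_integral => //; [exact: measurable_funepos|exact: measurable_funepos|].
  by move=> x Dx; apply: (funepos_le fg'); rewrite inE.
- apply: ge0_le_integral => //; [exact: measurable_funeneg|exact: measurable_funeneg|].
  by move=> x Dx; apply: (funeneg_le fg'); rewrite inE.
Qed.

Lemma limn_einf_eventually (u : (\bar R)^nat) (b : R) : b%:E < limn_einf u ->
  exists N, forall n, (N <= n)%N -> b%:E <= u n.
Proof.
rewrite limn_einf_lim => bu.
have [N _ H] := lte_lim (nondecreasing_einfs u) (@is_cvg_einfs _ u) bu.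
exists N => n Nn; apply: le_trans (H N (leqnn N)) _.
by apply: ereal_inf_lbound; exists n.
Qed.

End integral_bounds.

Section bump_test.
Context (R : realType) (d : nat).
Notation E := 'rV[R]_d.
Notation leb := (lebesgue_rV R d).
Local Open Scope ereal_scope.

Lemma box_bump_continuous (a b : E) (s : R) : (0 < s)%R -> continuous (box_bump a b s).
Proof.
by move=> s0; apply: smooth_continuous; exact: flat_poly_smooth (flat_poly_bump a b s0).
Qed.

Lemma box_bump_compact (a b : E) (s : R) : (0 < s)%R ->
  compact (closure [set x | box_bump a b s x != 0%R]).
Proof. by move=> s0; have [] := @test_bump R d setT a b s s0 (fun _ _ => I). Qed.

(** Passes from identities for continuous compactly supported functions to the measures of preimages
    of open boxes. *)
Lemma cvg_integral_bump dp (T : measurableType dp) (mu : {measure set T -> \bar R})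
    (D : set T) (v : T -> E) (a b : E) : measurable D -> mu D < +oo ->
  measurable_fun D v ->
  \int[mu]_(x in D) (box_bump a b k.+1%:R^-1 (v x))%:E @[k --> \oo] -->
  mu (D `&` v @^-1` obox a b).
Proof.
move=> mD Doo mv.
have mob : measurable_fun D (fun x => \1_(obox a b) (v x) : R).
  apply: (@measurableT_comp _ _ _ _ _ _ (\1_(obox a b) : E -> R)) => //.
  by apply: measurable_indic; exact: measurable_obox.
have -> : mu (D `&` v @^-1` obox a b) = \int[mu]_(x in D) (\1_(obox a b) (v x))%:E.
  have mA : measurable (D `&` v @^-1` obox a b) by apply: mv => //; exact: measurable_obox.
  have := integral_indic mu mD mA; rewrite setIAC setIid => <-.
  apply: eq_integral => x; rewrite inE => Dx; congr EFin.
  rewrite !indicE; congr (nat_of_bool _)%:R.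
  by apply/idP/idP; rewrite !inE; [case|split].
have [] := @dominated_convergence _ _ _ mu D mD
  (fun k x => (box_bump a b k.+1%:R^-1 (v x))%:E) (fun x => (\1_(obox a b) (v x))%:E)
  (fun=> 1%:E) => //.
- move=> k; apply/measurable_EFinP.
  apply: (@measurableT_comp _ _ _ _ _ _ (box_bump a b k.+1%:R^-1)) => //.
  apply: flat_poly_measurable; exact: flat_poly_bump.
- exact/measurable_EFinP.
- by apply: aeW => x _; apply: cvg_EFin; [exact: nearW|exact: cvg_bump].
- apply/integrableP; split; first exact: measurable_cst.
  under eq_integral do rewrite gee0_abs//.
  by rewrite integral_cst// mul1e.
- by apply: aeW => x k _; rewrite lee_fin ger0_norm ?bump_ge0// bump_le1.
Qed.

End bump_test.

Lemma ereal_cvg_unique (R : realType) (u v : (\bar R)^nat) (a b : \bar R) :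
  u @ \oo --> a -> v @ \oo --> b -> (forall k, u k = v k) -> a = b.
Proof. by move=> ua vb /funext uv; apply: (cvg_unique _ ua) => //; rewrite uv. Qed.

Section measure_preserving.
Local Open Scope ereal_scope.
Context (R : realType) (d : nat).
Notation E := 'rV[R]_d.
Notation leb := (lebesgue_rV R d).
Context (Omega Lambda : set E) (u : E -> E).
Hypothesis mO : measurable Omega.
Hypothesis mL : measurable Lambda.
Hypothesis Ooo : leb Omega < +oo.
Hypothesis Loo : leb Lambda < +oo.
Hypothesis mu : measurable_fun Omega u.
Hypothesis u_test : forall l : E -> R, continuous l -> compact (closure [set x | l x != 0%R]) ->
  \int[leb]_(x in Omega) (l (u x))%:E = \int[leb]_(y in Lambda) (l y)%:E.

Lemma preserving_preimage A : measurable A ->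
  leb (Omega `&` u @^-1` A) = leb (Lambda `&` A).
Proof.
(* An everywhere measurable extension, needed for the pushforward; the measure restricted to [Omega]
   does not see the value 0. *)
pose v x := if x \in Omega then u x else 0%R.
have mv : measurable_fun setT v.
  apply: measurable_fun_mx => // i j.
  have -> : (fun x => v x i j) = (fun x => u x i j) \_ Omega.
    by apply/funext => x; rewrite /v /patch; case: ifPn => // _; rewrite mxE.
  by apply/(measurable_restrictT _ mO); exact: measurable_mx_entry.
have Ev B : Omega `&` u @^-1` B = v @^-1` B `&` Omega.
  rewrite setIC; apply/seteqP; split=> x /= [Bx Ox]; split=> //; move: Bx;
  by rewrite /v mem_set.
move=> mA; rewrite Ev -[LHS]/(pushforward (mrestr leb mO) v A).
rewrite [in RHS]setIC -[RHS]/(mrestr leb mL A).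
have E1 B : pushforward (mrestr leb mO) v B = leb (Omega `&` u @^-1` B) by rewrite Ev.
have E2 B : mrestr leb mL B = leb (Lambda `&` B) by rewrite setIC.
apply: (@rV_measure_unique R d (pushforward (mrestr leb mO) v) (mrestr leb mL)) => //.
- move=> a b; apply: (etrans (E1 _)); apply: (etrans _ (esym (E2 _))).
  have H1 := cvg_integral_bump (a := a) (b := b) mO Ooo mu.
  have H2 := cvg_integral_bump (v := id) (a := a) (b := b) mL Loo (@measurable_id _ _ _).
  apply: (ereal_cvg_unique H1 H2) => k.
  by apply: u_test; [exact: box_bump_continuous|exact: box_bump_compact].
- move=> k; set B := obox _ _; have mB : measurable B by exact: measurable_obox.
  rewrite [X in X < _](E1 B).
  apply: le_lt_trans Ooo; apply: le_measure; rewrite ?inE//.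
  exact: mu.
Qed.

Lemma preserving_ae : {ae leb, forall x, Omega x -> Lambda (u x)}.
Proof.
exists (Omega `&` u @^-1` ~` Lambda); split.
- by apply: mu => //; exact: measurableC.
- apply: (etrans (preserving_preimage _)); first exact: measurableC.
  by rewrite setICr measure0.
- by move=> x /= /not_implyP.
Qed.

Lemma preserving_integral (z : E) (l : E -> \bar R) : ~ Lambda z ->
  measurable_fun setT l -> (forall y, Lambda y -> 0 <= l y) ->
  (forall y, ~ Lambda y -> l y = 0) ->
  \int[leb]_(x in Omega) l (u x) = \int[leb]_(y in Lambda) l y.
Proof.
move=> nz ml l0 lout.
(* The value [z] outside [Lambda] keeps points off [Omega] out of the preimage of any subset of
   [Lambda], so the unrestricted measure can be pushed forward. *)
pose v x := if x \in Omega then u x else z.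
have mv : measurable_fun setT v.
  apply: measurable_fun_mx => // i j.
  pose w x := (u x - z)%R.
  have -> : (fun x => v x i j) = (fun x => ((fun x => w x i j) \_ Omega) x + z i j)%R.
    apply/funext => x; rewrite /v /patch /w; case: ifPn => _; rewrite ?add0r//.
    by rewrite !mxE subrK.
  apply: measurable_funD => //; apply/(measurable_restrictT _ mO).
  by under eq_fun do rewrite /w !mxE; apply: measurable_funB => //; exact: measurable_mx_entry.
have Ev B : B `<=` Lambda -> v @^-1` B = Omega `&` u @^-1` B.
  move=> BL; apply/seteqP; split=> x; rewrite /v /=.
    by case: ifPn; rewrite (inE, notin_setE)// => _ /BL.
  by move=> [Ox Bx]; rewrite mem_set.
rewrite (@integral_supp _ _ _ _ Omega (Omega `&` u @^-1` Lambda))//; last first.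
  by move=> x Ox nx; rewrite lout// => Lx; apply: nx.
rewrite -(Ev Lambda)//.
transitivity (\int[leb]_(x in v @^-1` Lambda) (l \o v) x).
  apply: eq_integral => x; rewrite inE Ev// => -[Ox _] /=.
  by rewrite /v mem_set.
rewrite -(@ge0_integral_pushforward _ _ _ _ _ _ mv leb Lambda l mL)//.
- apply: eq_measure_integral => A mA AL.
  rewrite -[LHS]/(leb (v @^-1` A)) Ev//.
  apply: (etrans (preserving_preimage _)) => //.
  by rewrite setIC setIidl.
- exact: measurable_funTS.
- by move=> y; rewrite inE; exact: l0.
Qed.

End measure_preserving.

(** * Compactness of potentials *)

Section bounded_below.
Context dp (T : measurableType dp) (R : realType) (mu : {measure set T -> \bar R}).
Context (D : set T) (mD : measurable D).
Local Open Scope ereal_scope.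
Hypothesis Doo : mu D < +oo.

Lemma integrable_cstr (C : R) : mu.-integrable D (fun=> C%:E).
Proof.
apply/integrableP; split; first exact: measurable_cst.
rewrite integral_cst//= lte_mul_pinfty//.
Qed.

(** On a set of finite measure a lower bound makes the negative part integrable, so only the
    positive part can spoil integrability. Conjugates of [f] are treated through this dichotomy. *)
Lemma integrable_or_pinfty (h : T -> \bar R) (C : R) : measurable_fun D h ->
  (forall x, D x -> C%:E <= h x) ->
  mu.-integrable D h \/ \int[mu]_(x in D) h x = +oo.
Proof.
move=> mh hC.
have negoo : \int[mu]_(x in D) h^\- x < +oo.
  apply: (@le_lt_trans _ _ (\int[mu]_(x in D) `|C|%:E)).
    apply: ge0_le_integral => //; first exact: measurable_funeneg.
    move=> x Dx; rewrite funenegE ge_max; apply/andP; split; last by rewrite lee_fin.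
    rewrite leeNl; apply: le_trans (hC x Dx); rewrite -EFinN lee_fin.
    by rewrite lerNl -normrN ler_norm.
  by rewrite integral_cst//= lte_mul_pinfty//.
have [posoo|posoo] := eqVneq (\int[mu]_(x in D) h^\+ x) +oo; [right|left].
  rewrite integralE posoo addye//.
  by case: (integral _ _ _) negoo.
apply/integrableP; split=> //.
have -> : \int[mu]_(x in D) `|h x| = \int[mu]_(x in D) (h^\+ x + h^\- x).
  by apply: eq_integral => x _; rewrite -[LHS]/((abse \o h) x) fune_abse.
rewrite ge0_integralD//; [|exact: measurable_funepos|exact: measurable_funeneg].
by rewrite lte_add_pinfty// ltey.
Qed.

Lemma integral_shift (h : T -> \bar R) (C : R) : (0 <= C)%R -> measurable_fun D h ->
  (forall x, D x -> (- C)%:E <= h x) ->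
  \int[mu]_(x in D) (h x + C%:E) = \int[mu]_(x in D) h x + C%:E * mu D.
Proof.
move=> C0 mh hC; have [ih|ioo] := integrable_or_pinfty mh hC.
  by rewrite integralD//= ?integral_cst//; exact: integrable_cstr.
rewrite ioo; have CD : C%:E * mu D \is a fin_num.
  by rewrite fin_numM// ge0_fin_numE.
rewrite addye ?fin_num_eqNy//; last by move: CD; rewrite fin_numE => /andP[].
have mhC : measurable_fun D (fun x => h x + C%:E).
  by apply: emeasurable_funD => //; exact: measurable_cst.
have hC0 x : D x -> 0%:E <= h x + C%:E.
  by move=> /hC; rewrite EFinN => H; rewrite -[leLHS](subee (x := C%:E))// addeC leeD2r.
have [ihC|//] := integrable_or_pinfty mhC hC0.
have : mu.-integrable D h.
  apply: eq_integrable (integrableB mD ihC (integrable_cstr C)) => // x _ /=.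
  by rewrite addeK.
by move=> /(integral_fune_fin_num mD); rewrite ioo.
Qed.

(** Fatou's lemma applied to [h n + C]; the finite quantity [C * mu D] is then cancelled. *)
Lemma fatou_lb (h : nat -> T -> \bar R) (g : T -> \bar R) (C : R) : (0 <= C)%R ->
  (forall n, measurable_fun D (h n)) -> measurable_fun D g ->
  (forall n x, D x -> (- C)%:E <= h n x) -> (forall x, D x -> (- C)%:E <= g x) ->
  {ae mu, forall x, D x -> g x <= limn_einf (h ^~ x)} ->
  \int[mu]_(x in D) g x <= limn_einf (fun n => \int[mu]_(x in D) h n x).
Proof.
move=> C0 mh mg hC gC gh.
have CD : C%:E * mu D \is a fin_num by rewrite fin_numM// ge0_fin_numE.
have ge0 (k : T -> \bar R) x : (- C)%:E <= k x -> 0 <= k x + C%:E.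
  by rewrite EFinN => H; rewrite -[leLHS](subee (x := C%:E))// addeC leeD2r.
rewrite -(leeD2rE _ _ CD) -integral_shift// [leRHS]addeC -limn_einf_shift//.
rewrite (_ : (fun n => _) = fun n => \int[mu]_(x in D) (h n x + C%:E)); last first.
  by apply/funext => n; rewrite addeC [RHS]integral_shift// => x; exact: hC.
have mhC k : measurable_fun D k -> measurable_fun D (fun x => k x + C%:E).
  by move=> mk; apply: emeasurable_funD => //; exact: measurable_cst.
apply: le_trans (@fatou _ _ _ mu D mD (fun n x => h n x + C%:E) _ _); last 2 first.
- by move=> n; exact: mhC.
- by move=> n x Dx; apply: ge0; exact: hC.
apply: ae_ge0_le_integral => //.
- by move=> x Dx; apply: ge0; exact: gC.
- exact: mhC.
- move=> x Dx; apply: (le_trans _ (le_limn_einf (a := cst 0) _)) => [|n].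
    by have [-> _] := cvg_limn_einf_sup (cvg_cst (0 : \bar R)).
  by apply: ge0; exact: hC.
- apply: measurableT_comp => //; apply: measurable_fun_limn_esup => n.
  by apply: measurableT_comp => //; exact: mhC.
- apply: filterS gh => x H Dx; rewrite (_ : (fun n => _) = fun n => C%:E + h n x); last first.
    by apply/funext => n; rewrite addeC.
  by rewrite limn_einf_shift// addeC leeD2l// H.
Qed.

End bounded_below.

Section extended_limits.
Context (R : realType).
Local Open Scope ereal_scope.

Lemma lt_ereal_dense (x : R) (y : \bar R) : x%:E < y -> exists2 b : R, (x < b)%R & b%:E < y.
Proof.
case: y => [y| |]//; last by exists (x + 1)%R; rewrite ?ltrDl// ltry.
by rewrite lte_fin => xy; exists ((x + y) / 2)%R; rewrite ?lte_fin; lra.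
Qed.

(** Finiteness of [b] and [c] is not known in advance. Any reals below them satisfy the inequality
    in the limit; letting one vary with the other fixed bounds [b], then [c], by real numbers. *)
Lemma sum_limn_einf_le (a_ : nat -> R) (a t : R) (b_ c_ : (\bar R)^nat) (b c : \bar R) :
  a_ @ \oo --> a -> b <= limn_einf b_ -> c <= limn_einf c_ -> b != -oo -> c != -oo ->
  (forall n, (a_ n)%:E + b_ n + c_ n <= (t + n.+1%:R^-1)%:E) ->
  a%:E + b + c <= t%:E.
Proof.
move=> aa bb cc b0 c0 H.
have key (be ga : R) : be%:E < b -> ga%:E < c -> (a + be + ga <= t)%R.
  move=> /lt_le_trans/(_ bb)/limn_einf_eventually[N1 H1].
  move=> /lt_le_trans/(_ cc)/limn_einf_eventually[N2 H2].
  have cv : (a_ n + be + ga - n.+1%:R^-1)%R @[n --> \oo] --> (a + be + ga - 0)%R.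
    apply: cvgB; last exact: cvg_harmonic.
    by apply: cvgD; [apply: cvgD => //; exact: cvg_cst|exact: cvg_cst].
  rewrite subr0 in cv; apply: (cvgr_to_le cv).
  exists (maxn N1 N2) => // n /=; rewrite geq_max => /andP[n1 n2].
  rewrite lerBlDr -lee_fin; apply: le_trans (H n); rewrite !EFinD.
  by apply: leeD; [apply: leeD => //; exact: H1|exact: H2].
have lb (y : \bar R) : y != -oo -> exists x : R, x%:E < y.
  case: y => // [y _|_]; last by exists 0%R; rewrite ltry.
  by exists (y - 1)%R; rewrite lte_fin ltrBlDr ltrDl.
have [be0 be0b] := lb _ b0; have [ga0 ga0c] := lb _ c0.
have keyb (ga : R) : ga%:E < c -> b <= (t - a - ga)%:E.
  move=> gc; rewrite leNgt; apply/negP => /lt_ereal_dense[be H1 H2].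
  by have := key _ _ H2 gc; lra.
have bfin : b \is a fin_num.
  by rewrite fin_numE b0 -ltey (le_lt_trans (keyb _ ga0c))// ltry.
have keyc : c <= (t - a - fine b)%:E.
  rewrite leNgt; apply/negP => /lt_ereal_dense[ga H1 /keyb].
  by rewrite -[b]fineK// lee_fin; lra.
have cfin : c \is a fin_num by rewrite fin_numE c0 -ltey (le_lt_trans keyc)// ltry.
move: keyc; rewrite -[in leLHS](fineK cfin) lee_fin => keyc.
by rewrite -(fineK bfin) -(fineK cfin) -!EFinD lee_fin; lra.
Qed.

End extended_limits.

Section potential_compactness.
Context (R : realType) (d : nat).
Notation E := 'rV[R]_d.

Definition rat_pt (n : nat) : E :=
  if unpickle n is Some v then map_mx ratr (v : 'rV[rat]_d) else 0.

Lemma rat_pt_dense (v : E) (e : R) : 0 < e -> exists n, `|v - rat_pt n| <= e.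
Proof.
move=> e0.
have : forall i, exists a : rat, `|v ord0 i - ratr a| <= e.
  move=> i; have [a] := @rat_in_itvoo R (v ord0 i) (v ord0 i + e) (ltac:(lra)).
  rewrite in_itv/= => /andP[]; set t := ratr a => h1 h2; exists a.
  by rewrite ler_norml -/t; lra.
move=> /choice[a Ha]; exists (pickle (\row_i a i)); rewrite /rat_pt pickleK.
apply: mx_norm_le; first exact: ltW.
by move=> i j; rewrite !mxE (ord1 i); exact: Ha.
Qed.

Context (Lam : set E) (M : R).
Hypothesis LM : forall y, Lam y -> `|y| <= M.
Hypothesis M0 : 0 <= M.

(** The value 0 at the origin is the counterpart of [inf l = 0] ([kpot0]); it bounds the values
    pointwise and makes conjugates nonnegative. *)
Definition potential (k : E -> R) := supp_lip Lam k /\ k 0 = 0.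

Let L := (1 * d)%:R * M.
Let L0 : 0 <= L.
Proof. exact: mulr_ge0. Qed.

Lemma potential_lip k : potential k -> forall v w, `|k (v + w) - k v| <= L * `|w|.
Proof. by move=> [sk _]; exact: (supp_lip_lipschitz LM). Qed.

Lemma potential_le k v : potential k -> `|k v| <= L * `|v|.
Proof. by move=> pk; have := potential_lip pk 0 v; rewrite add0r pk.2 subr0. Qed.

Lemma potential_continuous k : potential k -> continuous k.
Proof. by move=> pk; exact: (lipschitz_continuous (potential_lip pk)). Qed.

(** Values at points and coefficients form one bounded family indexed by [E + I], with a cluster
    point by Tychonoff. Agreement at rational points and the common Lipschitz constant turn it into
    pointwise convergence. The selected indices satisfy only [n <= s n], which is enough for
    minimising sequences. *)
Lemma potential_compact (I : finType) (k_ : nat -> E -> R) (c_ : nat -> I -> R) (B : R) :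
  (forall n, potential (k_ n)) -> (forall n i, `|c_ n i| <= B) ->
  exists k c (s : nat -> nat), [/\ forall n, (n <= s n)%N, potential k,
    forall v, k_ (s n) v @[n --> \oo] --> k v &
    forall i, c_ (s n) i @[n --> \oo] --> (c i : R)].
Proof.
move=> pk cB.
pose h n (x : E + I) := match x with inl v => k_ n v | inr i => c_ n i end.
pose b (x : E + I) := match x with inl v => L * `|v| | inr i => B end.
have [|hb Hb] := @seq_cluster R (E + I)%type h b.
  by move=> n [v|i] /=; [exact: potential_le|exact: cB].
pose k v := hb (inl v); pose c i := hb (inr i).
(* At stage [n] closeness is asked at the first [n] rational points and for all coefficients. *)
pose l n : seq (E + I) := [seq inl (rat_pt j) | j <- iota 0 n] ++ [seq inr i | i <- enum I].
have : forall n, exists m, (n <= m)%N /\ forall x, x \in l n -> `|hb x - h m x| < n.+1%:R^-1.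
  move=> n; have [|m nm H] := Hb (l n) n.+1%:R^-1 n; first by rewrite invr_gt0.
  by exists m.
move=> /choice[s Hs].
have pkk : potential k.
  have app (x : seq E) (e : R) : 0 < e -> exists m, forall v, v \in x -> `|k v - k_ m v| < e.
    move=> e0; have [m _ H] := Hb [seq inl v | v <- x] e 0%N e0; exists m => v vx.
    by have := H (inl v) (map_f _ vx).
  split=> [v w t Ht|].
    apply/ler_addgt0Pr => e e0.
    have [m Hm] := app [:: v; v + w] (e / 2) (ltac:(lra)).
    have := Hm v; have := Hm (v + w); rewrite !inE !eqxx orbT !ltr_norml => /(_ isT) h1 /(_ isT) h2.
    by have := (pk m).1 v w t Ht; lra.
  apply/eqP; rewrite -normr_le0; apply/ler_addgt0Pr => e e0; rewrite add0r.
  have [m Hm] := app [:: 0] e e0; have := Hm 0; rewrite inE eqxx => /(_ isT).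
  by rewrite (pk m).2 subr0 => /ltW.
have inv0 (e : R) : 0 < e -> \forall n \near \oo, n.+1%:R^-1 < e.
  by move=> e0; exact: (near_infty_natSinv_lt (PosNum e0)).
exists k, c, s; split=> //.
- by move=> n; have [] := Hs n.
- move=> v; apply/cvgrPdist_le => e e0.
  have e1 : 0 < e / (3 * (L + 1)) by rewrite divr_gt0// mulr_gt0// ltr_wpDl.
  have [j Hj] := rat_pt_dense v e1.
  have e3 : 0 < e / 3 by rewrite divr_gt0.
  have [N _ HN] := inv0 _ e3.
  exists (maxn N j.+1) => // n /=; rewrite geq_max => /andP[Nn jn].
  have [_ Hn] := Hs n.
  have : `|k (rat_pt j) - k_ (s n) (rat_pt j)| < n.+1%:R^-1.
    apply: (Hn (inl (rat_pt j))); rewrite mem_cat; apply/orP; left.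
    by apply: (map_f (fun j => inl (rat_pt j))); rewrite mem_iota.
  have := HN n Nn; rewrite /=; set t := n.+1%:R^-1 => te tk.
  have lip k' : potential k' -> `|k' v - k' (rat_pt j)| <= e / 3.
    move=> pk'; have := potential_lip pk' (rat_pt j) (v - rat_pt j); rewrite subrKC.
    move/le_trans; apply; apply: (@le_trans _ _ (L * (e / (3 * (L + 1))))).
      by rewrite ler_wpM2l.
    have -> : L * (e / (3 * (L + 1))) = e / 3 * (L / (L + 1)).
      by field; rewrite gt_eqF// ltr_wpDl.
    rewrite -[leRHS]mulr1 ler_wpM2l ?(ltW e3)//.
    by rewrite ler_pdivrMr ?ltr_wpDl// mul1r lerDl.
  have := lip _ pkk; have := lip _ (pk (s n)); move: tk; rewrite ltr_norml !ler_norml.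
  by move: te; clear; lra.
- move=> i; apply/cvgrPdist_le => e e0; have [N _ HN] := inv0 _ e0.
  exists N => // n /= Nn; have [_ Hn] := Hs n.
  have := Hn (inr i); rewrite mem_cat => H.
  apply: ltW; apply: lt_trans (HN n Nn); apply: H.
  by rewrite (map_f inr) ?mem_enum// orbT.
Qed.

End potential_compactness.

(** * The dual problem *)

Section conjugate_growth.
Context (R : realType) (d : nat).
Notation Mx := 'M[R]_d.
Context (f : Mx -> R).
Local Open Scope ereal_scope.

Lemma conjugate_ge (xi : Mx) : (- f 0%R)%:E <= conjugate f xi.
Proof.
have := legendre_ge (EFin \o f) 0%R xi.
by rewrite dotC dot0r /= add0e EFinN.
Qed.

Lemma measurable_conjugate : measurable_fun setT (conjugate f).
Proof. exact: measurable_legendre. Qed.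

(* Testing the conjugate at [M] times the matrix of signs of [xi]. *)
Lemma conjugate_coercive (M C : R) : (0 <= M)%R ->
  (forall x : Mx, (forall i j, `|x i j| <= M)%R -> (f x <= C)%R) ->
  forall xi : Mx, (M * (\sum_(p : 'I_d * 'I_d) `|xi p.1 p.2|) - C)%:E <= conjugate f xi.
Proof.
move=> M0 fC xi.
pose x : Mx := \matrix_(i, j) (M * Num.sg (xi i j))%R.
apply: le_trans (legendre_ge (EFin \o f) x xi); rewrite /= -EFinB lee_fin.
have -> : (dot x xi = M * (\sum_(p : 'I_d * 'I_d) `|xi p.1 p.2|))%R.
  rewrite /dot pair_bigA/= mulr_sumr; apply: eq_bigr => p _.
  by rewrite mxE -mulrA -normrEsg.
rewrite lerB// fC// => i j; rewrite mxE normrM ger0_norm// ler_piMr//.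
by rewrite normr_sg; case: eqP => _ /=; rewrite ?lexx ?ler01.
Qed.

Lemma growth_bounded (p c b : R) : (0 < p)%R -> (0 <= c)%R ->
  (forall xi, f xi <= c * enorm xi `^ p / p + b)%R ->
  forall M : R, exists C : R, forall x : Mx, (forall i j, `|x i j| <= M)%R -> (f x <= C)%R.
Proof.
move=> p0 c0 fc M; exists (c * ((d * d)%:R * Num.max M 0) `^ p / p + b)%R => x xM.
apply: le_trans (fc x) _; rewrite lerD2r ler_pM2r ?invr_gt0// ler_wpM2l//.
rewrite ge0_ler_powR ?nnegrE ?enorm_ge0 ?(ltW p0)// ?mulr_ge0// ?le_max ?lexx ?orbT//.
apply: le_trans (enorm_le_norm x) _; rewrite ler_wpM2l//.
apply: mx_norm_le => [|i j]; first by rewrite le_max lexx orbT.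
by rewrite le_max xM.
Qed.

End conjugate_growth.

Section dual_problem.
Context (R : realType) (d : nat).
Notation E := 'rV[R]_d.
Notation Mx := 'M[R]_d.
Notation leb := (lebesgue_rV R d).
Context (Omega Lambda : set E) (q M : R) (f : Mx -> R) (S : set (E -> Mx)) (F : E -> E).
Hypothesis d_gt0 : (0 < d)%N.
Hypothesis oO : open Omega.
Hypothesis bO : bounded_set Omega.
Hypothesis oL : open Lambda.
Hypothesis bL : bounded_set Lambda.
Hypothesis cL : convex_set (Lambda : set (convex_lmodType E)).
Hypothesis L0 : Lambda 0.
Hypothesis LM : forall y, Lambda y -> `|y| <= M.
Hypothesis vol : leb Omega = leb Lambda.
Hypothesis q1 : 1 <= q.
Hypothesis SW : S `<=` W01q Omega q.
Hypothesis S_closed : closed_in_W01q Omega q S.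
Hypothesis S_fin : finite_dimensional Omega S.
Hypothesis f_bdd : forall m : R, exists C : R, forall x : Mx,
  (forall i j, `|x i j| <= m) -> f x <= C.
Hypothesis mF : measurable_fun Omega F.
Hypothesis iF : forall j, leb.-integrable Omega (EFin \o (fun x => F x ord0 j)).
Implicit Types (k : E -> R) (l g : E -> \bar R) (phi : E -> Mx).
Local Open Scope ereal_scope.

Notation G phi x := (F x + wdiv Omega phi x)%R.

Let mO : measurable Omega := measurable_open oO.
Let mL : measurable Lambda := measurable_open oL.
Let Ooo : leb Omega < +oo := leb_bounded_lty bO mO.
Let Loo : leb Lambda < +oo := leb_bounded_lty bL mL.
Let M0 : (0 <= M)%R. Proof. by have := LM L0; rewrite normr0. Qed.

Let LL : R := ((1 * d)%:R * M)%R.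
Let LL0 : (0 <= LL)%R. Proof. exact: mulr_ge0. Qed.

Let cst_int := integrable_cstr mO Ooo.

Definition norm1 (v : E) : R := \sum_j `|v ord0 j|.

Lemma norm_le_norm1 v : (`|v| <= norm1 v)%R.
Proof.
apply: mx_norm_le => [|i j]; first by apply: sumr_ge0.
by rewrite (ord1 i) /norm1 (bigD1 j)//= lerDl sumr_ge0.
Qed.

Lemma measurable_G phi : measurable_fun Omega (fun x => G phi x).
Proof.
apply: measurable_fun_mx => // i j; under eq_fun do rewrite mxE.
apply: measurable_funD; first exact: measurable_mx_entry.
by apply: measurable_mx_entry; exact: measurable_wdiv.
Qed.

Lemma integrable_norm1 (H : E -> E) :
  (forall j, leb.-integrable Omega (EFin \o (fun x => H x ord0 j))) ->
  leb.-integrable Omega (EFin \o (fun x => norm1 (H x))).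
Proof.
move=> iH.
rewrite (_ : _ \o _ = EFin \o (fun x => \sum_(j < d) 1 * `|H x ord0 j|)%R).
  apply: integrable_EFin_sum => // j; have := integrable_abse (iH j).
  exact.
by apply/funext => x /=; congr EFin; apply: eq_bigr => j _; rewrite mul1r.
Qed.

Lemma integrable_G phi j : S phi ->
  leb.-integrable Omega (EFin \o (fun x => (G phi x) ord0 j)).
Proof.
move=> Sphi; rewrite (_ : _ \o _ = (EFin \o (fun x => F x ord0 j)) \+
    (EFin \o (fun x => wdiv Omega phi x ord0 j))).
  apply: integrableD => //; exact: (S_wdiv_integrable oO bO q1 SW ord0 j Sphi).
by apply/funext => x; rewrite /= mxE EFinD.
Qed.

Lemma integrable_dominated (h : E -> R) (H : E -> E) (C : R) :
  measurable_fun Omega h -> leb.-integrable Omega (EFin \o (fun x => norm1 (H x))) ->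
  (0 <= C)%R -> (forall x, (`|h x| <= C * `|H x|)%R) -> leb.-integrable Omega (EFin \o h).
Proof.
move=> mh iH C0 hH; apply: (le_integrable mO _ _ (integrableZl mO C iH)).
  exact/measurable_EFinP.
move=> x _; rewrite lee_fin.
apply: le_trans (hH x) _; apply: le_trans (ler_norm _).
by rewrite ler_wpM2l// norm_le_norm1.
Qed.

Lemma potential_measurable k (H : E -> E) : potential Lambda k ->
  measurable_fun Omega H -> measurable_fun Omega (fun x => k (H x)).
Proof.
move=> pk mH; apply: (@measurableT_comp _ _ _ _ _ _ k) => //.
exact: continuous_measurable_mx (potential_continuous LM pk).
Qed.

Lemma potential_integrable k (H : E -> E) : potential Lambda k ->
  measurable_fun Omega H ->
  (forall j, leb.-integrable Omega (EFin \o (fun x => H x ord0 j))) ->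
  leb.-integrable Omega (EFin \o (fun x => k (H x))).
Proof.
move=> pk mH iH; apply: (integrable_dominated _ (integrable_norm1 iH) LL0).
  exact: potential_measurable.
by move=> x; exact: (potential_le LM).
Qed.

Lemma measurable_conjugate_comp phi : measurable_fun Omega phi ->
  measurable_fun Omega (fun x => conjugate f (phi x)).
Proof. by move=> mphi; exact: measurableT_comp (measurable_conjugate f) mphi. Qed.

Lemma conjugate_integral phi : measurable_fun Omega phi ->
  leb.-integrable Omega (fun x => conjugate f (phi x)) \/
  \int[leb]_(x in Omega) conjugate f (phi x) = +oo.
Proof.
move=> mphi; apply: (@integrable_or_pinfty _ _ _ leb Omega mO Ooo _ (- f 0)%R).
  exact: measurable_conjugate_comp.
by move=> x _; exact: conjugate_ge.
Qed.

Section admissible.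
Context k l phi.
Hypothesis A0klphi : A0 Lambda S k l phi.

Lemma A0_ge0 y : Lambda y -> 0 <= l y.
Proof.
case: A0klphi => _ _ [_ _ _ _ [il _]] Ly; rewrite -il.
by apply: ereal_inf_lbound; exists y.
Qed.

Lemma A0_fin y : Lambda y -> l y \is a fin_num.
Proof. by case: A0klphi => _ _ [_ _ _ [H _] _] /H. Qed.

Lemma A0_kpot_potential : potential Lambda (kpot Lambda l).
Proof.
split; first exact: (kpot_supp_lip LM A0_ge0 L0 (A0_fin L0)).
by apply: (kpot0 LM A0_ge0 L0 (A0_fin L0)); case: A0klphi => _ _ [_ _ _ _ []].
Qed.

Lemma A0_kpot_le v : (kpot Lambda l v <= k v)%R.
Proof.
case: A0klphi => _ _ [_ _ _ _ [_ H]].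
rewrite -lee_fin -[leLHS]/((EFin \o kpot Lambda l) v).
rewrite (kpotE LM A0_ge0 L0 (A0_fin L0)); apply: legendre_le => y.
rewrite /ext_infty; case: ifPn => [|_]; last by rewrite leNye.
rewrite inE => Ly; rewrite leeBlDr ?A0_fin//; apply: H; exact: subset_closure.
Qed.

Lemma A0_J_ge :
  \int[leb]_(x in Omega) (kpot Lambda l (G phi x))%:E + \int[leb]_(y in Lambda) l y +
    \int[leb]_(x in Omega) conjugate f (phi x) <= J Omega Lambda f F k l phi.
Proof.
case: A0klphi => Sphi mk _; rewrite /J; do 2 apply: leeD => //.
apply: le_integral_integrable => //.
- apply: potential_integrable; [exact: A0_kpot_potential|exact: measurable_G|].
  by move=> j; exact: integrable_G.
- by apply/measurable_EFinP; exact: (measurableT_comp mk (measurable_G phi)).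
- by move=> x _; rewrite lee_fin A0_kpot_le.
Qed.

End admissible.

Section canonical.
Context (g : E -> \bar R) (phi : E -> Mx).
Hypothesis g_ge0 : forall y, Lambda y -> 0 <= g y.
Hypothesis g_fin : forall y, Lambda y -> g y \is a fin_num.
Hypothesis g_inf : ereal_inf (g @` Lambda) = 0.
Hypothesis mg : measurable_fun Lambda g.
Hypothesis Sphi : S phi.

Let k0 := kpot Lambda g.

Lemma kpot_potential : potential Lambda k0.
Proof.
split; first exact: (kpot_supp_lip LM g_ge0 L0 (g_fin L0)).
exact: (kpot0 LM g_ge0 L0 (g_fin L0) g_inf).
Qed.

Let l0_le y : Lambda y -> legendre (EFin \o k0) y <= g y.
Proof. exact: (legendre_kpot_le LM g_ge0 L0 (g_fin L0)). Qed.

Let l0_ge0 y : 0 <= legendre (EFin \o k0) y.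
Proof. exact: (legendre_ge0 kpot_potential.2). Qed.

Let l0_fin y : Lambda y -> legendre (EFin \o k0) y \is a fin_num.
Proof.
move=> Ly; rewrite ge0_fin_numE//; apply: le_lt_trans (l0_le Ly) _.
by move: (g_fin Ly) (g_ge0 Ly); case: (g y) => // r _ _; rewrite ltry.
Qed.

Lemma kpot_A0 : A0 Lambda S k0 (legendre (EFin \o k0)) phi.
Proof.
split=> //.
  exact: continuous_measurable_mx (potential_continuous LM kpot_potential).
split.
- exact: measurable_legendre.
- by move=> y; rewrite -ltNye (lt_le_trans _ (l0_ge0 y)).
- move=> y; apply: (legendre_out cL _ bL kpot_potential.1); by exists 0%R.
- split; first exact: l0_fin.
  exact: legendre_continuous.
- split; last by move=> y v _; exact: (fenchel_young y v kpot_potential.2).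
  apply/eqP; rewrite eq_le; apply/andP; split.
    rewrite -g_inf; apply: le_ereal_inf_tmp => _ [y Ly <-].
    by apply: le_trans (l0_le Ly); apply: ereal_inf_lbound; exists y.
  by apply: le_ereal_inf_tmp => _ [y Ly <-].
Qed.

Lemma kpot_J_le :
  J Omega Lambda f F k0 (legendre (EFin \o k0)) phi <=
  \int[leb]_(x in Omega) (k0 (G phi x))%:E + \int[leb]_(y in Lambda) g y +
    \int[leb]_(x in Omega) conjugate f (phi x).
Proof.
rewrite /J; apply: leeD => //; apply: leeD => //.
apply: ge0_le_integral => //.
exact: measurable_funTS (measurable_legendre _).
Qed.

(** [k0] is recovered from its conjugate on the open set [Lambda] alone; the boundary values do not
    contribute. Perturbations of [l0] can then be made on [Lambda] only. *)
Lemma kpot_legendre_kpot : kpot Lambda (legendre (EFin \o k0)) = k0.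
Proof.
apply/funext => v; apply/eqP; rewrite eq_le (A0_kpot_le kpot_A0)/=.
have E1 : (k0 v)%:E = legendre (ext_infty Lambda g) v.
  by rewrite -(kpotE LM g_ge0 L0 (g_fin L0)).
have E2 : (kpot Lambda (legendre (EFin \o k0)) v)%:E =
    legendre (ext_infty Lambda (legendre (EFin \o k0))) v.
  by rewrite -(kpotE LM (fun y _ => l0_ge0 y) L0 (l0_fin L0)).
rewrite -lee_fin E1 E2; apply: legendreS => y.
by rewrite /ext_infty; case: ifPn => //; rewrite inE; exact: l0_le.
Qed.

End canonical.

(** The slope [m] is arbitrary because [f] is bounded on every bounded set; this superlinear growth
    will absorb the linear loss in the potential term. *)
Let energy_coercive (m : R) : (0 <= m)%R -> exists C : R, forall phi, S phi ->
  m%:E * \int[leb]_(x in Omega) (\sum_(p : 'I_d * 'I_d) `|phi x p.1 p.2|)%:E + C%:E <=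
  \int[leb]_(x in Omega) conjugate f (phi x).
Proof.
move=> m0; have [C HC] := f_bdd m.
exists (- C * fine (leb Omega))%R => phi Sphi.
have mphi := S_measurable SW Sphi.
have iN : leb.-integrable Omega (EFin \o (fun x => \sum_(p : 'I_d * 'I_d) 1 * `|phi x p.1 p.2|)%R).
  apply: integrable_EFin_sum => // p; have := integrable_abse (S_integrable oO bO q1 SW p.1 p.2 Sphi).
  exact.
have EN : EFin \o (fun x => \sum_(p : 'I_d * 'I_d) 1 * `|phi x p.1 p.2|)%R =
    (fun x => (\sum_(p : 'I_d * 'I_d) `|phi x p.1 p.2|)%:E).
  by apply/funext => x /=; congr EFin; apply: eq_bigr => j _; rewrite mul1r.
rewrite EN in iN.
have -> : m%:E * \int[leb]_(x in Omega) (\sum_(p : 'I_d * 'I_d) `|phi x p.1 p.2|)%:E +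
    (- C * fine (leb Omega))%:E =
    \int[leb]_(x in Omega) (m%:E * (\sum_(p : 'I_d * 'I_d) `|phi x p.1 p.2|)%:E + (- C)%:E).
  rewrite integralD//; last exact: integrableZl.
  rewrite integralZl//; congr (_ + _).
  by rewrite integral_cst// EFinM fineK// ge0_fin_numE.
apply: le_integral_integrable => //.
- by apply: integrableD => //; exact: integrableZl.
- exact: measurable_conjugate_comp.
- move=> x _; apply: le_trans (conjugate_coercive m0 HC (phi x)).
  by rewrite EFinN EFinB EFinM.
Qed.

(** * A priori bound on the coefficients *)

Section coefficients.
Context (n : nat) (s : 'I_n -> E -> Mx).
Hypothesis Ss : forall i, S (s i).

Let D i : R := fine (\int[leb]_(x in Omega) (norm1 (wdiv Omega (s i) x))%:E).
Let AF : R := fine (\int[leb]_(x in Omega) (norm1 (F x))%:E).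

Let iD i : leb.-integrable Omega (EFin \o (fun x => norm1 (wdiv Omega (s i) x))).
Proof. by apply: integrable_norm1 => j; exact: (S_wdiv_integrable oO bO q1 SW ord0 j (Ss i)). Qed.

Let iAF : leb.-integrable Omega (EFin \o (fun x => norm1 (F x))).
Proof. exact: integrable_norm1. Qed.

Let norm1_ge0 v : (0 <= norm1 v)%R. Proof. exact: sumr_ge0. Qed.

(** Integrable majorant of [|k (G phi x)|], common to all potentials [k]: [LL] is their Lipschitz
    constant, and [c] the coefficients of [phi]. *)
Definition dominating (c : 'I_n -> R) x : R :=
  LL * (norm1 (F x) + \sum_i `|c i| * norm1 (wdiv Omega (s i) x)).

Lemma integrable_dominating c : leb.-integrable Omega (EFin \o dominating c).
Proof.
rewrite (_ : _ \o _ = (fun x => LL%:E * ((EFin \o (fun x => norm1 (F x))) x +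
    (EFin \o (fun x => \sum_i `|c i| * norm1 (wdiv Omega (s i) x))%R) x))).
  apply: integrableZl => //; apply: integrableD => //.
  exact: integrable_EFin_sum.
by apply/funext => x.
Qed.

Lemma integral_dominating c : \int[leb]_(x in Omega) (dominating c x)%:E =
  (LL * (AF + \sum_i `|c i| * D i))%:E.
Proof.
transitivity (\int[leb]_(x in Omega) (LL%:E * ((EFin \o (fun x => norm1 (F x))) x +
    (EFin \o (fun x => \sum_i `|c i| * norm1 (wdiv Omega (s i) x))%R) x))).
  by apply: eq_integral => x _.
have i2 := integrable_EFin_sum mO (fun i => `|c i|%R) iD.
rewrite integralZl//; last exact: integrableD.
rewrite [RHS]EFinM; congr (_ * _); rewrite integralD// [RHS]EFinD; congr (_ + _).
  by rewrite fineK//; apply: integrable_fin_num => //; exact: iAF.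
rewrite (integral_EFin_sum mO (fun i => `|c i|%R) iD) -sumEFin; apply: eq_bigr => i _.
by rewrite EFinM fineK//; apply: integrable_fin_num => //; exact: iD.
Qed.

Lemma potential_dominated c phi : S phi -> ae_comb Omega c s phi ->
  {ae leb, forall x, Omega x -> forall k, potential Lambda k ->
    (`|k (G phi x)| <= dominating c x)%R}.
Proof.
move=> Sphi cphi.
have := wdiv_ae_comb oO (S_W1q SW Sphi) (fun i => S_W1q SW (Ss i)) cphi.
apply: filterS => x H Ox k pk; apply: le_trans (potential_le LM _ pk) _.
rewrite ler_wpM2l// H//; apply: le_trans (ler_normD _ _) _.
apply: lerD; first exact: norm_le_norm1.
apply: le_trans (ler_norm_sum _ _ _) _; apply: ler_sum => i _.
by rewrite normrZ ler_wpM2l// norm_le_norm1.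
Qed.

Lemma dual_coercive (alpha : R) : (0 < alpha)%R ->
  (forall c phi, ae_comb Omega c s phi -> measurable_fun Omega phi ->
    (alpha * \sum_i `|c i|)%:E <=
      \int[leb]_(x in Omega) (\sum_(p : 'I_d * 'I_d) `|phi x p.1 p.2|)%:E) ->
  exists C : R, forall k c phi, potential Lambda k -> S phi -> ae_comb Omega c s phi ->
    (\sum_i `|c i| - C)%:E <=
    \int[leb]_(x in Omega) (k (G phi x))%:E + \int[leb]_(x in Omega) conjugate f (phi x).
Proof.
move=> a0 Ha; pose DD := (\sum_i D i)%R.
have D0 i : (0 <= D i)%R by apply: fine_ge0; apply: integral_ge0 => x _; rewrite lee_fin.
have DD0 : (0 <= DD)%R by apply: sumr_ge0.
(* The potential term loses at most [LL * DD] times the sum of the [|c_i|], up to a constant. With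
   this slope the energy gains [LL * DD + 1] times that sum, which leaves a surplus of slope one. *)
pose m := ((LL * DD + 1) / alpha)%R.
have m0 : (0 <= m)%R by rewrite divr_ge0 ?(ltW a0)// addr_ge0// mulr_ge0.
have [C HC] := energy_coercive m0.
exists (LL * AF - C)%R => k c phi pk Sphi cphi.
have mphi := S_measurable SW Sphi.
have ik := potential_integrable pk (measurable_G phi) (fun j => integrable_G j Sphi).
have B1 : (- (LL * (AF + \sum_i `|c i| * D i)))%:E <= \int[leb]_(x in Omega) (k (G phi x))%:E.
  have : `| \int[leb]_(x in Omega) (k (G phi x))%:E | <= (LL * (AF + \sum_i `|c i| * D i))%:E.
    rewrite -integral_dominating.
    apply: le_trans (le_abse_integral _ mO _) _; first by case/integrableP: ik.
    apply: ae_ge0_le_integral => //.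
    - by apply: measurableT_comp => //; case/integrableP: ik.
    - move=> x _; rewrite lee_fin mulr_ge0// addr_ge0// sumr_ge0// => i _.
      by rewrite mulr_ge0.
    - by case/integrableP: (integrable_dominating c).
    - apply: filterS (potential_dominated Sphi cphi) => x H Ox.
      by rewrite lee_fin; exact: H.
  have kfin : \int[leb]_(x in Omega) (k (G phi x))%:E \is a fin_num.
    by apply: integrable_fin_num => //; exact: ik.
  by rewrite -(fineK kfin) !lee_fin ler_norml => /andP[].
have B2 := HC phi Sphi.
have B3 : (m * (alpha * \sum_i `|c i|) + C)%:E <=
    \int[leb]_(x in Omega) conjugate f (phi x).
  apply: le_trans B2; rewrite EFinD EFinM leeD2r// lee_wpmul2l ?lee_fin//.
  exact: Ha.
apply: le_trans (leeD B1 B3); rewrite -EFinD lee_fin.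
have -> : (m * (alpha * \sum_i `|c i|) = (LL * DD + 1) * \sum_i `|c i|)%R.
  by rewrite mulrA divfK// gt_eqF.
have : (\sum_i `|c i| * D i <= DD * \sum_i `|c i|)%R.
  rewrite mulr_sumr; apply: ler_sum => i _; rewrite mulrC ler_wpM2r//.
  by rewrite /DD (bigD1 i)//= lerDl sumr_ge0.
move/(ler_wpM2l LL0); set X := (\sum_i `|c i| * D i)%R; set Y := (\sum_i `|c i|)%R.
by move=> h; nra.
Qed.

End coefficients.

(** Turns a limit of potentials into an admissible pair. The infimum [c] of its conjugate is
    subtracted from [l], which raises [k] by at most [c]; the two effects on [J] cancel since the
    volumes are equal. Conjugating twice then gives the fixed-point relations. *)
Lemma normalized_potential k phi : potential Lambda k -> S phi ->
  \int[leb]_(y in Lambda) legendre (EFin \o k) y < +oo ->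
  exists k0, [/\ potential Lambda k0, legendre (legendre (EFin \o k0)) = EFin \o k0,
    kpot Lambda (legendre (EFin \o k0)) = k0, A0 Lambda S k0 (legendre (EFin \o k0)) phi &
    J Omega Lambda f F k0 (legendre (EFin \o k0)) phi <=
    \int[leb]_(x in Omega) (k (G phi x))%:E + \int[leb]_(y in Lambda) legendre (EFin \o k) y +
    \int[leb]_(x in Omega) conjugate f (phi x)].
Proof.
move=> pk Sphi lkoo; set lk := legendre (EFin \o k).
have lk0 y : 0 <= lk y by exact: (legendre_ge0 pk.2).
have lkf y : Lambda y -> lk y \is a fin_num.
  by apply: (legendre_finite oL mL) => // z _; exact: lk0.
have mlk : measurable_fun Lambda lk by exact: measurable_funTS (measurable_legendre _).
pose c := ereal_inf (lk @` Lambda).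
have c_ge0 : 0 <= c by apply: le_ereal_inf_tmp => _ [y _ <-].
have cfin : c \is a fin_num.
  rewrite ge0_fin_numE//; apply: (@le_lt_trans _ _ (lk 0%R)).
    by apply: ereal_inf_lbound; exists 0%R.
  by rewrite -ge0_fin_numE// lkf.
pose cr := fine c; have cE : c = cr%:E by rewrite /cr fineK.
pose g y := lk y - cr%:E.
have g_ge0 y : Lambda y -> 0 <= g y.
  move=> Ly; rewrite /g -cE; have := lkf _ Ly => lf.
  by rewrite sube_ge0 ?cfin ?orbT//; apply: ereal_inf_lbound; exists y.
have g_fin y : Lambda y -> g y \is a fin_num.
  by move=> Ly; rewrite /g fin_numB lkf.
have g_inf : ereal_inf (g @` Lambda) = 0.
  apply/eqP; rewrite eq_le; apply/andP; split; last first.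
    by apply: le_ereal_inf_tmp => _ [y Ly <-]; exact: g_ge0.
  apply/lee_addgt0Pr => e e0; rewrite add0e.
  have [_ [y Ly <-] ylt] := lb_ereal_inf_adherent e0 cfin.
  apply: (@le_trans _ _ (g y)); first by apply: ereal_inf_lbound; exists y.
  by rewrite /g leeBlDr// addeC -cE ltW.
have mg : measurable_fun Lambda g.
  by apply: emeasurable_funB => //; exact: measurable_cst.
have pk0 := kpot_potential g_ge0 g_fin g_inf.
have k0k v : (kpot Lambda g v <= k v + cr)%R.
  rewrite -lee_fin -[leLHS]/((EFin \o kpot Lambda g) v).
  rewrite (kpotE LM g_ge0 L0 (g_fin _ L0)); apply: legendre_le => y.
  rewrite /ext_infty; case: ifPn => [|_]; last by rewrite leNye.
  rewrite inE => Ly; have := fenchel_young y v pk.2.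
  rewrite -[legendre (EFin \o k) y]/(lk y) /g -(fineK (lkf _ Ly)) -!EFinB -?EFinD !lee_fin.
  by lra.
have iG := fun j => @integrable_G phi j Sphi.
have ik := potential_integrable pk (measurable_G phi) iG.
have ilk : leb.-integrable Lambda lk.
  apply/integrableP; split=> //; rewrite (eq_integral lk)// => y _.
  by rewrite gee0_abs.
exists (kpot Lambda g); split=> //.
- exact: (legendre2_kpot LM g_ge0 L0 (g_fin _ L0)).
- exact: (kpot_legendre_kpot g_ge0 g_fin g_inf Sphi).
- exact: kpot_A0.
apply: le_trans (kpot_J_le _ g_ge0 g_fin g_inf mg) _.
apply: leeD => //.
have V : leb Lambda \is a fin_num by rewrite ge0_fin_numE.
have -> : \int[leb]_(y in Lambda) g y = \int[leb]_(y in Lambda) lk y - cr%:E * leb Lambda.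
  rewrite integralB ?integral_cst//.
  exact: (integrable_cstr mL Loo).
have H : \int[leb]_(x in Omega) (kpot Lambda g (G phi x))%:E <=
    \int[leb]_(x in Omega) (k (G phi x))%:E + cr%:E * leb Lambda.
  rewrite -vol -(integral_cst _ mO) -integralD//.
  apply: le_integral => //.
  - exact: (potential_integrable pk0 (measurable_G phi) iG).
  - by apply: integrableD => //; exact: cst_int.
  - by move=> x _; rewrite -EFinD lee_fin; exact: k0k.
  - exact: cst_int.
apply: le_trans (leeD2r _ H) _.
by rewrite addeACA subee ?adde0// fin_numM.
Qed.

Lemma cvg_dist_bound (a_ b_ : nat -> R) (a : R) :
  (forall j, (`|a - a_ j| <= b_ j)%R) -> b_ @ \oo --> (0 : R)%R -> a_ @ \oo --> a.
Proof.
move=> ab b0; apply/cvgrPdist_le => e e0.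
have [N _ HN] := (cvgr0Pnorm_le b_).1 b0 e e0.
exists N => // j Nj; apply: le_trans (ab j) _; apply: le_trans (ler_norm _) _.
exact: HN.
Qed.

Lemma cvg_weighted_sum (I : finType) (c_ : nat -> I -> R) (c w : I -> R) :
  (forall i, c_ j i @[j --> \oo] --> c i) ->
  (fun j => \sum_i `|c_ j i - c i| * w i)%R @ \oo --> (0 : R)%R.
Proof.
move=> cc.
have H : (fun j => \sum_i `|c_ j i - c i| * w i)%R @ \oo --> (\sum_(i : I) 0 * w i)%R.
  apply: cvg_big => [|i _]; first exact: add_continuous.
  apply: cvgM; last exact: cvg_cst.
  rewrite -(normr0 R) -(subrr (c i)); apply: cvg_norm.
  by apply: cvgB; [exact: cc|exact: cvg_cst].
by rewrite big1 in H => // i _; rewrite mul0r.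
Qed.

(** * Semicontinuity along a minimising sequence *)

Section limits.
Context (n : nat) (s : 'I_n -> E -> Mx).
Hypothesis Ss : forall i, S (s i).
Context (c_ : nat -> 'I_n -> R) (c : 'I_n -> R) (phi_ : nat -> E -> Mx) (phi : E -> Mx).
Context (k_ : nat -> E -> R) (k : E -> R) (B : R).
Hypothesis Sphi_ : forall j, S (phi_ j).
Hypothesis Sphi : S phi.
Hypothesis cphi_ : forall j, ae_comb Omega (c_ j) s (phi_ j).
Hypothesis cphi : ae_comb Omega c s phi.
Hypothesis cc : forall i, c_ j i @[j --> \oo] --> c i.
Hypothesis cB : forall j i, (`|c_ j i| <= B)%R.
Hypothesis pk_ : forall j, potential Lambda (k_ j).
Hypothesis pk : potential Lambda k.
Hypothesis kk : forall v, k_ j v @[j --> \oo] --> k v.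

Lemma cvg_integral_potential :
  \int[leb]_(x in Omega) (k_ j (G (phi_ j) x))%:E @[j --> \oo] -->
  \int[leb]_(x in Omega) (k (G phi x))%:E.
Proof.
have Ws i := S_W1q SW (Ss i).
have w_ := ae_foralln (fun j => wdiv_ae_comb oO (S_W1q SW (Sphi_ j)) Ws (cphi_ j)).
have w0 := wdiv_ae_comb oO (S_W1q SW Sphi) Ws cphi.
have dom := ae_foralln (fun j => potential_dominated Ss (Sphi_ j) (cphi_ j)).
have [] := @dominated_convergence _ _ _ leb Omega mO
  (fun j x => (k_ j (G (phi_ j) x))%:E) (fun x => (k (G phi x))%:E)
  (fun x => (dominating s (fun=> B) x)%:E) => //.
- move=> j; apply/measurable_EFinP.
  exact: (potential_measurable (pk_ j) (measurable_G (phi_ j))).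
- by apply/measurable_EFinP; exact: (potential_measurable pk (measurable_G phi)).
- apply: filterS2 w_ w0 => x w_ w0 Ox; apply: cvg_EFin; first exact: nearW.
  apply: (@cvg_dist_bound _ (fun j => `|k (G phi x) - k_ j (G phi x)| +
    LL * \sum_i `|c_ j i - c i| * `|wdiv Omega (s i) x|)%R) => [j|].
    apply: le_trans (ler_distD (k_ j (G phi x)) _ _) _; rewrite lerD2l.
    have := potential_lip LM (pk_ j) (G phi x) (G (phi_ j) x - G phi x).
    rewrite subrKC distrC => /le_trans; apply; apply: ler_wpM2l => //.
    rewrite opprD addrACA subrr add0r w0// w_// -sumrB.
    apply: le_trans (ler_norm_sum _ _ _) _; apply: ler_sum => i _.
    by rewrite -scalerBl normrZ.
  rewrite -[X in _ --> X](addr0 (0%R : R)); apply: cvgD.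
    rewrite -(normr0 R) -(subrr (k (G phi x))); apply: cvg_norm.
    by apply: cvgB; [exact: cvg_cst|exact: kk].
  have := cvgM (cvg_cst LL) (cvg_weighted_sum (fun i => `|wdiv Omega (s i) x|%R) cc).
  by rewrite mulr0; apply.
- exact: integrable_dominating.
- apply: filterS dom => x dom j Ox; rewrite lee_fin.
  have := dom j Ox _ (pk_ j) => /le_trans; apply.
  rewrite ler_wpM2l// lerD2l; apply: ler_sum => i _.
  rewrite ler_wpM2r ?sumr_ge0//; apply: le_trans (cB j i) _; exact: ler_norm.
Qed.

Lemma conjugate_integral_limn :
  \int[leb]_(x in Omega) conjugate f (phi x) <=
  limn_einf (fun j => \int[leb]_(x in Omega) conjugate f (phi_ j x)).
Proof.
apply: (@fatou_lb _ _ _ leb Omega mO Ooo _ _ `|f 0|%R) => //.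
- by move=> j; apply: measurable_conjugate_comp; exact: (S_measurable SW (Sphi_ j)).
- by apply: measurable_conjugate_comp; exact: (S_measurable SW Sphi).
- move=> j x _; apply: le_trans (conjugate_ge f _).
  by rewrite lee_fin lerN2 ler_norm.
- move=> x _; apply: le_trans (conjugate_ge f _).
  by rewrite lee_fin lerN2 ler_norm.
have := ae_foralln cphi_.
apply: filterS2 cphi => x p0 p_ Ox.
apply: (@legendre_le_limn_einf _ _ _ (fun=> EFin \o f) (EFin \o f) (fun j => phi_ j x) (phi x)) => z.
rewrite /= -EFinB; under eq_fun do rewrite -EFinB; apply: cvg_EFin; first exact: nearW.
apply: cvgB; last exact: cvg_cst.
apply: (@cvg_dist_bound _ (fun j => \sum_i `|c_ j i - c i| * `|dot z (s i x)|)%R) => [j|].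
  rewrite p0// p_// !dot_sumr distrC -sumrB; apply: le_trans (ler_norm_sum _ _ _) _.
  by apply: ler_sum => i _; rewrite !dotZr -mulrBl normrM.
exact: cvg_weighted_sum.
Qed.

Lemma legendre_integral_limn (l_ : nat -> E -> \bar R) :
  (forall j, measurable_fun Lambda (l_ j)) -> (forall j y, Lambda y -> 0 <= l_ j y) ->
  (forall j y, Lambda y -> legendre (EFin \o k_ j) y <= l_ j y) ->
  \int[leb]_(y in Lambda) legendre (EFin \o k) y <=
  limn_einf (fun j => \int[leb]_(y in Lambda) l_ j y).
Proof.
move=> ml l0 kl; apply: (@fatou_lb _ _ _ leb Lambda mL Loo _ _ 0%R) => //.
- exact: measurable_funTS (measurable_legendre _).
- by move=> j y Ly; rewrite oppr0 l0.
- by move=> y _; rewrite oppr0; exact: (legendre_ge0 pk.2).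
apply: aeW => y Ly.
apply: (@le_trans _ _ (limn_einf (fun j => legendre (EFin \o k_ j) y))).
  apply: legendre_le_limn_einf => z.
  rewrite /= -EFinB; under eq_fun do rewrite -EFinB; apply: cvg_EFin; first exact: nearW.
  by apply: cvgB; [exact: cvg_cst|exact: kk].
by apply: le_limn_einf => j; exact: kl.
Qed.

End limits.

Hypothesis S_energy : exists2 phi, S phi &
  \int[leb]_(x in Omega) conjugate f (phi x) \is a fin_num.

Lemma dual_exists : exists k0 phi0, [/\ potential Lambda k0,
  legendre (legendre (EFin \o k0)) = EFin \o k0,
  kpot Lambda (legendre (EFin \o k0)) = k0,
  A0 Lambda S k0 (legendre (EFin \o k0)) phi0 &
  J Omega Lambda f F k0 (legendre (EFin \o k0)) phi0 \is a fin_num /\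
  forall k l phi, A0 Lambda S k l phi ->
    J Omega Lambda f F k0 (legendre (EFin \o k0)) phi0 <= J Omega Lambda f F k l phi].
Proof.
have [n [s [[Ss gs] [alpha a0 Ha]]]] := S_basis oO bO q1 SW S_fin.
have [C HC] := dual_coercive Ss a0 Ha.
pose Jset := [set v | exists k l phi, A0 Lambda S k l phi /\ v = J Omega Lambda f F k l phi].
have Jsum k l phi c : A0 Lambda S k l phi -> ae_comb Omega c s phi ->
    (\sum_i `|c i| - C)%:E <= J Omega Lambda f F k l phi.
  move=> A cphi; have [Sphi _ _] := A.
  apply: le_trans (HC _ _ _ (A0_kpot_potential A) Sphi cphi) _.
  apply: le_trans (A0_J_ge A); rewrite addeAC leeDl//.
  by apply: integral_ge0 => y Ly; exact: (A0_ge0 A).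
have Jge v : Jset v -> (- C)%:E <= v.
  move=> [k [l [phi [A ->]]]]; have [Sphi _ _] := A; have [c cphi] := gs _ Sphi.
  apply: le_trans (Jsum _ _ _ _ A cphi); rewrite lee_fin lerDr sumr_ge0//.
pose m := ereal_inf Jset.
have m_ge : (- C)%:E <= m by exact: le_ereal_inf_tmp.
have m_lt : m < +oo.
  (* The zero cost together with a field of finite energy shows that the infimum is not [+oo]. *)
  have [phi1 Sphi1 e1] := S_energy; pose g (y : E) : \bar R := 0.
  have ginf : ereal_inf (g @` Lambda) = 0.
    rewrite (_ : g @` Lambda = [set 0]) ?ereal_inf1//.
    by apply/seteqP; split=> [_ [y _ <-]//|_ ->]; exists 0%R.
  have g0 y : Lambda y -> 0 <= g y by [].
  have gf y : Lambda y -> g y \is a fin_num by [].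
  have mg : measurable_fun Lambda g by exact: measurable_cst.
  apply: (@le_lt_trans _ _ (J Omega Lambda f F (kpot Lambda g)
      (legendre (EFin \o kpot Lambda g)) phi1)).
    apply: ereal_inf_lbound; exists (kpot Lambda g), (legendre (EFin \o kpot Lambda g)), phi1.
    by split=> //; exact: kpot_A0.
  apply: le_lt_trans (kpot_J_le phi1 g0 gf ginf mg) _.
  rewrite (_ : \int[leb]_(y in Lambda) g y = 0); last exact: integral0.
  rewrite adde0 lte_add_pinfty//; last by rewrite ltey_eq e1.
  have := potential_integrable (kpot_potential g0 gf ginf) (measurable_G phi1)
    (fun j => integrable_G j Sphi1).
  by move=> /(integrable_fin_num mO); rewrite fin_numElt => /andP[].
have mfin : m \is a fin_num.
  by rewrite fin_numElt m_lt (lt_le_trans _ m_ge)// ltNyr.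
pose mr := fine m; have mE : m = mr%:E by rewrite /mr fineK.
have : forall j : nat, exists t : (E -> R) * (E -> \bar R) * (E -> Mx) * ('I_n -> R),
    [/\ A0 Lambda S t.1.1.1 t.1.1.2 t.1.2, ae_comb Omega t.2 s t.1.2 &
      J Omega Lambda f F t.1.1.1 t.1.1.2 t.1.2 <= (mr + j.+1%:R^-1)%:E].
  move=> j; have j0 : (0 < j.+1%:R^-1 :> R)%R by rewrite invr_gt0.
  have [_ [k [l [phi [A ->]]]] Jlt] := lb_ereal_inf_adherent j0 mfin.
  have [Sphi _ _] := A; have [c cphi] := gs _ Sphi.
  by exists (k, l, phi, c); split=> //=; rewrite EFinD -mE ltW.
move=> /choice[t Ht].
pose l_ j := (t j).1.1.2; pose phi_ j := (t j).1.2; pose c_ j := (t j).2.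
pose k_ j := kpot Lambda (l_ j).
have A j : A0 Lambda S (t j).1.1.1 (l_ j) (phi_ j) by have [] := Ht j.
have cphi_ j : ae_comb Omega (c_ j) s (phi_ j) by have [] := Ht j.
have Jle j : J Omega Lambda f F (t j).1.1.1 (l_ j) (phi_ j) <= (mr + j.+1%:R^-1)%:E.
  by have [] := Ht j.
have pk_ j : potential Lambda (k_ j) by exact: A0_kpot_potential (A j).
have Sphi_ j : S (phi_ j) by have [] := A j.
(* [Jsum] bounds the sum of the [|c_j i|] by [J + C], and [J <= mr + 1] along the minimising
   sequence. *)
pose B := (mr + 1 + C)%R.
have cB j i : (`|c_ j i| <= B)%R.
  have := le_trans (Jsum _ _ _ _ (A j) (cphi_ j)) (Jle j); rewrite lee_fin => H.
  have j1 : (j.+1%:R^-1 <= 1 :> R)%R by rewrite invf_le1// ler1n.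
  have : (`|c_ j i| <= \sum_i `|c_ j i|)%R by rewrite (bigD1 i)//= lerDl sumr_ge0.
  move: H j1; set x := j.+1%:R^-1%R; rewrite /B; lra.
have [k [c [sg [sgle pk kk cc]]]] := potential_compact LM M0 pk_ cB.
pose phi0 x : Mx := (\sum_i c i *: s i x)%R.
have Sphi0 : S phi0 := S_comb_cvg oO q1 SW S_closed Ss (fun j => Sphi_ (sg j))
  (fun j => cphi_ (sg j)) cc.
have cphi0 : ae_comb Omega c s phi0 by exact: aeW.
have H1 := cvg_integral_potential Ss (fun j => Sphi_ (sg j)) Sphi0 (fun j => cphi_ (sg j))
  cphi0 cc (fun j => cB (sg j)) (fun j => pk_ (sg j)) pk kk.
have H2 := conjugate_integral_limn (fun j => Sphi_ (sg j)) Sphi0 (fun j => cphi_ (sg j)) cphi0 cc.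
have H3 := legendre_integral_limn pk kk (l_ := fun j => l_ (sg j)).
have kfin (k' : E -> R) phi : potential Lambda k' -> S phi ->
    \int[leb]_(x in Omega) (k' (G phi x))%:E \is a fin_num.
  move=> pk' Sphi; apply: integrable_fin_num => //.
  exact: (potential_integrable pk' (measurable_G phi) (fun j => integrable_G j Sphi)).
have conj_gt phi : S phi -> \int[leb]_(x in Omega) conjugate f (phi x) != -oo.
  move=> Sphi; have [/(integrable_fin_num mO)|->//] := conjugate_integral (S_measurable SW Sphi).
  by rewrite fin_numE => /andP[].
have L_ge0 : 0 <= \int[leb]_(y in Lambda) legendre (EFin \o k) y.
  by apply: integral_ge0 => y _; exact: (legendre_ge0 pk.2).
have key : \int[leb]_(x in Omega) (k (G phi0 x))%:E +
    \int[leb]_(y in Lambda) legendre (EFin \o k) y +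
    \int[leb]_(x in Omega) conjugate f (phi0 x) <= mr%:E.
  rewrite -(fineK (kfin _ _ pk Sphi0)).
  apply: (@sum_limn_einf_le _ (fun j => fine (\int[leb]_(x in Omega)
      (k_ (sg j) (G (phi_ (sg j)) x))%:E)) _ _
    (fun j => \int[leb]_(y in Lambda) l_ (sg j) y)
    (fun j => \int[leb]_(x in Omega) conjugate f (phi_ (sg j) x))) => //.
  - by apply: fine_cvg; rewrite fineK// kfin.
  - apply: H3.
    + by move=> j; have [_ _ [ml _ _ _ _]] := A (sg j); exact: measurable_funTS.
    + by move=> j y; exact: (A0_ge0 (A (sg j))).
    + move=> j y Ly; apply: (legendre_kpot_le LM (A0_ge0 (A (sg j))) L0) => //.
      exact: (A0_fin (A (sg j)) L0).
  - by rewrite -ltNye (lt_le_trans _ L_ge0).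
  - exact: conj_gt.
  - move=> j; rewrite fineK ?kfin//.
    apply: le_trans (A0_J_ge (A (sg j))) _; apply: le_trans (Jle (sg j)) _.
    by rewrite lee_fin lerD2l lef_pV2 ?posrE// ler_nat ltnS.
have lkoo : \int[leb]_(y in Lambda) legendre (EFin \o k) y < +oo.
  rewrite ltey; apply/eqP => Loo'; move: key; rewrite Loo'.
  have kf := kfin _ _ pk Sphi0.
  rewrite addey; last by move: kf; rewrite fin_numE => /andP[].
  by rewrite addye// conj_gt.
have [k0 [pk0 bik0 kpk0 A00 Jk0]] := normalized_potential pk Sphi0 lkoo.
have Jm := le_trans Jk0 key.
have mJ k' l' phi' : A0 Lambda S k' l' phi' -> m <= J Omega Lambda f F k' l' phi'.
  by move=> A'; apply: ereal_inf_lbound; exists k', l', phi'.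
exists k0, phi0; split=> //; split.
  by rewrite fin_numElt (le_lt_trans Jm) ?ltry// (lt_le_trans _ (mJ _ _ _ A00))// mE ltNyr.
by move=> k' l' phi' A'; apply: le_trans Jm _; rewrite -mE; exact: mJ.
Qed.

(** The gradient is a subgradient: the first-order expansion at [v + t w] is compared with the chord
    from [v] to [v + w], and the step [t] is divided out. *)
Lemma convex_has_gradient_le k (v g : E) : convex_on setT k -> has_gradient k v g ->
  forall w, (k v + dot g w <= k (v + w))%R.
Proof.
move=> ck gk w; apply/ler_addgt0Pr => e e0.
have W : (0 < `|w| + 1)%R by rewrite ltr_wpDl.
have [rho rho0 H] := gk (e / (`|w| + 1))%R (divr_gt0 e0 W).
pose t := Num.min 1%R (rho / (`|w| + 1))%R.
have t0 : (0 < t)%R by rewrite lt_min ltr01 divr_gt0.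
have t1 : (t <= 1)%R by rewrite ge_min lexx.
have tw : (`|t *: w| <= rho)%R.
  rewrite normrZ gtr0_norm//; apply: (@le_trans _ _ (t * (`|w| + 1))%R).
    by rewrite ler_wpM2l ?(ltW t0)// lerDl.
  by rewrite -ler_pdivlMr// ge_min lexx orbT.
have := H _ tw; rewrite ler_norml dotZr normrZ gtr0_norm// => /andP[h _].
have [_] := ck (v + w)%R v t Logic.I Logic.I (ltac:(lra)).
have -> : (t *: (v + w) + (1 - t) *: v = v + t *: w)%R.
  by rewrite scalerDr scalerBl scale1r addrAC addrCA subrr addr0.
move=> c1.
have ew : (e / (`|w| + 1) * (t * `|w|) <= t * e)%R.
  rewrite mulrCA ler_wpM2l ?(ltW t0)// mulrAC ler_pdivrMr// ler_wpM2l ?(ltW e0)// lerDl//.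
have : (t * (k v + dot g w) <= t * (k (v + w) + e))%R by move: h c1 ew; lra.
by rewrite ler_pM2l.
Qed.

(** * Optimality conditions at a minimiser of the dual functional *)

Section optimality.
Context (k0 : E -> R) (phi0 : E -> Mx).
Notation l0 := (legendre (EFin \o k0)).
Hypothesis pk0 : potential Lambda k0.
Hypothesis l0K : legendre l0 = EFin \o k0.
Hypothesis kpot_l0 : kpot Lambda l0 = k0.
Hypothesis A00 : A0 Lambda S k0 l0 phi0.
Hypothesis J_fin : J Omega Lambda f F k0 l0 phi0 \is a fin_num.
Hypothesis J_min : forall k l phi, A0 Lambda S k l phi ->
  J Omega Lambda f F k0 l0 phi0 <= J Omega Lambda f F k l phi.
Hypothesis nd : nondegenerate_map Omega (F \+ wdiv Omega phi0)%R.

Let Sphi0 : S phi0. Proof. by case: A00. Qed.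

Let l0_ge0 y : 0 <= l0 y. Proof. exact: (legendre_ge0 pk0.2). Qed.

Let l0_fin y : Lambda y -> l0 y \is a fin_num. Proof. exact: (A0_fin A00). Qed.

Let k0_convex : convex_on setT k0.
Proof.
have -> : k0 = fine \o legendre l0 by rewrite l0K.
by apply: legendre_convex_on => // y _; rewrite l0K.
Qed.

Let k0_lip := potential_lip LM pk0.

Let k0_gradient v : smooth_pts k0 v -> has_gradient k0 v (grad k0 v).
Proof. by move=> sv; exact: (has_gradient_smooth k0_convex k0_lip d_gt0 sv). Qed.

Lemma ae_smooth_G : {ae leb, forall x, Omega x -> smooth_pts k0 (G phi0 x)}.
Proof.
have [_ /(_ _ (negligible_smooth_ptsC LL0 k0_convex k0_lip))] := nd.
case=> N [mN N0 sub]; exists N; split=> // x /= /not_implyP[Ox nx]; exact: sub.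
Qed.

(** The default value 0 belongs to [Lambda], so the map takes its values in [closure Lambda]
    everywhere, not just almost everywhere. *)
Definition transport x : E :=
  if G phi0 x \in smooth_pts k0 then grad k0 (G phi0 x) else 0%R.

Lemma measurable_transport : measurable_fun Omega transport.
Proof.
pose v y := if y \in smooth_pts k0 then grad k0 y else 0%R : E.
apply: (@measurableT_comp _ _ _ _ _ _ v); last exact: measurable_G.
have msm : measurable (smooth_pts k0) := measurable_smooth_pts k0_lip.
apply: measurable_fun_mx => // i j.
have -> : (fun y => v y i j) = (fun y => grad k0 y i j) \_ (smooth_pts k0).
  by apply/funext => y; rewrite /v /patch; case: ifPn => // _; rewrite mxE.
apply/(measurable_restrictT _ msm); apply: measurable_funTS.
by apply: measurable_mx_entry; exact: (measurable_grad k0_convex k0_lip).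
Qed.

Lemma fenchel_gradient v : smooth_pts k0 v ->
  l0 (grad k0 v) = (dot (grad k0 v) v - k0 v)%:E.
Proof.
move=> sv; apply/eqP; rewrite eq_le; apply/andP; split.
  apply: legendre_le => z; rewrite /= -EFinB lee_fin.
  have := convex_has_gradient_le k0_convex (k0_gradient sv) (z - v)%R.
  by rewrite subrKC dotBr (dotC z); lra.
have := fenchel_young (grad k0 v) v pk0.2.
by rewrite EFinB leeBlDl.
Qed.

(** The conjugate is finite at a gradient, by equality in Fenchel's inequality, and infinite off
    [closure Lambda]. *)
Lemma gradient_closure v : smooth_pts k0 v -> closure Lambda (grad k0 v).
Proof.
move=> sv; apply: contrapT => /(legendre_out cL (ex_intro _ 0%R L0) bL pk0.1).
by rewrite fenchel_gradient.
Qed.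

Lemma transport_closure x : closure Lambda (transport x).
Proof.
rewrite /transport; case: ifPn => [|_]; last exact: subset_closure.
by rewrite inE; exact: gradient_closure.
Qed.

Lemma ae_transport_gradient : {ae leb, forall x, Omega x ->
  is_gradient k0 (G phi0 x) (transport x)}.
Proof.
apply: filterS ae_smooth_G => x H Ox; have sx := H Ox.
by rewrite /transport mem_set//; exact: has_gradient_is_gradient (k0_gradient sx).
Qed.

Lemma approx_subgradient v y (e : R) : (k0 v - e)%:E <= (dot y v)%:E - l0 y ->
  forall w, (k0 v + dot y w - e <= k0 (v + w))%R.
Proof.
move=> H w; have := fenchel_young y (v + w)%R pk0.2; move: H.
case: (l0 y) (l0_ge0 y) => [r| |]// _.
rewrite -EFinB -EFinD !lee_fin dotDr; lra.
Qed.

(** Equality in Fenchel's inequality makes [y] a subgradient up to every positive error, which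
    [has_gradient_subdiff] turns into arbitrary closeness to the gradient. *)
Lemma subgradient_unique v y : smooth_pts k0 v -> (k0 v)%:E + l0 y <= (dot y v)%:E ->
  y = grad k0 v.
Proof.
move=> sv H; apply/eqP; rewrite -subr_eq0 -normr_le0; apply/ler_addgt0Pr => e e0.
have [delta delta0 Hd] := has_gradient_subdiff (k0_gradient sv) e0.
rewrite add0r; apply: Hd => w.
apply: approx_subgradient; move: H.
case: (l0 y) (l0_ge0 y) => [r| |]// _; rewrite -EFinD -EFinB !lee_fin; lra.
Qed.

Let int_k phi k : potential Lambda k -> S phi ->
  leb.-integrable Omega (EFin \o (fun x => k (G phi x))).
Proof.
by move=> pk Sphi; exact: (potential_integrable pk (measurable_G phi) (fun j => integrable_G j Sphi)).
Qed.

(** No term of [J] is [-oo] and the first is finite, so a finite sum forces the other two to be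
    finite. This allows them to be cancelled in comparisons with the minimum. *)
Let J_terms : \int[leb]_(y in Lambda) l0 y \is a fin_num /\
  \int[leb]_(x in Omega) conjugate f (phi0 x) \is a fin_num.
Proof.
have kf := integrable_fin_num mO (int_k pk0 Sphi0).
have c0 : \int[leb]_(x in Omega) conjugate f (phi0 x) != -oo.
  have [/(integrable_fin_num mO)|->//] := conjugate_integral (S_measurable SW Sphi0).
  by rewrite fin_numE => /andP[].
have L_ge0' : \int[leb]_(y in Lambda) l0 y != -oo.
  have : 0 <= \int[leb]_(y in Lambda) l0 y by apply: integral_ge0.
  by case: (integral _ _ _).
move: J_fin; rewrite /J -[X in X + _ + _](fineK kf).
by case: (\int[leb]_(y in Lambda) l0 y) L_ge0' => [a| |]//;
  case: (\int[leb]_(x in Omega) conjugate f (phi0 x)) c0 => [b| |].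
Qed.

Let int_l0 : leb.-integrable Lambda l0.
Proof.
apply/integrableP; split; first exact: measurable_funTS (measurable_legendre _).
rewrite (eq_integral l0)//; first by move: J_terms.1; rewrite fin_numElt => /andP[].
by move=> y _; rewrite gee0_abs.
Qed.

Lemma normalize_inf (l : E -> \bar R) : (forall y, Lambda y -> l y \is a fin_num) ->
  ereal_inf (l @` Lambda) \is a fin_num -> exists c : R,
  [/\ forall y, Lambda y -> 0 <= l y - c%:E, forall y, Lambda y -> l y - c%:E \is a fin_num &
      ereal_inf ((fun y => l y - c%:E) @` Lambda) = 0].
Proof.
move=> lf cfin; exists (fine (ereal_inf (l @` Lambda))); rewrite fineK//.
have g_ge0 y : Lambda y -> 0 <= l y - ereal_inf (l @` Lambda).
  move=> Ly; rewrite sube_ge0 ?cfin ?orbT//; apply: ereal_inf_lbound; exists y => //.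
split=> // [y Ly|]; first by rewrite fin_numB lf.
apply/eqP; rewrite eq_le; apply/andP; split; last first.
  by apply: le_ereal_inf_tmp => _ [y Ly <-]; exact: g_ge0.
apply/lee_addgt0Pr => e e0; rewrite add0e.
have [_ [y Ly <-] ylt] := lb_ereal_inf_adherent e0 cfin.
apply: (@le_trans _ _ (l y - ereal_inf (l @` Lambda))).
  by apply: ereal_inf_lbound; exists y.
by rewrite leeBlDr// addeC ltW.
Qed.

Lemma cvg_comp_eps (V : normedModType R) (h : V -> R) (y_ : nat -> V) (g : V) :
  {for g, continuous h} ->
  (forall e : R, (0 < e)%R -> exists N, forall j, (N <= j)%N -> (`|y_ j - g| <= e)%R) ->
  h (y_ j) @[j --> \oo] --> h g.
Proof.
move=> ch yg; have yc : y_ @ \oo --> g.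
  apply/cvgrPdist_le => e e0; have [N HN] := yg e e0.
  by exists N => // j Nj; rewrite distrC; exact: HN.
exact: (cvg_comp y_ h yc ch).
Qed.

(* The dual problem is perturbed by adding [h / (j + 1)] to [l0]. *)
Lemma perturbed_potential (h : E -> R) (H : R) (j : nat) : continuous h ->
  (forall y, (`|h y| <= H)%R) -> exists (k : E -> R) (c : R),
  [/\ potential Lambda k,
    (forall v, (k v - c <= k0 v + j.+1%:R^-1 * H)%R /\ (k0 v - j.+1%:R^-1 * H <= k v - c)%R),
    (forall v, exists2 y, Lambda y &
       (k v - c + j.+1%:R^-1 * h y - j.+1%:R^-1 ^+ 2)%:E <= (dot y v)%:E - l0 y) &
    \int[leb]_(x in Omega) (k0 (G phi0 x))%:E <=
    \int[leb]_(x in Omega) (k (G phi0 x) - c)%:E +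
    (j.+1%:R^-1)%:E * \int[leb]_(y in Lambda) (h y)%:E].
Proof.
move=> ch hH; set e : R := j.+1%:R^-1%R.
have e0 : (0 < e)%R by rewrite invr_gt0.
have H0 : (0 <= H)%R by apply: le_trans (hH 0%R).
have mh : measurable_fun Lambda h by exact: measurable_funTS (continuous_measurable_mx ch).
pose l y := l0 y + (e * h y)%:E.
have lf y : Lambda y -> l y \is a fin_num by move=> Ly; rewrite /l fin_numD l0_fin.
have eh y : (- (e * H) <= e * h y <= e * H)%R.
  by rewrite -mulrN !ler_pM2l// -ler_norml.
have linf : ereal_inf (l @` Lambda) \is a fin_num.
  rewrite fin_numElt; apply/andP; split.
    apply: (@lt_le_trans _ _ (- (e * H))%:E); first exact: ltNyr.
    apply: le_ereal_inf_tmp => _ [y Ly <-]; rewrite -[leLHS]add0e.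
    by apply: leeD; rewrite ?l0_ge0// lee_fin; case/andP: (eh y).
  apply: (@le_lt_trans _ _ (l 0%R)); first by apply: ereal_inf_lbound; exists 0%R.
  by have := lf _ L0; rewrite fin_numElt => /andP[].
have [c [g_ge0 g_fin g_inf]] := normalize_inf lf linf.
pose g y := l y - c%:E.
have ml0 : measurable_fun Lambda l0 by exact: measurable_funTS (measurable_legendre _).
have ih : leb.-integrable Lambda (fun y => (e * h y)%:E).
  apply: (le_integrable mL _ _ (integrable_cstr mL Loo (e * H))).
    by apply/measurable_EFinP; exact: measurable_funM.
  move=> y _; rewrite lee_fin (ger0_norm (mulr_ge0 (ltW e0) H0)).
  by rewrite ler_norml; exact: eh.
have il : leb.-integrable Lambda l by exact: integrableD.
have mg : measurable_fun Lambda g.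
  by apply: emeasurable_funB => //; case/integrableP: il.
pose k := kpot Lambda g.
have pk : potential Lambda k := kpot_potential g_ge0 g_fin g_inf.
have kE v : (k v)%:E = legendre (ext_infty Lambda g) v.
  by rewrite -(kpotE LM g_ge0 L0 (g_fin _ L0)).
exists k, c; split=> //.
- move=> v; split.
    rewrite lerBlDr -lee_fin kE; apply: legendre_le => y.
    rewrite /ext_infty; case: ifPn => [|_]; last by rewrite leNye.
    rewrite inE => Ly; have := fenchel_young y v pk0.2.
    rewrite /g /l; case: (l0 y) (l0_fin Ly) => // a _.
    rewrite -!(EFinN, EFinD) !lee_fin; have /andP[] := eh y.
    by move=> e1 e2; lra.
  rewrite lerBlDr -lee_fin -[in leLHS]kpot_l0.
  rewrite -[leLHS]/((EFin \o kpot Lambda l0) v) (kpotE LM (fun y _ => l0_ge0 y) L0 (l0_fin L0)).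
  apply: legendre_le => y; rewrite /ext_infty; case: ifPn => [|_]; last by rewrite leNye.
  rewrite inE => Ly; have := kpot_ge LM g_ge0 L0 (g_fin _ L0) v Ly.
  rewrite -/k /g /l; case: (l0 y) (l0_fin Ly) => // a _.
  rewrite -!(EFinN, EFinD) !lee_fin; have /andP[] := eh y.
  by move=> e1 e2; lra.
- move=> v.
  (* The supremum over the open set [Lambda] need not be attained. An error [e ^+ 2] is affordable,
     since it still vanishes after division by [e]. *)
  have : (k v - e ^+ 2)%:E < legendre (ext_infty Lambda g) v.
    by rewrite -kE lte_fin ltrBlDr ltrDl exprn_gt0.
  move=> /legendre_gtP[y]; rewrite /ext_infty; case: ifPn => [|_]; last by rewrite ltNge leNye.
  rewrite inE => Ly H1; exists y => //; move: H1.
  rewrite /g /l; case: (l0 y) (l0_fin Ly) => // a _.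
  by rewrite -!(EFinN, EFinD) !lte_fin !lee_fin; lra.
have [fl fc] := J_terms.
(* Minimality against the perturbed pair with the same field [phi0]: the energy term cancels. *)
have := le_trans (J_min (kpot_A0 g_ge0 g_fin g_inf Sphi0)) (kpot_J_le phi0 g_ge0 g_fin g_inf mg).
rewrite {1}/J leeD2rE// -/k.
have ihh : leb.-integrable Lambda (fun y => (h y)%:E).
  apply: (le_integrable mL _ _ (integrable_cstr mL Loo H)); first exact/measurable_EFinP.
  by move=> y _; rewrite lee_fin (ger0_norm H0).
have V : leb Lambda \is a fin_num by rewrite ge0_fin_numE.
have -> : \int[leb]_(y in Lambda) g y = \int[leb]_(y in Lambda) l0 y +
    e%:E * \int[leb]_(y in Lambda) (h y)%:E - c%:E * leb Lambda.
  rewrite integralB ?integral_cst//; last exact: (integrable_cstr mL Loo).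
  congr (_ - _); rewrite integralD//; congr (_ + _).
  by under eq_integral do rewrite EFinM; rewrite integralZl.
have -> : \int[leb]_(x in Omega) (k (G phi0 x) - c)%:E =
    \int[leb]_(x in Omega) (k (G phi0 x))%:E - c%:E * leb Lambda.
  under eq_integral do rewrite EFinB.
  rewrite (integralB mO (int_k pk Sphi0) (cst_int c)).
  by rewrite -vol; congr (_ - _); exact: integral_cst.
have := integrable_fin_num mO (int_k pk0 Sphi0).
have := integrable_fin_num mO (int_k pk Sphi0).
have := integrable_fin_num mL ihh; move: fl V => /=.
case: (leb Lambda) => // vv; case: (\int[leb]_(y in Lambda) l0 y) => // a.
case: (\int[leb]_(y in Lambda) (h y)%:E) => // b _ _ _.
case: (\int[leb]_(x in Omega) (k (G phi0 x))%:E) => // r _.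
case: (\int[leb]_(x in Omega) (k0 (G phi0 x))%:E) => // r' _.
by rewrite -!EFinM -!(EFinN, EFinD) !lee_fin; lra.
Qed.

Lemma integrable_bounded (D : set E) (h : E -> R) (H : R) : measurable D -> leb D < +oo ->
  measurable_fun D h -> (forall x, (`|h x| <= H)%R) -> leb.-integrable D (EFin \o h).
Proof.
move=> mD Doo mh hH; apply: (le_integrable mD _ _ (integrable_cstr mD Doo H)).
  exact/measurable_EFinP.
by move=> y _ /=; rewrite lee_fin; apply: le_trans (hH y) (ler_norm _).
Qed.

(** The quotients [r j = (j + 1) * (k0 - k_ j)] have integral at most that of [h] over [Lambda], by
    minimality. Pointwise they are at least [h (y j) - 1/(j+1)] for near-maximisers [y j], which
    converge to the gradient of [k0]; Fatou's lemma concludes. *)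
Lemma transport_le (h : E -> R) (H : R) : continuous h -> (forall y, (`|h y| <= H)%R) ->
  \int[leb]_(x in Omega) (h (transport x))%:E <= \int[leb]_(y in Lambda) (h y)%:E.
Proof.
move=> ch hH; have H0 : (0 <= H)%R by apply: le_trans (hH 0%R).
have : forall j, exists t : (E -> R) * R, [/\ potential Lambda t.1,
    (forall v, (t.1 v - t.2 <= k0 v + j.+1%:R^-1 * H)%R /\
       (k0 v - j.+1%:R^-1 * H <= t.1 v - t.2)%R),
    (forall v, exists2 y, Lambda y &
       (t.1 v - t.2 + j.+1%:R^-1 * h y - j.+1%:R^-1 ^+ 2)%:E <= (dot y v)%:E - l0 y) &
    \int[leb]_(x in Omega) (k0 (G phi0 x))%:E <=
    \int[leb]_(x in Omega) (t.1 (G phi0 x) - t.2)%:E +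
    (j.+1%:R^-1)%:E * \int[leb]_(y in Lambda) (h y)%:E].
  by move=> j; have [k [c HH]] := perturbed_potential j ch hH; exists (k, c).
move=> /choice[t Ht].
pose k_ j v := ((t j).1 v - (t j).2)%R.
pose r j v : R := (j.+1%:R * (k0 v - k_ j v))%R.
have j0 (j : nat) : (0 < j.+1%:R :> R)%R by [].
have jE (j : nat) : (j.+1%:R * j.+1%:R^-1 = 1 :> R)%R by rewrite mulfV ?gt_eqF.
have mh : measurable_fun setT h := continuous_measurable_mx ch.
have ih : leb.-integrable Lambda (EFin \o h).
  by apply: (integrable_bounded mL Loo _ hH); exact: measurable_funTS.
have ik_ j : leb.-integrable Omega (EFin \o (fun x => k_ j (G phi0 x))).
  have [pk _ _ _] := Ht j.
  apply: eq_integrable (integrableB mO (int_k pk Sphi0) (cst_int (t j).2)) => // x _.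
have ir j : leb.-integrable Omega (EFin \o (fun x => r j (G phi0 x))).
  apply: eq_integrable (integrableZl mO j.+1%:R
    (integrableB mO (int_k pk0 Sphi0) (ik_ j))) => // x _.
have r_lb j v : (- H <= r j v)%R.
  have [_ /(_ v)[k1 _] _ _] := Ht j.
  rewrite /r -(ler_pM2l (x := j.+1%:R^-1)) ?invr_gt0// mulrA mulVf ?gt_eqF// mul1r.
  rewrite mulrN; move: k1; rewrite /k_; set a := (_ * H)%R; lra.
have int_r j : \int[leb]_(x in Omega) (r j (G phi0 x))%:E <= \int[leb]_(y in Lambda) (h y)%:E.
  have [_ _ _] := Ht j; rewrite -[X in _ <= X + _ -> _]/(\int[leb]_(x in Omega) (k_ j (G phi0 x))%:E).
  have -> : \int[leb]_(x in Omega) (r j (G phi0 x))%:E = (j.+1%:R)%:E *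
      (\int[leb]_(x in Omega) (k0 (G phi0 x))%:E - \int[leb]_(x in Omega) (k_ j (G phi0 x))%:E).
    rewrite -(integralB mO (int_k pk0 Sphi0) (ik_ j)) -integralZl//.
    exact: (integrableB mO (int_k pk0 Sphi0) (ik_ j)).
  have := integrable_fin_num mO (int_k pk0 Sphi0); have := integrable_fin_num mO (ik_ j).
  have := integrable_fin_num mL ih => /=.
  case: (\int[leb]_(y in Lambda) (h y)%:E) => // b _.
  case: (\int[leb]_(x in Omega) (k_ j (G phi0 x))%:E) => // a _.
  case: (\int[leb]_(x in Omega) (k0 (G phi0 x))%:E) => // a' _.
  rewrite -!(EFinM, EFinN, EFinD) !lee_fin => H1.
  rewrite -(ler_pM2l (x := j.+1%:R^-1)) ?invr_gt0// mulrA mulVf ?gt_eqF// mul1r.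
  by move: H1; set z := (_ * b)%R; lra.
have lim v : smooth_pts k0 v -> (h (grad k0 v))%:E <= limn_einf (fun j => (r j v)%:E).
  move=> sv; have : forall j, exists y, Lambda y /\
       (k_ j v + j.+1%:R^-1 * h y - j.+1%:R^-1 ^+ 2)%:E <= (dot y v)%:E - l0 y.
    by move=> j; have [_ _ /(_ v)[y Ly Hy] _] := Ht j; exists y.
  move=> /choice[y Hy].
  have yg : forall e : R, (0 < e)%R -> exists N, forall j, (N <= j)%N ->
      (`|y j - grad k0 v| <= e)%R.
    move=> e e0; have [delta delta0 Hd] := has_gradient_subdiff (k0_gradient sv) e0.
    (* With [e' = 1/(j+1)], the error [e' * H] occurs once in the comparison of [k_ j] with [k0] and
       once through [h]; the slack satisfies [e' ^+ 2 <= e']. Together they are at most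
       [e' * (2 * H + 1)]. *)
    have K0 : (0 < 2 * H + 1)%R by rewrite ltr_wpDl// mulr_ge0.
    have [N _ HN] := near_infty_natSinv_lt (PosNum (divr_gt0 delta0 K0)).
    exists N => j /HN /=; rewrite ltr_pdivlMr// => ej; apply: Hd => w.
    have [Lj Hj] := Hy j.
    have j1 : (j.+1%:R^-1 <= 1 :> R)%R by rewrite invf_le1// ler1n.
    have jp : (0 < j.+1%:R^-1 :> R)%R by rewrite invr_gt0.
    have [_ /(_ v)[_ k2] _ _] := Ht j.
    move: ej j1 jp k2 Hj; set e' := (j.+1%:R^-1)%R => ej j1 jp k2 Hj.
    have hy : (- (e' * H) <= e' * h (y j))%R.
      by rewrite -mulrN ler_pM2l//; have := hH (y j); rewrite ler_norml => /andP[].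
    have ee : (e' ^+ 2 <= e')%R by rewrite expr2 ler_piMl// ltW.
    have app : (k0 v - delta)%:E <= (dot (y j) v)%:E - l0 (y j).
      apply: le_trans Hj; rewrite lee_fin /k_.
      have : (e' * (2 * H + 1) <= delta)%R by exact: ltW.
      by rewrite mulrDr mulr1 mulrCA; move: k2 hy ee; set x := (e' * H)%R; lra.
    exact: (approx_subgradient app w).
  have hyg := cvg_comp_eps (ch (grad k0 v)) yg.
  have cv : (h (y j) - j.+1%:R^-1)%R @[j --> \oo] --> (h (grad k0 v) - 0)%R.
    by apply: cvgB => //; exact: cvg_harmonic.
  rewrite subr0 in cv.
  have cvE : (h (y j) - j.+1%:R^-1)%:E @[j --> \oo] --> (h (grad k0 v))%:E.
    by apply: cvg_EFin => //; exact: nearW.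
  have [<- _] := cvg_limn_einf_sup cvE.
  (* Fenchel's inequality for [k0] and the near-maximality of [y j] for [k_ j] are subtracted, so
     that [l0 (y j)] disappears. *)
  apply: le_limn_einf => j; rewrite lee_fin.
  have [Lj Hj] := Hy j.
  have := fenchel_young (y j) v pk0.2; move: Hj.
  case: (l0 (y j)) (l0_fin Lj) => // a _.
  rewrite -!(EFinN, EFinD) !lee_fin => H1 H2.
  rewrite /r -(ler_pM2l (x := j.+1%:R^-1)) ?invr_gt0// mulrA mulVf ?gt_eqF// mul1r.
  by rewrite mulrBr -expr2; move: H1 H2; set z := (_ * h _)%R; set zz := (_ ^+ 2)%R; lra.
apply: (@le_trans _ _ (limn_einf (fun j => \int[leb]_(x in Omega) (r j (G phi0 x))%:E))).
  apply: (@fatou_lb _ _ _ leb Omega mO Ooo _ _ H H0).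
  - by move=> j; case/integrableP: (ir j).
  - apply/measurable_EFinP; apply: measurableT_comp => //; exact: measurable_transport.
  - by move=> j x _; rewrite lee_fin.
  - by move=> x _; rewrite lee_fin; have := hH (transport x); rewrite ler_norml => /andP[].
  - apply: filterS ae_smooth_G => x sm Ox; have sx := sm Ox.
    by rewrite /transport mem_set//; exact: lim.
rewrite -[leRHS](cvg_limn_einf_sup (cvg_cst (\int[leb]_(y in Lambda) (h y)%:E))).1.
exact: le_limn_einf.
Qed.

Lemma transport_preserves (l : E -> R) : continuous l ->
  compact (closure [set x | l x != 0%R]) ->
  \int[leb]_(x in Omega) (l (transport x))%:E = \int[leb]_(y in Lambda) (l y)%:E.
Proof.
move=> cl kl; have [H hH] : exists H : R, forall x, (`|l x| <= H)%R.
  apply: (supported_bounded kl cl) => x nx; apply/eqP; apply: contrapT => /negP lx.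
  by apply: nx; exact: subset_closure.
have ml : measurable_fun setT l := continuous_measurable_mx cl.
have i1 : leb.-integrable Omega (EFin \o (fun x => l (transport x))).
  apply: (integrable_bounded mO Ooo _ (fun x => hH _)).
  apply: measurableT_comp => //; exact: measurable_transport.
have i2 : leb.-integrable Lambda (EFin \o l).
  by apply: (integrable_bounded mL Loo _ hH); exact: measurable_funTS.
apply/eqP; rewrite eq_le (transport_le cl hH)/=.
(* The reverse inequality is [transport_le] for [- l]. *)
have cNl : continuous (fun y => - l y)%R by move=> x; exact: (cvgN (cl x)).
have hNH y : (`|- l y| <= H)%R by rewrite normrN.
have := transport_le cNl hNH.
have N1 : \int[leb]_(x in Omega) (- l (transport x))%:E =
    - \int[leb]_(x in Omega) (l (transport x))%:E.
  by under eq_integral do rewrite EFinN; rewrite integralN//; exact: integrable_add_def.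
have N2 : \int[leb]_(y in Lambda) (- l y)%:E = - \int[leb]_(y in Lambda) (l y)%:E.
  by under eq_integral do rewrite EFinN; rewrite integralN//; exact: integrable_add_def.
by rewrite N1 N2 leeN2.
Qed.

Lemma le_integral_measurable dp (T : measurableType dp) (mu : {measure set T -> \bar R})
    (D : set T) (g h : T -> \bar R) : measurable D -> measurable_fun D g ->
  measurable_fun D h -> (forall x, D x -> g x <= h x) ->
  \int[mu]_(x in D) g x <= \int[mu]_(x in D) h x.
Proof.
move=> mD mg mh gh; rewrite [leLHS]integralE [leRHS]integralE.
have gh' : {in D, forall x, g x <= h x} by move=> x; rewrite inE; exact: gh.
apply: leeB.
- apply: ge0_le_integral => //; [exact: measurable_funepos|exact: measurable_funepos|].
  by move=> x Dx; apply: (funepos_le gh'); rewrite inE.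
- apply: ge0_le_integral => //; [exact: measurable_funeneg|exact: measurable_funeneg|].
  by move=> x Dx; apply: (funeneg_le gh'); rewrite inE.
Qed.

Lemma integrable_or_ninfty dp (T : measurableType dp) (mu : {measure set T -> \bar R})
    (D : set T) (g h : T -> \bar R) : measurable D -> mu.-integrable D g ->
  measurable_fun D h -> (forall x, D x -> g x <= h x) ->
  mu.-integrable D h \/ \int[mu]_(x in D) (- h x) = -oo.
Proof.
move=> mD ig mh gh.
have gh' : {in D, forall x, g x <= h x} by move=> x; rewrite inE; exact: gh.
have negoo : \int[mu]_(x in D) h^\- x < +oo.
  apply: (@le_lt_trans _ _ (\int[mu]_(x in D) g^\- x)).
    apply: ge0_le_integral => //; first exact: measurable_funeneg.
      by apply: measurable_funeneg; case/integrableP: ig.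
    by move=> x Dx; apply: (funeneg_le gh'); rewrite inE.
  exact: integral_funeneg_lt_pinfty ig.
have [posoo|posoo] := eqVneq (\int[mu]_(x in D) h^\+ x) +oo; [right|left].
  rewrite integralE (_ : (fun x => - h x)^\+ = h^\-); last exact: funeposN.
  rewrite (_ : (fun x => - h x)^\- = h^\+); last exact: funenegN.
  by rewrite posoo; case: (integral _ _ _) negoo.
apply/integrableP; split=> //.
have -> : \int[mu]_(x in D) `|h x| = \int[mu]_(x in D) (h^\+ x + h^\- x).
  by apply: eq_integral => x _; rewrite -[LHS]/((abse \o h) x) fune_abse.
rewrite ge0_integralD//; [|exact: measurable_funepos|exact: measurable_funeneg].
by rewrite lte_add_pinfty// ltey.
Qed.

Lemma has_gradient_directional (k : E -> R) (v g w : E) : has_gradient k v g ->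
  (j.+2%:R * (k (v + j.+2%:R^-1 *: w) - k v))%R @[j --> \oo] --> dot g w.
Proof.
move=> gk; apply/cvgrPdist_le => e e0.
have W : (0 < `|w| + 1)%R by rewrite ltr_wpDl.
have [rho rho0 H] := gk (e / (`|w| + 1))%R (divr_gt0 e0 W).
have [N _ HN] := near_infty_natSinv_lt (PosNum (divr_gt0 rho0 W)).
exists N => // j Nj; have := HN j.+1 (leqW Nj); rewrite /= ltr_pdivlMr//.
have jp : (0 < j.+2%:R^-1 :> R)%R by rewrite invr_gt0.
move=> jr; have := H (j.+2%:R^-1 *: w)%R.
rewrite normrZ gtr0_norm// dotZr => /(_ _)H1.
have {H1} := H1 (ltac:(move: jr jp; set t := (_^-1)%R; have := normr_ge0 w; nra)).
rewrite distrC; have {2}-> : (dot g w = j.+2%:R * (j.+2%:R^-1 * dot g w))%R.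
  by rewrite mulrA mulfV ?mul1r// gt_eqF.
rewrite -mulrBr normrM (ger0_norm (ler0n _ _)) => H1.
rewrite -ler_pdivlMl//; apply: le_trans H1 _.
rewrite mulrCA ler_pM2l// mulrAC ler_pdivrMr// ler_wpM2l ?(ltW e0)// lerDl//.
Qed.

Lemma conjugate_convex (x y : Mx) (t : R) : (0 < t < 1)%R ->
  conjugate f (t *: x + (1 - t) *: y)%R <= t%:E * conjugate f x + (1 - t)%:E * conjugate f y.
Proof.
move=> /andP[t0 t1]; have t1' : (0 < 1 - t)%R by rewrite subr_gt0.
have := conjugate_ge f x; have := conjugate_ge f y.
case Ex : (conjugate f x) => [a| |]; case Ey : (conjugate f y) => [b| |]// _ _.
- rewrite -!EFinM -EFinD; apply: legendre_convex; rewrite ?(ltW t0) ?(ltW t1)//.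
    by rewrite -Ex.
  by rewrite -Ey.
- by rewrite (gt0_muley (x := (1 - t)%:E)) ?lte_fin// addey ?leey// -EFinM.
- by rewrite gt0_muley ?lte_fin// addye ?leey// -EFinM.
- by rewrite !gt0_muley ?lte_fin// addye ?leey.
Qed.

Section dot_integrals.
Context (u : E -> E).
Hypothesis mu : measurable_fun Omega u.
Hypothesis uM : forall x, Omega x -> (`|u x| <= M)%R.

Lemma dot_integrable (H : E -> E) : measurable_fun Omega H ->
  (forall j, leb.-integrable Omega (EFin \o (fun x => H x ord0 j))) ->
  leb.-integrable Omega (EFin \o (fun x => dot (u x) (H x))).
Proof.
move=> mH iH; apply: (le_integrable mO _ _ (integrableZl mO LL (integrable_norm1 iH))).
  by apply/measurable_EFinP; exact: measurable_dot.
move=> x Ox; rewrite lee_fin; apply: le_trans (dot_norm_le _ _) _.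
apply: le_trans (ler_norm _); rewrite /LL -mulrA ler_wpM2l//.
by apply: ler_pM => //; [exact: uM|exact: norm_le_norm1].
Qed.

(** The energy may be [+oo], so the integral cannot be split by linearity alone. The linear term is
    integrable and the conjugate is bounded below; in the infinite case both sides are [-oo]. *)
Lemma V_integralE phi : S phi -> V_integral Omega f u phi =
  - (\int[leb]_(x in Omega) (dot (u x) (wdiv Omega phi x))%:E) -
    \int[leb]_(x in Omega) conjugate f (phi x).
Proof.
move=> Sphi; have mphi := S_measurable SW Sphi.
have idot := dot_integrable (measurable_wdiv oO phi)
  (fun j => S_wdiv_integrable oO bO q1 SW ord0 j Sphi).
have mf : measurable_fun Omega (fun x => conjugate f (phi x)) := measurable_conjugate_comp mphi.
have E1 : V_integral Omega f u phi = \int[leb]_(x in Omega)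
    (- ((dot (u x) (wdiv Omega phi x))%:E + conjugate f (phi x))).
  by apply: eq_integral => x _; rewrite [in RHS]addeC fin_num_oppeD// [RHS]addeC EFinN.
have dfin := integrable_fin_num mO idot.
have [ifs|ifs] := conjugate_integral mphi.
  have iW : leb.-integrable Omega
      (fun x => (dot (u x) (wdiv Omega phi x))%:E + conjugate f (phi x)).
    exact: (integrableD mO idot ifs).
  rewrite E1 integralN//; last exact: integrable_add_def.
  by rewrite (integralD mO idot ifs) fin_num_oppeD//; exact: integrable_fin_num.
have ilow : leb.-integrable Omega
    (fun x => (dot (u x) (wdiv Omega phi x))%:E + (- f 0%R)%:E).
  exact: integrableD (cst_int _).
have mW : measurable_fun Omega (fun x => (dot (u x) (wdiv Omega phi x))%:E + conjugate f (phi x)).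
  by apply: emeasurable_funD => //; case/integrableP: idot.
have [|ih|W] := integrable_or_ninfty mO ilow mW.
- by move=> x _; apply: leeD => //; exact: conjugate_ge.
- have : leb.-integrable Omega (fun x => conjugate f (phi x)).
    apply: eq_integrable (integrableB mO ih idot) => // x _ /=.
    by rewrite addeAC subee// add0e.
  by move=> /(integrable_fin_num mO); rewrite ifs.
- by rewrite E1 W ifs; case: (integral _ _ _) dfin.
Qed.

End dot_integrals.

Lemma closure_norm_le (V : normedModType R) (A : set V) (C : R) (x : V) :
  (forall y, A y -> (`|y| <= C)%R) -> closure A x -> (`|x| <= C)%R.
Proof.
move=> AC /closure_normP H; apply/ler_addgt0Pr => e e0; have [y Ay xy] := H e e0.
rewrite -(subrK y x) addrC; apply: le_trans (ler_normD _ _) _.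
by apply: lerD; [exact: AC|exact: ltW].
Qed.

Lemma transport_norm x : (`|transport x| <= M)%R.
Proof. by apply: closure_norm_le LM _; exact: transport_closure. Qed.

Lemma transport_U1 : U1_S Omega Lambda q S transport.
Proof.
split; last exact: transport_preserves.
have [C C0 HC] := S_wdiv_bound oO bO q1 SW S_fin M0.
split; [exact: measurable_transport|by move=> x _; exact: transport_closure|].
exists (C + 1)%R; split; first by rewrite ltr_wpDl.
move=> phi Sphi; apply: le_trans (HC _ _ Sphi measurable_transport _) _.
  by move=> x _ i; apply: le_trans (mx_coord_le_norm _ _ _) (transport_norm x).
by apply: lee_wpmul2r; [exact: Lq_norm_ge0|rewrite lee_fin lerDl].
Qed.

Let udiv phi := \int[leb]_(x in Omega) (dot (transport x) (wdiv Omega phi x))%:E.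

Let iudiv phi : S phi -> leb.-integrable Omega
  (EFin \o (fun x => dot (transport x) (wdiv Omega phi x))).
Proof.
move=> Sphi; apply: (dot_integrable measurable_transport (fun x _ => transport_norm x)).
  exact: measurable_wdiv.
by move=> j; exact: (S_wdiv_integrable oO bO q1 SW ord0 j Sphi).
Qed.

Lemma fin_num_swap (a b c e : \bar R) : a \is a fin_num -> b \is a fin_num ->
  c \is a fin_num -> e \is a fin_num -> a - b <= c - e -> a + e <= b + c.
Proof.
case: a => // a _; case: b => // b _; case: c => // c _; case: e => // e _.
by rewrite -!(EFinN, EFinD) !lee_fin; lra.
Qed.

Lemma fin_num_oppe_swap (a b c e : \bar R) : a \is a fin_num -> b \is a fin_num ->
  c \is a fin_num -> e \is a fin_num -> a + e <= b + c -> - c - b <= - e - a.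
Proof.
case: a => // a _; case: b => // b _; case: c => // c _; case: e => // e _.
by rewrite -!(EFinN, EFinD) !lee_fin; lra.
Qed.

(* First-order optimality of [phi0] along the segment from [phi0] to [phi]. *)
Lemma energy_variation phi (S_convex : convex_set (S : set (convex_lmodType (E -> Mx)))) :
  S phi -> leb.-integrable Omega (fun x => conjugate f (phi x)) ->
  \int[leb]_(x in Omega) conjugate f (phi0 x) + udiv phi0 <=
  \int[leb]_(x in Omega) conjugate f (phi x) + udiv phi.
Proof.
move=> Sphi ifs; have mphi := S_measurable SW Sphi; have mphi0 := S_measurable SW Sphi0.
have ifs0 : leb.-integrable Omega (fun x => conjugate f (phi0 x)).
  by have [//|oo] := conjugate_integral mphi0; move: J_terms.2; rewrite oo.
(* Starting at [1/2] keeps [t j] strictly between 0 and 1, as [conjugate_convex] requires;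
   [has_gradient_directional] uses the same steps. *)
pose t (j : nat) : R := (j.+2%:R^-1)%R.
have t0 j : (0 < t j)%R by rewrite invr_gt0.
have tE j : (j.+2%:R * t j = 1)%R by rewrite /t mulfV// gt_eqF.
have t1 j : (t j < 1)%R by rewrite invf_lt1// ltr1n.
pose ph j x : Mx := (t j *: phi x + (1 - t j) *: phi0 x)%R.
have Sph j : S (ph j).
  have := @convex_set_comb R (E -> Mx) S phi phi0 (t j) S_convex Sphi Sphi0.
  by apply; rewrite !ltW.
pose Dw x := (wdiv Omega phi x - wdiv Omega phi0 x)%R.
(* Divergence is linear only almost everywhere; the two-term combination is indexed by [bool] in
   order to use [wdiv_ae_comb]. *)
have Gph j : {ae leb, forall x, Omega x -> (G (ph j) x = G phi0 x + t j *: Dw x)%R}.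
  have := @wdiv_ae_comb R d Omega q oO bool (fun b => if b then t j else 1 - t j)%R
    (fun b => if b then phi else phi0) (ph j) (S_W1q SW (Sph j)).
  move=> /(_ _ _)H; have {H} := H (fun b => ltac:(by case: b; exact: S_W1q SW _ _)) .
  move=> /(_ _)H; have {}H := H (ltac:(by apply: aeW => x _; rewrite big_bool)).
  apply: filterS H => x H Ox; rewrite H// big_bool/= /Dw.
  rewrite -addrA; congr (_ + _)%R; rewrite scalerBl scale1r scalerBr.
  by rewrite addrCA addrA.
pose a := \int[leb]_(x in Omega) conjugate f (phi0 x).
pose b := \int[leb]_(x in Omega) conjugate f (phi x).
have afin : a \is a fin_num := integrable_fin_num mO ifs0.
have bfin : b \is a fin_num := integrable_fin_num mO ifs.
have mph j : measurable_fun Omega (fun x => conjugate f (ph j x)).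
  by apply: measurable_conjugate_comp; exact: (S_measurable SW (Sph j)).
have conv j : \int[leb]_(x in Omega) conjugate f (ph j x) <= (t j)%:E * b + (1 - t j)%:E * a.
  rewrite /a /b -!integralZl// -integralD//; [|exact: integrableZl|exact: integrableZl].
  apply: le_integral_measurable => //.
    by apply: emeasurable_funD; apply: emeasurable_funM => //;
      [case/integrableP: ifs|case/integrableP: ifs0].
  by move=> x _; apply: conjugate_convex; rewrite t0 t1.
have A0t j : A0 Lambda S k0 l0 (ph j) by case: A00.
pose Q j x : R := (j.+2%:R * (k0 (G phi0 x + t j *: Dw x) - k0 (G phi0 x)))%R.
have iD i : leb.-integrable Omega (EFin \o (fun x => Dw x ord0 i)).
  rewrite (_ : _ \o _ = (EFin \o (fun x => wdiv Omega phi x ord0 i)) \-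
    (EFin \o (fun x => wdiv Omega phi0 x ord0 i))).
    apply: integrableB => //; [exact: (S_wdiv_integrable oO bO q1 SW ord0 i Sphi)|].
    exact: (S_wdiv_integrable oO bO q1 SW ord0 i Sphi0).
  by apply/funext => x; rewrite /= !mxE EFinB.
have mD : measurable_fun Omega Dw.
  apply: measurable_fun_mx => // i j; under eq_fun do rewrite /Dw mxE [X in (_ + X)%R]mxE.
  by apply: measurable_funB; apply: measurable_mx_entry; exact: measurable_wdiv.
have mGt j : measurable_fun Omega (fun x => G phi0 x + t j *: Dw x)%R.
  apply: measurable_fun_mx => // i l; under eq_fun do rewrite mxE [X in (_ + X)%R]mxE.
  apply: measurable_funD; first by apply: measurable_mx_entry; exact: measurable_G.
  by apply: measurable_funM => //; exact: measurable_mx_entry.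
have mQ j : measurable_fun Omega (Q j).
  apply: measurable_funM => //; apply: measurable_funB; apply: (potential_measurable pk0) => //.
  exact: measurable_G.
have Qbd j x : (`|Q j x| <= LL * `|Dw x|)%R.
  rewrite /Q normrM ger0_norm//; have := k0_lip (G phi0 x) (t j *: Dw x)%R.
  rewrite normrZ gtr0_norm// mulrCA => /(ler_wpM2l (ler0n R j.+2)) => /le_trans; apply.
  by rewrite (mulrA j.+2%:R) tE mul1r.
have iQ j : leb.-integrable Omega (EFin \o Q j).
  exact: (integrable_dominated (mQ j) (integrable_norm1 iD) LL0 (Qbd j)).
(* Minimality against [ph j], with [k0] and [l0] kept fixed: the integral of [l0] cancels, convexity
   bounds the energy, and the remainder is divided by [t j]. *)
have Qge j : a - b <= \int[leb]_(x in Omega) (Q j x)%:E.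
  have := J_min (A0t j); rewrite /J -/a.
  have Ek : \int[leb]_(x in Omega) (k0 (G (ph j) x))%:E =
      \int[leb]_(x in Omega) (k0 (G phi0 x + t j *: Dw x)%R)%:E.
    apply: ae_eq_integral => //.
    - by apply/measurable_EFinP; apply: (potential_measurable pk0); exact: measurable_G.
    - by apply/measurable_EFinP; exact: (potential_measurable pk0).
    - by apply: filterS (Gph j) => x H Ox; rewrite H.
  have ikt : leb.-integrable Omega (EFin \o (fun x => k0 (G phi0 x + t j *: Dw x)%R)).
    apply: eq_integrable (integrableD mO (int_k pk0 Sphi0) (integrableZl mO (t j) (iQ j))) => //.
    move=> x _ /=; rewrite /Q -!(EFinM, EFinD); congr EFin.
    by rewrite (mulrA (t j)) (mulrC (t j)) tE mul1r subrKC.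
  have EQ : \int[leb]_(x in Omega) (Q j x)%:E = (j.+2%:R)%:E *
      (\int[leb]_(x in Omega) (k0 (G phi0 x + t j *: Dw x)%R)%:E -
       \int[leb]_(x in Omega) (k0 (G phi0 x))%:E).
    rewrite -(integralB mO ikt (int_k pk0 Sphi0)) -integralZl//.
    exact: (integrableB mO ikt (int_k pk0 Sphi0)).
  rewrite Ek EQ; have := conv j.
  have := integrable_fin_num mO ikt; have := integrable_fin_num mO (int_k pk0 Sphi0) => /=.
  move: afin bfin J_terms.1.
  case: (\int[leb]_(x in Omega) (k0 (G phi0 x))%:E) => // k1.
  case: (\int[leb]_(x in Omega) (k0 (G phi0 x + t j *: Dw x)%R)%:E) => // k2.
  case: (a) => // a'; case: (b) => // b'; case: (\int[leb]_(y in Lambda) l0 y) => // L _ _ _ _ _.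
  case: (\int[leb]_(x in Omega) conjugate f (ph j x)) => [c| |]//.
  rewrite -!(EFinM, EFinN, EFinD) !lee_fin => H1 H2.
  rewrite -(ler_pM2l (t0 j)) (mulrA (t j)) (mulrC (t j) j.+2%:R) tE mul1r.
  by move: H1; rewrite mulrBr mulrBl mul1r; set x := (_ * a')%R; set y := (_ * b')%R; lra.
have cvgQ : \int[leb]_(x in Omega) (Q j x)%:E @[j --> \oo] -->
    \int[leb]_(x in Omega) (dot (transport x) (Dw x))%:E.
  have [] := @dominated_convergence _ _ _ leb Omega mO (fun j x => (Q j x)%:E)
    (fun x => (dot (transport x) (Dw x))%:E) (fun x => LL%:E * (norm1 (Dw x))%:E) => //.
  - by move=> j; exact/measurable_EFinP.
  - by apply/measurable_EFinP; apply: measurable_dot => //; exact: measurable_transport.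
  - apply: filterS ae_smooth_G => x sm Ox; have sx := sm Ox.
    rewrite /transport mem_set//; apply: cvg_EFin; first exact: nearW.
    exact: has_gradient_directional (k0_gradient sx).
  - by apply: integrableZl => //; exact: (integrable_norm1 iD).
  - apply: aeW => x j _; rewrite lee_fin; apply: le_trans (Qbd j x) _.
    by rewrite ler_wpM2l// norm_le_norm1.
have ED : \int[leb]_(x in Omega) (dot (transport x) (Dw x))%:E = udiv phi - udiv phi0.
  rewrite /udiv -(integralB mO (iudiv Sphi) (iudiv Sphi0)).
  by apply: eq_integral => x _; rewrite dotBr EFinB.
have u1 : udiv phi \is a fin_num := integrable_fin_num mO (iudiv Sphi).
have u0 : udiv phi0 \is a fin_num := integrable_fin_num mO (iudiv Sphi0).
have H : a - b <= udiv phi - udiv phi0.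
  by rewrite -ED; exact: (cvge_to_ge cvgQ (nearW _ Qge)).
exact: (fin_num_swap afin bfin u1 u0 H).
Qed.

Lemma sube_pinfty_le (a b : \bar R) : a - +oo <= b.
Proof. by case: a => [a| |]; rewrite leNye. Qed.

Lemma transport_Phi (S_convex : convex_set (S : set (convex_lmodType (E -> Mx)))) :
  Phi Omega f S transport phi0.
Proof.
split=> //; apply/eqP; rewrite eq_le; apply/andP; split.
  by apply: ereal_sup_ubound; exists phi0.
apply: ge_ereal_sup => _ [phi Sphi <-].
have VE := V_integralE measurable_transport (fun x _ => transport_norm x).
rewrite !VE//; have [ifs|->] := conjugate_integral (S_measurable SW Sphi); last exact: sube_pinfty_le.
have := energy_variation S_convex Sphi ifs.
have u1 : udiv phi \is a fin_num := integrable_fin_num mO (iudiv Sphi).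
have u0 : udiv phi0 \is a fin_num := integrable_fin_num mO (iudiv Sphi0).
have b := integrable_fin_num mO ifs; have [_ a] := J_terms.
rewrite -/(udiv phi) -/(udiv phi0) => H.
exact: (fin_num_oppe_swap a b u1 u0 H).
Qed.

(** * Weak duality and uniqueness for admissible maps *)

Section admissible_map.
Context (u : E -> E).
Hypothesis U1u : U1_S Omega Lambda q S u.

Let mu : measurable_fun Omega u. Proof. by case: U1u => -[]. Qed.

Let uM x : Omega x -> (`|u x| <= M)%R.
Proof. by case: U1u => -[_ H _] _ Ox; apply: closure_norm_le LM _; exact: H. Qed.

Let utest := U1u.2.

(** Admissible maps take values in [closure Lambda], where [l] may be infinite on the boundary.
    Replacing [l] by 0 off [Lambda] changes [l (u x)] only on a null set of [x] in [Omega] and gives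
    a nonnegative integrand. *)
Definition on_target (l : E -> \bar R) y := if y \in Lambda then l y else 0.

Lemma out_Lambda : exists z, ~ Lambda z.
Proof.
exists (const_mx (M + 1))%R => /LM H.
have := le_trans (mx_coord_le_norm (const_mx (M + 1) : E)%R ord0 (Ordinal d_gt0)) H.
by rewrite mxE => /(le_trans (ler_norm _)); lra.
Qed.

Lemma measurable_on_target (l : E -> \bar R) : measurable_fun setT l ->
  measurable_fun setT (on_target l).
Proof.
move=> ml; rewrite (_ : on_target l = l \_ Lambda).
  by apply/(measurable_restrictT _ mL); exact: measurable_funTS.
by apply/funext => y; rewrite /on_target /patch.
Qed.

Lemma on_target_integral (l : E -> \bar R) : measurable_fun setT l ->
  (forall y, Lambda y -> 0 <= l y) ->
  \int[leb]_(x in Omega) on_target l (u x) = \int[leb]_(y in Lambda) l y.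
Proof.
move=> ml l0'; have [z nz] := out_Lambda.
rewrite (preserving_integral mO mL Ooo Loo mu utest nz).
- by apply: eq_integral => y yL; rewrite /on_target yL.
- exact: measurable_on_target.
- by move=> y Ly; rewrite /on_target mem_set// l0'.
- by move=> y nLy; rewrite /on_target memNset.
Qed.

Lemma ae_in_Lambda : {ae leb, forall x, Omega x -> Lambda (u x)}.
Proof. exact: (preserving_ae mO mL Ooo Loo mu utest). Qed.

Let iuG phi : S phi -> leb.-integrable Omega (EFin \o (fun x => dot (u x) (G phi x))).
Proof.
move=> Sphi; apply: (dot_integrable mu uM); first exact: measurable_G.
by move=> j; exact: integrable_G.
Qed.

Let iuF : leb.-integrable Omega (EFin \o (fun x => dot (u x) (F x))).
Proof. exact: (dot_integrable mu uM mF iF). Qed.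

Let iuw phi : S phi -> leb.-integrable Omega (EFin \o (fun x => dot (u x) (wdiv Omega phi x))).
Proof.
move=> Sphi; apply: (dot_integrable mu uM); first exact: measurable_wdiv.
by move=> j; exact: (S_wdiv_integrable oO bO q1 SW ord0 j Sphi).
Qed.

Lemma V_minus_F phi : S phi ->
  V_integral Omega f u phi - \int[leb]_(x in Omega) (dot (F x) (u x))%:E =
  - (\int[leb]_(x in Omega) (dot (u x) (G phi x))%:E +
     \int[leb]_(x in Omega) conjugate f (phi x)).
Proof.
move=> Sphi; rewrite (V_integralE mu uM Sphi).
have -> : \int[leb]_(x in Omega) (dot (F x) (u x))%:E = \int[leb]_(x in Omega) (dot (u x) (F x))%:E.
  by apply: eq_integral => x _; rewrite dotC.
have -> : \int[leb]_(x in Omega) (dot (u x) (G phi x))%:E =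
    \int[leb]_(x in Omega) (dot (u x) (F x))%:E +
    \int[leb]_(x in Omega) (dot (u x) (wdiv Omega phi x))%:E.
  rewrite -(integralD mO iuF (iuw Sphi)).
  by apply: eq_integral => x _; rewrite dotDr EFinD.
have := integrable_fin_num mO iuF; have := integrable_fin_num mO (iuw Sphi) => /=.
case: (\int[leb]_(x in Omega) (dot (u x) (wdiv Omega phi x))%:E) => // a _.
case: (\int[leb]_(x in Omega) (dot (u x) (F x))%:E) => // b _.
case: (\int[leb]_(x in Omega) conjugate f (phi x)) => // c.
by rewrite -!(EFinN, EFinD); congr EFin; lra.
Qed.

Lemma transport_cost_le k l phi : A0 Lambda S k l phi ->
  \int[leb]_(x in Omega) (dot (u x) (G phi x))%:E <=
  \int[leb]_(x in Omega) (kpot Lambda l (G phi x))%:E + \int[leb]_(y in Lambda) l y.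
Proof.
move=> A; have [Sphi _ [ml _ _ _ _]] := A.
have pk := A0_kpot_potential A; have ik := int_k pk Sphi.
rewrite -(on_target_integral ml (A0_ge0 A)).
have kfin : \int[leb]_(x in Omega) (kpot Lambda l (G phi x))%:E \is a fin_num.
  exact: (integrable_fin_num mO ik).
rewrite addeC -leeBlDr// -(integralB mO (iuG Sphi) ik).
have mg := measurable_int _ (integrableB mO (iuG Sphi) ik).
pose g x := (dot (u x) (G phi x))%:E - (kpot Lambda l (G phi x))%:E.
have l_ge0 y : 0 <= on_target l y.
  by rewrite /on_target; case: ifPn => //; rewrite inE => Ly; exact: (A0_ge0 A).
(* The integral of [l] may be [+oo]; passing to the positive part allows a comparison of nonnegative
   functions. *)
apply: (@le_trans _ _ (\int[leb]_(x in Omega) g^\+ x)).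
  apply: le_integral_measurable => //; first exact: measurable_funepos.
  by move=> x _; rewrite funeposE le_max lexx.
apply: ae_ge0_le_integral => //.
- exact: measurable_funepos.
- by apply: measurableT_comp mu; exact: measurable_on_target.
apply: filterS ae_in_Lambda => x H Ox; have Lx := H Ox.
rewrite funeposE ge_max l_ge0 andbT /g /on_target mem_set// leeBlDr// addeC.
exact: (kpot_ge LM (A0_ge0 A) L0 (A0_fin A L0)).
Qed.

Lemma weak_duality k l phi : A0 Lambda S k l phi ->
  - J Omega Lambda f F k l phi <= I0 Omega f S F u.
Proof.
move=> A; have [Sphi _ _] := A.
apply: (@le_trans _ _ (V_integral Omega f u phi - \int[leb]_(x in Omega) (dot (F x) (u x))%:E)).
  rewrite V_minus_F// leeN2; apply: le_trans (A0_J_ge A).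
  exact: (leeD (transport_cost_le A) (lexx _)).
by apply: leeD2r; apply: ereal_sup_ubound; exists phi.
Qed.

(** Optimality leaves no room in weak duality: the Fenchel gap [W] is nonnegative almost everywhere
    with integral at most zero, hence vanishes, and [u x] is a subgradient of [k0] at a point of
    differentiability. *)
Lemma minimizer_unique : I0 Omega f S F u <= - J Omega Lambda f F k0 l0 phi0 ->
  {ae leb, forall x, Omega x -> u x = transport x}.
Proof.
move=> uopt; have [fl fc] := J_terms.
have le1 : V_integral Omega f u phi0 - \int[leb]_(x in Omega) (dot (F x) (u x))%:E <=
    I0 Omega f S F u by apply: leeD2r; apply: ereal_sup_ubound; exists phi0.
have {le1 uopt} := le_trans le1 uopt.
rewrite V_minus_F// leeN2 /J leeD2rE// => le2.
have ml0 : measurable_fun setT l0 := measurable_legendre _.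
have ot := on_target_integral ml0 (fun y _ => l0_ge0 y).
have ot0 y : 0 <= on_target l0 y by rewrite /on_target; case: ifPn.
have mot : measurable_fun Omega (fun x => on_target l0 (u x)).
  by apply: measurableT_comp mu; exact: measurable_on_target.
have iot : leb.-integrable Omega (fun x => on_target l0 (u x)).
  apply/integrableP; split=> //; rewrite (eq_integral (fun x => on_target l0 (u x))).
    by rewrite ot; move: fl; rewrite fin_numElt => /andP[].
  by move=> x _; rewrite gee0_abs.
have ik := int_k pk0 Sphi0; have iu := iuG Sphi0.
pose W x := (k0 (G phi0 x))%:E + on_target l0 (u x) - (dot (u x) (G phi0 x))%:E.
have iW : leb.-integrable Omega W := integrableB mO (integrableD mO ik iot) iu.
have Wpos : {ae leb, forall x, Omega x -> 0 <= W x}.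
  apply: filterS ae_in_Lambda => x H Ox; have Lx := H Ox.
  rewrite /W sube_ge0// ?fin_numE//= /on_target mem_set//.
  exact: (fenchel_young (u x) (G phi0 x) pk0.2).
have IW : \int[leb]_(x in Omega) `|W x| = 0.
  have -> : \int[leb]_(x in Omega) `|W x| = \int[leb]_(x in Omega) W x.
    apply: ae_eq_integral => //.
    - by apply: measurableT_comp => //; case/integrableP: iW.
    - by case/integrableP: iW.
    - by apply: filterS Wpos => x H Ox; rewrite gee0_abs// H.
  apply/eqP; rewrite eq_le; apply/andP; split; last first.
    apply: (@le_trans _ _ (\int[leb]_(x in Omega) `|W x|)); first exact: integral_ge0.
    rewrite le_eqVlt; apply/orP; left; apply/eqP; apply: ae_eq_integral => //.
    - by apply: measurableT_comp => //; case/integrableP: iW.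
    - by case/integrableP: iW.
    - by apply: filterS Wpos => x H Ox; rewrite gee0_abs// H.
  rewrite /W (integralB mO (integrableD mO ik iot) iu) (integralD mO ik iot).
  rewrite leeBlDr ?add0e; last exact: (integrable_fin_num mO iu).
  by rewrite ot.
have W0 : {ae leb, forall x, Omega x -> W x = 0}.
  by apply/(ae_eq_integral_abs leb mO) => //; case/integrableP: iW.
move: (ae_smooth_G) (ae_in_Lambda) W0; apply: filterS3 => x sm inL W0 Ox.
have sx := sm Ox; have Lx := inL Ox.
rewrite /transport mem_set//; apply: subgradient_unique => //.
have := W0 Ox; rewrite /W /on_target mem_set//.
case: (l0 (u x)) (l0_fin Lx) => // a _.
by rewrite -!(EFinN, EFinD) lee_fin => -[]; lra.
Qed.

End admissible_map.

(** [phi0] attains the supremum defining [V], and Fenchel's inequality is an equality along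
    gradients; the two inequalities of weak duality thus become equalities. *)
Lemma transport_value (S_convex : convex_set (S : set (convex_lmodType (E -> Mx)))) :
  I0 Omega f S F transport = - J Omega Lambda f F k0 l0 phi0.
Proof.
have [_ VE] := transport_Phi S_convex; rewrite /I0 -VE.
rewrite (V_minus_F transport_U1 Sphi0); congr (- _); rewrite /J; congr (_ + _).
have ml0 : measurable_fun setT l0 := measurable_legendre _.
rewrite -(on_target_integral transport_U1 ml0 (fun y _ => l0_ge0 y)).
have ik := int_k pk0 Sphi0.
have iu : leb.-integrable Omega (EFin \o (fun x => dot (transport x) (G phi0 x))).
  apply: (dot_integrable measurable_transport (fun x _ => transport_norm x)).
    exact: measurable_G.
  by move=> j; exact: integrable_G.
have kfin := integrable_fin_num mO ik; have ufin := integrable_fin_num mO iu.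
have -> : \int[leb]_(x in Omega) on_target l0 (transport x) =
    \int[leb]_(x in Omega) ((dot (transport x) (G phi0 x))%:E - (k0 (G phi0 x))%:E).
  apply: ae_eq_integral => //.
  - by apply: measurableT_comp measurable_transport; exact: measurable_on_target.
  - by case/integrableP: (integrableB mO iu ik).
  - move: (ae_smooth_G) (ae_in_Lambda transport_U1); apply: filterS2 => x sm inL Ox.
    have sx := sm Ox; have Lx := inL Ox.
    rewrite /on_target mem_set// /transport mem_set// fenchel_gradient//.
rewrite (integralB mO iu ik) addeCA subee ?adde0//.
Qed.

End optimality.

End dual_problem.

Theorem theorem4p3 (R : realType) (d : nat) (d_gt0 : (0 < d)%N)
    (Omega Lambda : set 'rV[R]_d) (r p q : R)
    (f : 'M[R]_d -> R) (S : set ('rV[R]_d -> 'M[R]_d))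
    (F : 'rV[R]_d -> 'rV[R]_d)
    (Omega_open : open Omega) (Omega_bounded : bounded_set Omega)
    (Omega_convex : convex_set (Omega : set (convex_lmodType 'rV[R]_d)))
    (Lambda_open : open Lambda) (Lambda_bounded : bounded_set Lambda)
    (Lambda_convex : convex_set (Lambda : set (convex_lmodType 'rV[R]_d)))
    (r_gt1 : 1 < r)
    (ball_Lambda : eball 0 r^-1 `<=` Lambda)
    (Lambda_ball : Lambda `<=` eball 0 (r / 2))
    (p_gt1 : 1 < p) (pq : p^-1 + q^-1 = 1)
    (same_volume : lebesgue_rV R d Omega = lebesgue_rV R d Lambda)
    (fS_A1 : A1 Omega p q f S)
    (F_A3 : A3 Omega F)
    (S_finite_dim : finite_dimensional Omega S)
    (S_nonempty : S !=set0)
    (S_closed : closed_in_W01q Omega q S)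
    (S_convex : convex_set (S : set (convex_lmodType ('rV[R]_d -> 'M[R]_d))))
    (nondeg : forall phi, S phi -> nondegenerate_map Omega (F \+ wdiv Omega phi)) :
  inf_P0 Omega Lambda q f S F = sup_D0 Omega Lambda f S F /\
  exists (k0 : 'rV[R]_d -> R) (l0 : 'rV[R]_d -> \bar R)
         (phi0 : 'rV[R]_d -> 'M[R]_d),
    [/\ D0_maximizer Omega Lambda f S F k0 l0 phi0,
        EFin \o k0 = legendre l0,
        l0 = legendre (EFin \o k0) &
        exists u0 : 'rV[R]_d -> 'rV[R]_d,
          [/\ P0_minimizer Omega Lambda q f S F u0,
              (forall u, P0_minimizer Omega Lambda q f S F u ->
                 {ae lebesgue_rV R d, forall x, Omega x -> u x = u0 x}),
              {ae lebesgue_rV R d, forall x, Omega x ->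
                 is_gradient k0 (F x + wdiv Omega phi0 x) (u0 x)} &
              Phi Omega f S u0 phi0]].
Proof.
have [M Mgt0 LMbox] := bounded_set_cbox Lambda_bounded.
have LM y : Lambda y -> `|y| <= M.
  move=> /LMbox yM; apply: mx_norm_le => [|i j]; first exact: ltW.
  by have := yM j; rewrite !mxE (ord1 i) ler_norml.
have L0 : Lambda 0.
  apply: ball_Lambda; rewrite /eball /= subrr /enorm dot0r sqrtr0 invr_gt0.
  exact: lt_trans r_gt1.
have q1 : 1 <= q.
  have p0 : 0 < p by exact: lt_trans p_gt1.
  have pi : p^-1 < 1 by rewrite invf_lt1.
  have pi0 : 0 < p^-1 by rewrite invr_gt0.
  have qi0 : 0 < q^-1 by lra.
  have q0 : 0 < q by rewrite -invr_gt0.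
  by rewrite -(invf_le1 q0); lra.
have [SW _ [a [b [c [_ _ c0 fgrowth _]]]] [phi1 [Sphi1 e1]] _] := fS_A1.
have [mF iF'] := F_A3.
have f_bdd : forall m : R, exists C : R, forall x : 'M[R]_d,
    (forall i j, `|x i j| <= m) -> f x <= C.
  apply: (growth_bounded (p := p) (c := c) (b := b)); [exact: lt_trans p_gt1|exact: ltW|].
  by move=> xi; have [_] := fgrowth xi.
have iF j : (lebesgue_rV R d).-integrable Omega (EFin \o (fun x => F x ord0 j)).
  apply: le_integrable iF'; first exact: measurable_open.
    by apply/measurable_EFinP; exact: measurable_mx_entry.
  move=> x _; rewrite lee_fin; apply: le_trans (coord_le_enorm _ _ _) (ler_norm _).
have S_energy : exists2 phi, S phi &
    (\int[lebesgue_rV R d]_(x in Omega) conjugate f (phi x))%E \is a fin_num.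
  by exists phi1.
have [k0 [phi0 [pk0 l0K kpot_l0 A00 [J_fin J_min]]]] :=
  dual_exists d_gt0 Omega_open Omega_bounded Lambda_open Lambda_bounded Lambda_convex
    L0 LM same_volume q1 SW S_closed S_finite_dim f_bdd mF iF S_energy.
set l0 := legendre (EFin \o k0) in l0K kpot_l0 A00 J_fin J_min *.
have Sphi0 : S phi0 by case: A00.
have nd := nondeg _ Sphi0.
pose u0 := transport Omega F k0 phi0.
have u0_U1 : U1_S Omega Lambda q S u0.
  exact: (transport_U1 d_gt0 Omega_open Omega_bounded Lambda_open Lambda_bounded
    Lambda_convex L0 LM same_volume q1 SW S_finite_dim mF iF pk0 l0K kpot_l0 A00 J_fin J_min nd).
have u0_value : I0 Omega f S F u0 = (- J Omega Lambda f F k0 l0 phi0)%E.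
  exact: (transport_value d_gt0 Omega_open Omega_bounded Lambda_open Lambda_bounded
    Lambda_convex L0 LM same_volume q1 SW S_finite_dim mF iF pk0 l0K kpot_l0 A00 J_fin J_min
    nd S_convex).
have weak u k l phi : U1_S Omega Lambda q S u -> A0 Lambda S k l phi ->
    (- J Omega Lambda f F k l phi <= I0 Omega f S F u)%E.
  move=> Uu A; exact: (weak_duality f d_gt0 Omega_open Omega_bounded Lambda_open
    Lambda_bounded L0 LM q1 SW mF iF Uu A).
split.
  (* Both problems have the value [- J] at the dual minimiser: [u0] attains it, weak duality bounds
     the infimum from below, and minimality of [J] bounds the supremum from above. *)
  apply: (@etrans _ _ (- J Omega Lambda f F k0 l0 phi0)%E); apply/eqP; rewrite eq_le;
    apply/andP; split.
  - by rewrite -u0_value; apply: ereal_inf_lbound; exists u0.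
  - by apply: le_ereal_inf_tmp => _ [u Uu <-]; exact: weak.
  - by apply: ereal_sup_ubound; exists k0, l0, phi0.
  - by apply: ge_ereal_sup => _ [k [l [phi [A ->]]]]; rewrite leeN2; exact: J_min.
exists k0, l0, phi0; split=> //.
  by split=> // k l phi A; rewrite leeN2; exact: J_min.
exists u0; split.
- by split=> // v Uv; rewrite u0_value; exact: weak.
- move=> u [Uu umin].
  apply: (minimizer_unique d_gt0 Omega_open Omega_bounded Lambda_open Lambda_bounded
    L0 LM q1 SW mF iF pk0 l0K A00 J_fin nd Uu).
  by rewrite -u0_value; exact: umin.
- exact: (ae_transport_gradient d_gt0 L0 LM pk0 l0K nd).
- exact: (transport_Phi d_gt0 Omega_open Omega_bounded Lambda_bounded
    Lambda_convex L0 LM q1 SW mF iF pk0 l0K A00 J_fin J_min nd S_convex).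
Qed.
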